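(* Let $n$ be a nonnegative integer. The error function $E_n(\alpha)$ is (real) analytic in $\alpha$ on $(-1,1)$, with the exception of the endpoints and the tips of V-shapes of $E_n$. The same holds for the alternation points $u_i(\alpha)$, $v_j(\alpha)$ and for the coefficients of the minimax polynomial $p_n(x;\alpha)$.
   Context: For $\alpha\in[-1,1]$ let $f(x;\alpha)=|x-\alpha|$, $x\in[-1,1]$. For a nonnegative integer $n$ let $\mathbb{P}_n$ be the space of real polynomials of degree at most $n$, $\|\cdot\|$ the uniform norm on $[-1,1]$, $E_n(\alpha)=\min_{q\in\mathbb{P}_n}\|f(\cdot;\alpha)-q\|$, and let $p_n(x;\alpha)=c_nx^n+\dots+c_1x+c_0\in\mathbb{P}_n$ be the unique minimizer (the minimax polynomial), with coefficients $c_m=c_m(\alpha)$. V-shapes: $E_n$ has a V-shape on $[a,b]$ if there is $c\in(a,b)$ such that $E_n$ is continuous on $[a,b]$, linear and decreasing on $[a,c]$, and linear and increasing on $[c,b]$. If $[a,b]$ is a maximal interval with this property, it is called a V-shape of $E_n$; $a,b$ are its endpoints and $c$ is its tip. Alternation points: for $\alpha\in(-1,1)$, the alternation points are the points $x\in[-1,1]$ with $|f(x;\alpha)-p_n(x;\alpha)|=E_n(\alpha)$; it is known that the signs of $f-p_n$ alternate along them, that there are exactly $n+2$ or $n+3$ of them, that $n+3$ occurs only at tips of V-shapes, and that $\alpha$ is always one of them, with $p_n(\alpha;\alpha)=E_n(\alpha)$. Those to the left of $\alpha$ are denoted $u_i=u_i(\alpha)$ and those to the right $v_j=v_j(\alpha)$,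 enumerated by distance to $\alpha$: the alternation set is $$\mathcal{A}_n(\alpha)=\{u_{k+1}(\alpha)<\dots<u_1(\alpha)<\alpha<v_1(\alpha)<\dots<v_{\ell+1}(\alpha)\},$$ where $k=k(\alpha)$, $\ell=\ell(\alpha)$. It is known that if $\alpha$ is not in a V-shape of $E_n$ then there are exactly $n+2$ alternation points and $\pm1$ are among them, so $u_{k+1}=-1$, $v_{\ell+1}=1$ and $k+\ell=n-1$. *)

(* Defs.v *)
From HB Require Import structures.
From mathcomp Require Import all_boot all_order all_algebra finmap.
From mathcomp Require Import all_classical all_reals all_analysis.

Set Implicit Arguments.
Unset Strict Implicit.
Unset Printing Implicit Defensive.

Import Order.TTheory GRing.Theory Num.Theory.
Import numFieldNormedType.Exports.

Local Open Scope classical_set_scope.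
Local Open Scope ring_scope.

Definition unorm (R : realType) (g : R -> R) : R :=
  sup [set `|g x| | x in `[-1, 1]].

Definition approx_err (R : realType) (alpha : R) (q : {poly R}) (x : R) : R :=
  `|x - alpha| - q.[x].

Definition Eerr (R : realType) (n : nat) (alpha : R) : R :=
  inf [set unorm (approx_err alpha q) | q in [set q : {poly R} | (size q <= n.+1)%N]].

(* [xget] chooses a minimizer; it is well known to exist and to be unique when
   alpha lies in [-1, 1], which is the only range used. *)
Definition minimax (R : realType) (n : nat) (alpha : R) : {poly R} :=
  xget 0 [set q : {poly R} |
    (size q <= n.+1)%N /\ unorm (approx_err alpha q) = Eerr n alpha].

Definition alternation (R : realType) (n : nat) (alpha : R) : set R :=
  [set x | x \in `[-1, 1] /\
           `|approx_err alpha (minimax n alpha) x| = Eerr n alpha].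

(* The alternation points on either side of alpha, enumerated by increasing
   distance to alpha.  [fset_set] lists the elements of a finite set, and the
   alternation set is finite for -1 < alpha < 1. *)
Definition left_alt (R : realType) (n : nat) (alpha : R) : seq R :=
  sort >=%R (fset_set (alternation n alpha `&` [set x | x < alpha])).

Definition right_alt (R : realType) (n : nat) (alpha : R) : seq R :=
  sort <=%R (fset_set (alternation n alpha `&` [set x | alpha < x])).

(* Indices start at 0: [u_pt n i] is u_(i+1) and [v_pt n j] is v_(j+1).  They are
   meaningful only when i < size (left_alt n alpha), which is k(alpha) + 1, and
   j < size (right_alt n alpha), which is l(alpha) + 1. *)
Definition u_pt (R : realType) (n i : nat) (alpha : R) : R :=
  nth 0 (left_alt n alpha) i.

Definition v_pt (R : realType) (n j : nat) (alpha : R) : R :=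
  nth 0 (right_alt n alpha) j.

Definition linear_on (R : realType) (E : R -> R) (a b : R) : Prop :=
  exists s t : R, {in `[a, b], forall x, E x = s * x + t}.

Definition has_Vshape (R : realType) (E : R -> R) (a c b : R) : Prop :=
  [/\ a < c < b,
      {within `[a, b], continuous E},
      linear_on E a c /\ {in `[a, c] &, {homo E : x y /~ x < y}} &
      linear_on E c b /\ {in `[c, b] &, {homo E : x y / x < y}}].

(* [a, b] is a maximal interval, within the domain [-1, 1] of E_n, on which E
   has a V-shape, and c is its tip. *)
Definition is_Vshape (R : realType) (E : R -> R) (a c b : R) : Prop :=
  [/\ -1 <= a /\ b <= 1,
      has_Vshape E a c b &
      forall a' c' b' : R,
        -1 <= a' -> b' <= 1 -> has_Vshape E a' c' b' ->
        a' <= a -> b <= b' -> a' = a /\ b' = b].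

Definition Vshape_exceptional (R : realType) (E : R -> R) (x : R) : Prop :=
  exists a c b : R, is_Vshape E a c b /\ [\/ x = a, x = c | x = b].

Definition analytic_at (R : realType) (g : R -> R) (x0 : R) : Prop :=
  exists (r : R) (a : R^nat), 0 < r /\
    forall x : R, `|x - x0| < r -> pseries a (x - x0) @ \oo --> g x.

(* Main.v *)
(* Write e = |x - a| - p for the error of the minimax polynomial p.  If e has n + 3
   alternation points, dropping the first or the last one and rescaling what remains to
   [-1, 1] gives the minimax polynomials of the neighbouring parameters, on which E_n is
   therefore linear: a is the tip of a V-shape.  Otherwise there are n + 2 points.  The
   zigzags of e force sign changes of p'', and a degenerate point would allow one zigzag
   too many after a small perturbation of p; hence the interior alternation points are
   nondegenerate and |p'(a)| < 1.  If e' vanishes at an end point of [-1, 1], following p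
   beyond that end and rescaling shows that a is an end point of a V-shape.  In the
   remaining case the alternation conditions form a nonsingular system, which Horner's
   scheme makes quadratic; it is solved by convergent power series in the parameter, by an
   iteration that contracts for a weighted l^1 norm of coefficients.  By compactness the
   error of the perturbed polynomial remains bounded by its values at the perturbed
   points, so by alternation it is the minimax polynomial. *)
Require Import Defs.
From HB Require Import structures.
From mathcomp Require Import all_boot all_order all_algebra finmap.
From mathcomp Require Import all_classical all_reals all_analysis.
From mathcomp Require Import qpoly polyrcf ring lra zify.
Import Order.TTheory GRing.Theory Num.Theory.
Import numFieldNormedType.Exports.
Local Open Scope classical_set_scope.
Local Open Scope ring_scope.

Set Implicit Arguments.
Unset Strict Implicit.
Unset Printing Implicit Defensive.

(** * Alternation and zigzags *)

(** Zigzags ask for strict changes of direction, not for equal levels. They survive a small change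
    of [p], so a perturbation that creates an extra extremum already contradicts the bound on their
    length; no alternation has to be preserved. The kink accounts for the additional points: there
    [e'] may pass from negative to positive without help from [p''], and this lost sign costs two
    places in the alternation of [p'']. The arms of the V-shapes found here lie on lines through (1,
    0) or (-1, 0), because a homothety fixing an end of [-1, 1] multiplies the error, and the
    distance of the kink to that end, by the same ratio. In the analytic part the intermediate
    Horner values of [p] and [p'] are unknowns too, so that every equation has at most one product
    of unknowns. The norm keeps the iterates bounded, while their coefficients converge because each
    step fixes one more of them. *)

Lemma divided_difference_coef (K : fieldType) (m : nat) (x : nat -> K) (p : {poly K}) :
  injective x -> (size p <= m.+1)%N ->
  \sum_(i < m.+1) p.[x i] / \prod_(j < m.+1 | j != i) (x i - x j) = p`_m.
Proof.
move=> xI sp; rewrite {2}(lagrange_gen (ltn0Sn m) xI sp) coef_sum.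
apply: eq_bigr => i _; rewrite lagrangeE // mulrA -polyCM coefCM -mulrA; congr (_ * _).
rewrite horner_prod; under [in RHS]eq_bigr do rewrite hornerXsubC.
suff -> : (\prod_(j < m.+1 | j != i) ('X - (x j)%:P))`_m = 1 by rewrite mulr1.
have mon : \prod_(j < m.+1 | j != i) ('X - (x j)%:P) \is monic.
  by apply: monic_prod => j _; exact: monicXsubC.
have sz : size (\prod_(j < m.+1 | j != i) ('X - (x j)%:P)) = m.+1.
  rewrite size_prod /=; last by move=> j _; rewrite polyXsubC_eq0.
  rewrite (eq_bigr (fun=> (2 * 1)%N)); last by move=> j _; rewrite size_XsubC.
  by rewrite -big_distrr /= sum1_card cardC1 card_ord /= mul2n -addnn -addSn addnK.
by move/monicP: mon; rewrite lead_coefE sz.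
Qed.

(** Exactly the m - i factors with j > i are negative. *)
Lemma sgr_prod_subr (R : realDomainType) (m : nat) (x : nat -> R) (i : 'I_m.+1) :
  {homo x : i j / (i < j)%N >-> i < j} ->
  0 < (-1) ^+ (m - i) * \prod_(j < m.+1 | j != i) (x i - x j).
Proof.
move=> xh.
have -> : (-1) ^+ (m - i) = \prod_(j < m.+1 | j != i) (-1) ^+ (i < j)%N :> R.
  rewrite -expr_sum; congr (_ ^+ _).
  have -> : (\sum_(j < m.+1 | j != i) (i < j) = \sum_(j < m.+1) (i < j))%N.
    by rewrite [RHS](bigD1 i) //= ltnn.
  rewrite -(big_mkord xpredT (fun j => (i < j)%N : nat)) (@big_cat_nat _ _ _ i.+1) //=.
  rewrite big_nat big1 ?add0n; last by move=> j; case: ltnP => //; lia.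
  rewrite big_nat (eq_bigr (fun=> 1%N)) -?big_nat ?sum_nat_const_nat ?muln1 ?subSS //.
  by move=> j /andP [-> _].
rewrite -big_split /=; apply: prodr_gt0 => j ji.
case: ltngtP => [ij|ij|ij]; last by rewrite (val_inj ij) eqxx in ji.
  by rewrite expr1 mulN1r opprB subr_gt0 xh.
by rewrite expr0 mul1r subr_gt0 xh.
Qed.

(** The divided difference of [p] at the m + 1 points is its coefficient of degree m, which is zero.
    The alternation gives all its terms the same sign, so each vanishes and [p] has m + 1 roots.
    This avoids counting zeros with multiplicity. *)
Lemma weak_alternation_eq0 (R : realFieldType) (m : nat) (x : nat -> R) (t : R)
    (p : {poly R}) :
  (forall i, (i < m)%N -> x i < x i.+1) -> t != 0 -> (size p <= m)%N ->
  (forall i, (i <= m)%N -> 0 <= t * (-1) ^+ i * p.[x i]) -> p = 0.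
Proof.
move=> xinc t0 sp psgn.
(* Interpolation wants an injective sequence on all of [nat]; beyond index m it continues with unit
   steps. *)
pose y i := if (i <= m)%N then x i else x m + (i - m)%:R.
have yS i : y i < y i.+1.
  rewrite /y; case: (ltngtP i m) => im; first by apply: xinc.
    by rewrite ltrD2l ltr_nat; lia.
  by rewrite im ltrDl ltr0n; lia.
have yh : {homo y : i j / (i < j)%N >-> i < j}.
  move=> i j; elim: j => // j IH; rewrite ltnS leq_eqVlt => /predU1P [->//|/IH h].
  exact: lt_trans h (yS j).
have yI : injective y.
  move=> i j yij; case: (ltngtP i j) => // /yh; rewrite yij ltxx //.
have yx (i : 'I_m.+1) : y i = x i by rewrite /y -ltnS ltn_ord.
have := divided_difference_coef yI (leqW sp).
rewrite nth_default // => /(congr1 (fun z => t * (-1) ^+ m * z)).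
rewrite mulr0 mulr_sumr => /eqP; rewrite psumr_eq0 => [/allP h|i _]; last first.
  have := sgr_prod_subr i yh; set d := \prod_(j < _ | _) _ => dpos.
  have -> : t * (-1) ^+ m * (p.[y i] / d) =
      (t * (-1) ^+ i * p.[y i]) / ((-1) ^+ (m - i) * d).
    have -> : (-1) ^+ m = (-1) ^+ (m - i) * (-1) ^+ i :> R.
      by rewrite -exprD subnK // -ltnS.
    have := sqrr_sign R (m - i); rewrite invfM; set s := (-1) ^+ (m - i) => s2.
    have s0 : s != 0 by rewrite signr_eq0.
    have -> : s^-1 = s by apply: (mulfI s0); rewrite mulfV // -expr2.
    ring.
  by rewrite divr_ge0 ?(ltW dpos) // yx psgn // -ltnS.
apply: (@roots_geq_poly_eq0 _ p [seq y (i : 'I_m.+1) | i <- enum 'I_m.+1]).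
- apply/allP => z /mapP [i _ ->]; have /implyP /(_ isT) := h i (mem_index_enum i).
  rewrite mulf_eq0 mulf_eq0 signr_eq0 (negPf t0) /= mulf_eq0 invr_eq0.
  case/orP => //; rewrite prodf_seq_eq0 => /hasP [j _ /andP [ji]].
  by rewrite subr_eq0 (inj_eq yI) => /eqP ij; rewrite (val_inj ij) eqxx in ji.
- by rewrite map_inj_uniq ?enum_uniq // => i j /yI /val_inj.
- by rewrite size_map size_enum_ord leqW.
Qed.

Lemma strict_alternation_size (R : realFieldType) (m : nat) (x : nat -> R) (t : R)
    (p : {poly R}) :
  (forall i, (i.+1 < m)%N -> x i < x i.+1) ->
  (forall i, (i < m)%N -> 0 < t * (-1) ^+ i * p.[x i]) -> (m <= size p)%N.
Proof.
case: m => // m xinc psgn; rewrite ltnNge; apply/negP => sp.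
have p0 : p = 0.
  apply: (@weak_alternation_eq0 _ m x t) => // [|i im]; last by rewrite ltW ?psgn.
  by apply: contraTneq (psgn 0%N isT) => ->; rewrite !mul0r ltxx.
by have := psgn 0%N isT; rewrite p0 horner0 mulr0 ltxx.
Qed.

(* The sign of t is the direction of the first increment. *)
Fixpoint zigzag (R : realType) (e : R -> R) (t : R) (s : seq R) : bool :=
  if s is x :: s' then
    (if s' is y :: _ then (x < y) && (0 < t * (e y - e x)) else true)
      && zigzag e (- t) s'
  else true.

Lemma zigzag_nth (R : realType) (e : R -> R) (t : R) (s : seq R) : zigzag e t s ->
  forall i, (i.+1 < size s)%N ->
  nth 0 s i < nth 0 s i.+1 /\
  0 < t * (-1) ^+ i * (e (nth 0 s i.+1) - e (nth 0 s i)).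
Proof.
elim: s t => // x [|y s] IH t // /andP [/andP [xy txy]] /IH {}IH [|i] iN.
  by rewrite expr0 mulr1.
have [h1 h2] := IH i iN; split; first exact: h1.
by move: h2; rewrite /= exprS mulrA mulrN1 !mulNr ?mulrN.
Qed.

Lemma le_of_step (R : realType) (f : nat -> R) (M : nat) :
  (forall i, (i.+1 < M)%N -> f i < f i.+1) ->
  forall i j, (i <= j)%N -> (j < M)%N -> f i <= f j.
Proof.
move=> fS i j; elim: j => [|j IH].
  by rewrite leqn0 => /eqP ->.
rewrite leq_eqVlt => /predU1P [-> //|]; rewrite ltnS => ij jM.
exact: le_trans (IH ij (ltnW jM)) (ltW (fS _ jM)).
Qed.

Lemma approx_err_side (R : realType) (a s : R) (p : {poly R}) (x : R) :
  `|s| = 1 -> 0 <= s * (x - a) -> approx_err a p x = s * (x - a) - p.[x].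
Proof.
by move=> s1 sx; rewrite /approx_err -[s * _]ger0_norm // normrM s1 mul1r.
Qed.

Lemma approx_err_mvt (R : realType) (a s : R) (p : {poly R}) (x y : R) :
  `|s| = 1 -> 0 <= s * (x - a) -> 0 <= s * (y - a) -> x < y ->
  exists2 z, x < z < y &
    approx_err a p y - approx_err a p x = (s - p^`().[z]) * (y - x).
Proof.
move=> s1 sx sy xy; have [z zxy e] := poly_mvt p xy.
exists z; first by move: zxy; rewrite in_itv.
rewrite !(approx_err_side _ s1) //.
have -> : p.[y] = p.[x] + p^`().[z] * (y - x) by rewrite -e; ring.
ring.
Qed.

(* The derivative of |x - a|; at the kink x = a the value 1 is arbitrary. *)
Definition slope (R : realType) (a : R) (x : R) : R := if x < a then -1 else 1.

Lemma normr_slope (R : realType) (a x : R) : `|slope a x| = 1.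
Proof. by rewrite /slope; case: ifP => _; rewrite ?normrN normr1. Qed.

(** If the kink lies inside, the increment is the sum of the increments on its two sides. One of
    them has the sign of t, and the mean value theorem applies on that side. *)
Lemma approx_err_increment_sign (R : realType) (a t : R) (p : {poly R}) (x y : R) :
  x < y -> 0 < t * (approx_err a p y - approx_err a p x) ->
  exists2 z, x < z < y & z != a /\ 0 < t * (slope a z - p^`().[z]).
Proof.
have oneside s u v : `|s| = 1 -> 0 <= s * (u - a) -> 0 <= s * (v - a) -> u < v ->
    (forall z, u < z < v -> z != a /\ slope a z = s) ->
    0 < t * (approx_err a p v - approx_err a p u) ->
    exists2 z, u < z < v & z != a /\ 0 < t * (slope a z - p^`().[z]).
  move=> s1 su sv uv hs; have [z zuv ->] := approx_err_mvt p s1 su sv uv.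
  rewrite mulrA pmulr_lgt0 ?subr_gt0 // => h; have [za zs] := hs z zuv.
  by exists z; rewrite // za zs.
have left u v : u < v -> v <= a ->
    0 < t * (approx_err a p v - approx_err a p u) ->
    exists2 z, u < z < v & z != a /\ 0 < t * (slope a z - p^`().[z]).
  move=> uv va; apply: (oneside (-1)) => //; rewrite ?normrN ?normr1 //; try lra.
  move=> z /andP [uz zv]; have za : z < a by exact: lt_le_trans va.
  by rewrite /slope za lt_eqF.
have right u v : u < v -> a <= u ->
    0 < t * (approx_err a p v - approx_err a p u) ->
    exists2 z, u < z < v & z != a /\ 0 < t * (slope a z - p^`().[z]).
  move=> uv au; apply: (oneside 1) => //; rewrite ?normr1 //; try lra.
  move=> z /andP [uz zv]; have za : a < z by exact: le_lt_trans uz.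
  by rewrite /slope ltNge ltW //= gt_eqF.
move=> xy h; case: (leP y a) => [ya|ay]; first exact: left.
case: (leP a x) => [ax|xa]; first exact: right.
have : 0 < t * (approx_err a p a - approx_err a p x) \/
       0 < t * (approx_err a p y - approx_err a p a).
  have e : t * (approx_err a p y - approx_err a p x) =
    t * (approx_err a p a - approx_err a p x) +
    t * (approx_err a p y - approx_err a p a) by ring.
  by move: h; rewrite e; set u := _ * _; set v := t * _; case: (ltP 0 u); [left|right; lra].
case=> [/(left _ _ xa (lexx _))|/(right _ _ ay (lexx _))] [z /andP [z1 z2] hz];
  exists z => //; lra.
Qed.

(** If u and v are on the same side of a, or if t = 1 and the jump of the slope goes against the
    change of sign, [p'] itself must change in the direction of t. For t = -1 across the kink, [p']
    decreases before or after a as soon as its value there leaves ]-1, 1[. Otherwise the jump alone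
    may explain the change of sign: this is the exceptional alternative. *)
Lemma slope_deriv_sign (R : realType) (a t : R) (p : {poly R}) (u v : R) :
  `|t| = 1 -> u < v -> u != a -> v != a ->
  0 < t * (slope a u - p^`().[u]) -> 0 < - t * (slope a v - p^`().[v]) ->
  (exists2 z, u < z < v & 0 < t * p^`()^`().[z]) \/
  (u < a < v /\ `|p^`().[a]| < 1).
Proof.
move=> t1 uv ua va hu hv.
have key x y : x < y -> 0 < t * (p^`().[y] - p^`().[x]) ->
    exists2 z, x < z < y & 0 < t * p^`()^`().[z].
  move=> xy; have [z zxy ->] := poly_mvt p^`() xy.
  by rewrite mulrA pmulr_lgt0 ?subr_gt0 // => h; exists z => //; move: zxy; rewrite in_itv.
case: (boolP (u < a < v)) => [uav|nuav]; last first.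
  left; apply: key => //; have : slope a u = slope a v.
    rewrite /slope; case: ltgtP nuav ua => // ua; case: ltgtP va => // av _;
      rewrite ?andbT //=; lra.
  by move=> e; rewrite e in hu; lra.
move: hu hv; case/andP: (uav) => ua' av; rewrite /slope ua' (lt_gtF av) => hu hv.
have [t_eq|t_eq] : t = 1 \/ t = -1.
  by case: (ler0P t) t1 => _ h; [right|left]; lra.
  by left; apply: key => //; rewrite t_eq in hu hv *; lra.
rewrite t_eq in hu hv key *.
case: (leP (p^`().[a]) (-1)) => h1.
  left; have [|z /andP [z1 z2] hz] := key u a ua'; first lra.
  by exists z => //; rewrite z1 (lt_trans z2).
case: (leP 1 p^`().[a]) => h2.
  left; have [|z /andP [z1 z2] hz] := key a v av; first lra.
  by exists z => //; rewrite z2 (lt_trans _ z1).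
by right; split => //; rewrite ltr_norml h1 h2.
Qed.

Lemma size_deriv2 (R : idomainType) (p : {poly R}) (n : nat) :
  (size p <= n.+1)%N -> (size p^`()^`() <= n.-1)%N.
Proof.
move=> sp; apply/leq_sizeP => i ni.
rewrite !coef_deriv nth_default ?mul0rn //; apply: leq_trans sp _.
by case: n ni => //= n; rewrite ltnS => /leqW.
Qed.

(* The zigzag forces alternating signs of e', hence of p'', except where the kink
   of |x - a| turns e' from negative to positive. *)
Lemma zigzag_bound (R : realType) (n : nat) (a t : R) (p : {poly R}) (s : seq R) :
  `|t| = 1 -> (size p <= n.+1)%N -> zigzag (approx_err a p) t s ->
  (n.+2 <= size s)%N -> (2 < size s)%N ->
  [/\ (size s <= n.+3)%N, nth 0 s 0 < a, a < last 0 s & `|p^`().[a]| < 1].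
Proof.
move=> t1 sp /zigzag_nth zz ns s2; set N := size s in zz ns s2 *.
pose X := nth 0 s.
have XS i : (i.+1 < N)%N -> X i < X i.+1 by move/zz => [].
have X_le := le_of_step XS.
have tsgn i : `|t * (-1) ^+ i| = 1 by rewrite normrM normrX normrN normr1 expr1n t1 mul1r.
have /choice [xi xiP] : forall i, exists z, (i.+1 < N)%N ->
    X i < z < X i.+1 /\ (z != a /\ 0 < t * (-1) ^+ i * (slope a z - p^`().[z])).
  move=> i; case: (ltnP i.+1 N) => iN; last by exists 0.
  have [xx h] := zz i iN.
  by have [z] := approx_err_increment_sign xx h; exists z.
have xiS i : (i.+2 < N)%N -> xi i < xi i.+1.
  move=> iN; have [/andP [_ h1] _] := xiP i (ltnW iN); have [/andP [h2 _] _] := xiP i.+1 iN.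
  exact: lt_trans h2.
(* In a [bad] place the change of sign of [e'] is attributed to the kink. *)
pose bad i := xi i < a < xi i.+1 /\ `|p^`().[a]| < 1.
have /choice [zt ztP] : forall i, exists z, (i.+2 < N)%N ->
    (xi i < z < xi i.+1 /\ 0 < t * (-1) ^+ i * p^`()^`().[z]) \/ bad i.
  move=> i; case: (ltnP i.+2 N) => iN; last by exists 0.
  have [_ [u1 u2]] := xiP i (ltnW iN); have [_ [v1 v2]] := xiP i.+1 iN.
  have [|[z z1 z2]|h] := slope_deriv_sign (tsgn i) (xiS i iN) u1 v1 u2 _.
  - by move: v2; rewrite exprS mulN1r mulrN.
  - by exists z => _; left.
  - by exists 0 => _; right.
have sq := size_deriv2 sp.
(* Without a bad place, [p''] would alternate at N - 2 points, too many for its degree. *)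
case: (pselect (exists2 b, (b.+2 < N)%N & bad b)) => [[b bN bb]|nobad]; last first.
  have : (N - 2 <= size p^`()^`())%N.
    apply: (@strict_alternation_size _ _ zt t) => i iN.
      have [h1|] := ztP i (ltac:(lia)); last by move=> ?; case: nobad; exists i => //; lia.
      have [h2|] := ztP i.+1 (ltac:(lia)); last by move=> ?; case: nobad; exists i.+1 => //; lia.
      by case: h1 => /andP [_ h1] _; case: h2 => /andP [h2 _] _; exact: lt_trans h2.
    have [[]//|?] := ztP i (ltac:(lia)); case: nobad; exists i => //; lia.
  move: sq ns s2; move: (size p^`()^`()) => k; lia.
have xi_le i j : (i <= j)%N -> (j.+1 < N)%N -> xi i <= xi j.
  move=> ij jN; apply: (@le_of_step _ xi N.-1) => //; last by lia.
  by move=> k kN; apply: xiS; lia.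
have good i : (i.+2 < N)%N -> i != b ->
    xi i < zt i < xi i.+1 /\ 0 < t * (-1) ^+ i * p^`()^`().[zt i].
  move=> iN ib; have [//|[/andP [ia ai] _]] := ztP i iN.
  have [/andP [ba ab] _] := bb; case: (ltngtP i b) => ib'; last by rewrite ib' eqxx in ib.
    by have := xi_le _ _ ib' ltac:(lia); lra.
  by have := xi_le _ _ ib' ltac:(lia); lra.
have [/andP [ba ab] pa] := bb.
have h4 : (N - 4 <= size p^`()^`())%N.
  (* Leaving out the index b alone would put two equal signs next to each other; leaving out b + 1
     as well restores the alternation. *)
  pose y i := if (i < b)%N then zt i else zt i.+2.
  apply: (@strict_alternation_size _ _ y t) => i iN; rewrite /y.
    case: (ltnP i b) => ib; last first.
      rewrite ltnNge leqW //=.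
      have [/andP [_ h1] _] := good i.+2 ltac:(lia) ltac:(lia).
      have [/andP [h2 _] _] := good i.+3 ltac:(lia) ltac:(lia).
      exact: lt_trans h2.
    have [/andP [_ h1] _] := good i ltac:(lia) ltac:(lia).
    case: (ltnP i.+1 b) => ib'.
      have [/andP [h2 _] _] := good i.+1 ltac:(lia) ltac:(lia).
      exact: lt_trans h2.
    have [/andP [h2 _] _] := good i.+3 ltac:(lia) ltac:(lia).
    by have := xi_le i.+1 i.+3 ltac:(lia) ltac:(lia); lra.
  case: (ltnP i b) => ib; first by have [] := good i ltac:(lia) ltac:(lia).
  have [_] := good i.+2 ltac:(lia) ltac:(lia).
  by rewrite !exprS !mulN1r !mulrN opprK.
split=> //.
- case: (leqP N n.+3) => // nN.
  (* For n = 0 the truncated bound on the size of [p''] gives only N <= 4, but then a single good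
     place contradicts [p'' = 0]. *)
  have n0 : n = 0%N by move: h4 sq; move: (size p^`()^`()) => k; lia.
  have p0 : p^`()^`() = 0 by apply/eqP; rewrite -size_poly_leq0; move: sq; rewrite n0.
  have [i iN ib] : exists2 i, (i.+2 < N)%N & i != b.
    by case: (posnP b) => [->|b0]; [exists 1%N|exists 0%N] => //; lia.
  by have [_] := good i iN ib; rewrite p0 horner0 mulr0 ltxx.
- have [/andP [h _] _] := xiP b (ltac:(lia)).
  by have := X_le 0%N b (leq0n _) ltac:(lia); rewrite /X in h *; lra.
- have [/andP [_ h] _] := xiP b.+1 (ltac:(lia)).
  have := X_le b.+2 N.-1 ltac:(lia) ltac:(lia); rewrite /X nth_last -/N in h *; lra.
Qed.

(** * Best approximation *)

Lemma continuous_approx_err (R : realType) (a : R) (p : {poly R}) :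
  continuous (approx_err a p).
Proof.
move=> x; rewrite /approx_err; apply: cvgB; last exact: continuous_horner.
by apply: cvg_norm; apply: cvgB; [exact: cvg_id|exact: cvg_cst].
Qed.

Lemma unorm_max (R : realType) (g : R -> R) : continuous g ->
  exists2 c, -1 <= c <= 1 & `|g c| = unorm g /\ forall x, -1 <= x <= 1 -> `|g x| <= unorm g.
Proof.
move=> gc; have [||c c1 cmax] := @EVT_max R (fun x => `|g x|) (-1) 1; first lra.
  by apply: continuous_subspaceT => x; apply: cvg_norm; exact: gc.
have has : has_sup [set `|g x| | x in `[-1, 1]].
  split; first by exists `|g c|; exists c.
  by exists `|g c| => _ [x x1 <-]; exact: cmax.
exists c; first by move: c1; rewrite in_itv.
have e : `|g c| = unorm g.
  apply/eqP; rewrite eq_le; apply/andP; split.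
    by apply: (sup_upper_bound has); exists c.
  by apply: ge_sup => [|_ [x x1 <-]]; [case: has|exact: cmax].
by split => // x x1; rewrite -e; apply: cmax; rewrite in_itv.
Qed.

Lemma unorm_le (R : realType) (g : R -> R) (M : R) : continuous g ->
  (forall x, -1 <= x <= 1 -> `|g x| <= M) -> unorm g <= M.
Proof. by move=> gc h; have [c c1 [<- _]] := unorm_max gc; exact: h. Qed.

Lemma le_unorm (R : realType) (g : R -> R) (x : R) : continuous g ->
  -1 <= x <= 1 -> `|g x| <= unorm g.
Proof. by move=> gc x1; have [c _ [_ h]] := unorm_max gc; exact: h. Qed.

Lemma unorm_ge0 (R : realType) (g : R -> R) : continuous g -> 0 <= unorm g.
Proof. by move=> gc; have [c c1 [<- _]] := unorm_max gc. Qed.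

(** Interpolation at the nodes 1/(i + 1) expresses the coefficients linearly in values on [-1, 1]; K
    adds up the absolute values of all coefficients of the Lagrange basis. This gives the
    compactness behind the existence of a best approximation. *)
Lemma coef_bound (R : realType) (n : nat) : exists K : R, forall (r : {poly R}) (B : R),
  (size r <= n.+1)%N -> (forall x, -1 <= x <= 1 -> `|r.[x]| <= B) ->
  forall m, `|r`_m| <= K * B.
Proof.
pose y (i : nat) : R := i.+1%:R^-1.
have yI : injective y by move=> i j /invr_inj /eqP; rewrite eqr_nat => /eqP [].
have y1 i : -1 <= y i <= 1.
  have : 0 < y i by rewrite invr_gt0 ltr0n.
  have : y i <= 1 by rewrite invf_le1 ?ltr0n // ler1n.
  lra.
pose c (i : 'I_n.+1) (m : nat) := `|(tnth (lagrange n.+1 y) i : {poly R})`_m|.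
exists (\sum_(m < n.+1) \sum_(i < n.+1) c i m) => r B sr rB m.
have B0 : 0 <= B by apply: le_trans (rB 0 _); rewrite ?normr_ge0 //; lra.
have c0 i k : 0 <= c i k by exact: normr_ge0.
case: (ltnP m n.+1) => mn; last first.
  rewrite nth_default ?normr0; last exact: leq_trans mn.
  by rewrite mulr_ge0 // sumr_ge0 // => k _; rewrite sumr_ge0.
rewrite (lagrange_gen (ltn0Sn n) yI sr) coef_sum mulr_suml.
apply: le_trans (_ : (\sum_(i < n.+1) c i m) * B <= _); last first.
  rewrite [leRHS](bigD1 (Ordinal mn)) //= lerDl sumr_ge0 // => k _.
  by rewrite mulr_ge0 // sumr_ge0.
rewrite mulr_suml (le_trans (ler_norm_sum _ _ _)) // ler_sum // => i _.
rewrite coefCM normrM mulrC ler_wpM2l // rB //.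
Qed.

Lemma row_entry_le_norm (R : realType) (d : nat) (v : 'rV[R]_d) (i : 'I_d) :
  `|v 0 i| <= `|v|.
Proof.
rewrite -[leRHS]/(mx_norm v) mx_normrE.
exact: (le_bigmax _ (fun ij : 'I_1 * 'I_d => `|v ij.1 ij.2|) (0, i)).
Qed.

Lemma horner_rVpoly_dist (R : realType) (d : nat) (u v : 'rV[R]_d) (x : R) :
  -1 <= x <= 1 -> `|(rVpoly u).[x] - (rVpoly v).[x]| <= d%:R * `|u - v|.
Proof.
move=> x1; rewrite -hornerN -hornerD -linearN -linearD.
rewrite (horner_coef_wide _ (size_poly _ _)).
apply: le_trans (ler_norm_sum _ _ _) _.
apply: le_trans (_ : \sum_(i < d) `|u - v| <= _); last first.
  by rewrite sumr_const card_ord mulr_natl.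
apply: ler_sum => i _; rewrite coef_rVpoly_ord normrM -[leRHS]mulr1.
apply: ler_pM => //; first exact: row_entry_le_norm.
by rewrite normrX exprn_ile1 // ler_norml.
Qed.

Lemma best_approx_exists (R : realType) (n : nat) (a : R) :
  exists2 q : {poly R}, (size q <= n.+1)%N &
    forall r : {poly R}, (size r <= n.+1)%N ->
      unorm (approx_err a q) <= unorm (approx_err a r).
Proof.
have ec := @continuous_approx_err R a.
pose F (v : 'rV[R]_n.+1) := unorm (approx_err a (rVpoly v)).
have Fd u v : F u <= F v + n.+1%:R * `|u - v|.
  apply: unorm_le => // x x1.
  have -> : approx_err a (rVpoly u) x =
    approx_err a (rVpoly v) x - ((rVpoly u).[x] - (rVpoly v).[x]).
    by rewrite /approx_err; ring.
  apply: le_trans (ler_normB _ _) _; apply: lerD; first exact: le_unorm.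
  exact: horner_rVpoly_dist.
have Fc : continuous F.
  move=> v; apply/(@cvgrPdist_lt _ _ _ (nbhs v) (nbhs_filter v)) => e e0.
  have h0 : \forall u \near v, `|v - u| < e / n.+1%:R.
    by apply: (@cvgr_dist_lt _ _ _ (nbhs v) (nbhs_filter v) id v cvg_id); rewrite divr_gt0.
  near=> u; have : `|v - u| < e / n.+1%:R by near: u; exact: h0.
  rewrite ltr_pdivlMr // mulrC => h.
  have h1 := Fd u v; have h2 := Fd v u; rewrite distrC in h1.
  by rewrite ltr_norml; apply/andP; split; lra.
have [K hK] := coef_bound R n.
(* A polynomial that does no worse than 0 is bounded on [-1, 1] by twice the error of 0, so its
   coefficients lie in the box of radius M. *)
set M := K * (2 * unorm (approx_err a 0)).
have M_ge (r : {poly R}) : (size r <= n.+1)%N -> unorm (approx_err a r) <= unorm (approx_err a 0) ->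
    forall m, `|r`_m| <= M.
  move=> sr hr; apply: hK => // x x1.
  have -> : r.[x] = approx_err a 0 x - approx_err a r x.
    by rewrite /approx_err horner0; ring.
  apply: le_trans (ler_normB _ _) _; rewrite mulr_natl mulr2n.
  by apply: lerD; [|apply: le_trans hr]; exact: le_unorm.
pose A := [set v : 'rV[R]_n.+1 | forall i, `[(- M), M]%classic (v ord0 i)].
have cA : compact A.
    by apply: (@rV_compact R n.+1 (fun=> `[(- M), M]%classic)) => i; exact: segment_compact.
have A0 : A 0.
  move=> i /=; rewrite mxE in_itv /=.
  have := M_ge 0 _ (lexx _) 0%N; rewrite size_poly0 coef0 normr0 => /(_ isT); lra.
have [||c cA' cmin] := @compact_EVT_min _ _ F A _ cA; first by exists 0.
  exact: continuous_subspaceT.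
exists (rVpoly c); first exact: size_poly.
move=> r sr.
have c0 : unorm (approx_err a (rVpoly c)) <= unorm (approx_err a 0).
  by have := cmin 0 (mem_set A0); rewrite /F linear0.
case: (leP (unorm (approx_err a r)) (unorm (approx_err a 0))) => hr; last first.
  exact: le_trans c0 (ltW hr).
have := cmin (poly_rV r); rewrite /F poly_rV_K //; apply; apply: mem_set => i /=.
by rewrite mxE in_itv /= -ler_norml M_ge.
Unshelve. all: by end_near. Qed.

Lemma minimax_spec (R : realType) (n : nat) (a : R) :
  (size (minimax n a) <= n.+1)%N /\ unorm (approx_err a (minimax n a)) = Eerr n a.
Proof.
suff [q hq] : exists q : {poly R},
    (size q <= n.+1)%N /\ unorm (approx_err a q) = Eerr n a.
  by have := @xgetPex _ 0 [set q : {poly R} | (size q <= n.+1)%N /\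
    unorm (approx_err a q) = Eerr n a]; apply; exists q.
have [q sq qmin] := best_approx_exists n a; exists q; split => //.
have lb : lbound [set unorm (approx_err a q) | q in [set q : {poly R} | (size q <= n.+1)%N]]
    (unorm (approx_err a q)) by move=> _ [r sr <-]; exact: qmin.
apply/eqP; rewrite eq_le; apply/andP; split.
  by apply: lb_le_inf => //; exists (unorm (approx_err a q)); exists q.
by apply: ge_inf; [exists (unorm (approx_err a q))|exists q].
Qed.

Lemma Eerr_le (R : realType) (n : nat) (a : R) (q : {poly R}) :
  (size q <= n.+1)%N -> Eerr n a <= unorm (approx_err a q).
Proof.
move=> sq; apply: ge_inf; last by exists q.
exists 0 => _ [r _ <-]; apply: unorm_ge0; exact: continuous_approx_err.
Qed.

(** Here t is the sign of the level at the first point, whereas in [zigzag] it is the direction of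
    the first step; hence the change of sign from one notion to the other. *)
Fixpoint alternates (R : realType) (e : R -> R) (E : R) (t : R) (s : seq R) : bool :=
  if s is x :: s' then
    [&& (if s' is y :: _ then x < y else true), e x == t * E
      & alternates e E (- t) s']
  else true.

Lemma alternates_nth (R : realType) (e : R -> R) (E t : R) (s : seq R) :
  alternates e E t s ->
  (forall i, (i.+1 < size s)%N -> nth 0 s i < nth 0 s i.+1) /\
  (forall i, (i < size s)%N -> e (nth 0 s i) = t * (-1) ^+ i * E).
Proof.
elim: s t => [|x s IH] t //= /and3P [xs /eqP ex] /IH [h1 h2]; split.
  by case=> [|i] iN; [case: s xs iN {IH h1 h2}|exact: h1].
case=> [|i] iN /=; first by rewrite expr0 mulr1.
by rewrite h2 // exprS mulrA mulrN1.
Qed.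

Lemma alternates_sorted (R : realType) (e : R -> R) (E t : R) (s : seq R) :
  alternates e E t s -> sorted <%R s.
Proof.
elim: s t => [|x s IH] t //= /and3P [xs _ /IH].
by case: s xs {IH} => //= y s ->.
Qed.

(** The difference of [p] and [q] alternates weakly at the points of s, so it vanishes. Since the
    hypothesis on [q] concerns these points alone, the lemma also identifies rescaled and reflected
    minimax polynomials. *)
Lemma alternates_unique (R : realType) (n : nat) (a t E : R) (p q : {poly R}) (s : seq R) :
  `|t| = 1 -> (size p <= n.+1)%N -> (size q <= n.+1)%N ->
  alternates (approx_err a p) E t s -> (n.+2 <= size s)%N ->
  (forall x, x \in s -> `|approx_err a q x| <= E) -> q = p.
Proof.
move=> t1 sp sq /alternates_nth [s_inc s_val] ns qE.
apply/eqP; rewrite -subr_eq0; apply/eqP.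
apply: (@weak_alternation_eq0 _ n.+1 (nth 0 s) t).
- by move=> i iN; apply: s_inc; lia.
- by rewrite -normr_gt0 t1.
- by rewrite (leq_trans (size_polyD _ _)) // size_polyN geq_max sq sp.
move=> i iN; have isz : (i < size s)%N by lia.
set u := t * _; have u1 : `|u| = 1 by rewrite normrM normrX normrN normr1 expr1n t1 mul1r.
have u2 : u * u = 1.
  by rewrite -expr2 -real_normK ?num_real // u1 expr1n.
have := qE _ (mem_nth 0 isz); have := s_val i isz; rewrite -/u /approx_err.
rewrite !hornerE => h1 h2.
have {}h2 : u * (`|s`_i - a| - q.[s`_i]) <= E.
  by apply: le_trans (ler_norm _) _; rewrite normrM u1 mul1r.
have e : E = u * (`|s`_i - a| - p.[s`_i]) by rewrite h1 mulrA u2 mul1r.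
rewrite mulrBr; rewrite e in h2; rewrite !mulrBr in h2; lra.
Qed.

(** Sufficiency in Chebyshev's theorem: the minimax polynomial has error at most E at the points of
    s, and uniqueness forces it to be [p]. *)
Lemma alternates_minimax (R : realType) (n : nat) (a t E : R) (p : {poly R}) (s : seq R) :
  `|t| = 1 -> (size p <= n.+1)%N ->
  alternates (approx_err a p) E t s -> (n.+2 <= size s)%N ->
  {in s, forall x, -1 <= x <= 1} ->
  (forall x, -1 <= x <= 1 -> `|approx_err a p x| <= E) ->
  minimax n a = p /\ Eerr n a = E.
Proof.
move=> t1 sp alt ns s1 pE; have ec := @continuous_approx_err R a.
have [sm em] := minimax_spec n a.
have e1 : unorm (approx_err a p) <= E by exact: unorm_le.
have mp : minimax n a = p.
  apply: (alternates_unique t1 sp sm alt ns) => x /s1 x1.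
  apply: le_trans (le_unorm (ec _) x1) _; rewrite em.
  exact: le_trans (Eerr_le _ sp) e1.
split=> //; apply/eqP; rewrite eq_le -em mp e1 /=.
have s0 : (0 < size s)%N by apply: leq_trans ns.
have [_ /(_ 0%N s0)] := alternates_nth alt; rewrite expr0 mulr1 => e0.
have h := s1 _ (mem_nth 0 s0); apply: le_trans (le_unorm (ec _) h).
by rewrite e0 normrM t1 mul1r ler_norm.
Qed.

Lemma norm1_cases (R : realType) (t : R) : `|t| = 1 -> t = 1 \/ t = -1.
Proof. by case: (ler0P t) => _ h; [right|left]; lra. Qed.

Lemma norm1_sqr (R : realType) (t : R) : `|t| = 1 -> t * t = 1.
Proof. by case/norm1_cases => ->; rewrite ?mulr1 ?mulrNN ?mulr1. Qed.

Lemma norm1_level (R : realType) (t y E : R) :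
  `|t| = 1 -> `|y| = E -> y != t * E -> y = - t * E.
Proof.
case/norm1_cases => ->; rewrite ?mulN1r ?opprK !mul1r => <- /eqP.
  by case: (ler0P y) => _ h; rewrite ?opprK.
by case: (ler0P y) => _ h; rewrite ?opprK // ?opprK in h *.
Qed.

(* Greedy choice: each alternation point is the first one of the required sign after the
   previous one, and q has its roots just before these points. *)
Lemma alternation_or_separating_poly (R : realType) (e : R -> R) (E : R) (m : nat) :
  continuous e -> 0 < E ->
  forall (t a0 : R), `|t| = 1 -> a0 <= 1 -> e a0 != t * E ->
  (exists s, [/\ size s = m.+1, alternates e E t s & {in s, forall x, a0 <= x <= 1}]) \/
  (exists q : {poly R}, [/\ (size q <= m.+1)%N,
     forall x, a0 <= x <= 1 -> `|e x| = E -> 0 < q.[x] * e x &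
     forall x, x <= a0 -> 0 < - t * q.[x]]).
Proof.
move=> ec E0.
(* If the level t E is not reached any more, a constant of sign -t has the sign of e at all
   remaining extremal points. *)
have base m' t a0 : `|t| = 1 -> ~ (exists2 x, a0 <= x <= 1 & e x = t * E) ->
    exists q : {poly R}, [/\ (size q <= m'.+1)%N,
     forall x, a0 <= x <= 1 -> `|e x| = E -> 0 < q.[x] * e x &
     forall x, x <= a0 -> 0 < - t * q.[x]].
  move=> t1 nex; have t2 := norm1_sqr t1; exists (- t)%:P; split.
  - by rewrite (leq_trans (size_polyC_leq1 _)).
  - move=> x x1 exE; rewrite hornerC (norm1_level t1 exE) ?mulrA ?mulrNN ?t2 ?mul1r //.
    by apply/eqP => h; apply: nex; exists x.
  - by move=> x _; rewrite hornerC mulrNN t2.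
elim: m => [|m IH] t a0 t1 a01 ea0.
  case: (pselect (exists2 x, a0 <= x <= 1 & e x = t * E)) => [[x x1 ex]|]; last first.
    by move=> nex; right; exact: base.
  left; exists [:: x]; split => //=; first by rewrite ex eqxx.
  by move=> y; rewrite inE => /eqP ->.
case: (pselect (exists2 x, a0 <= x <= 1 & e x = t * E)) => [exx|]; last first.
  by move=> nex; right; exact: base.
have t2 := norm1_sqr t1.
have dich x : `|e x| = E -> e x != t * E -> e x = - t * E by exact: norm1_level.
pose S := `[a0, 1]%classic `&` e @^-1` [set t * E].
have Sc : compact S.
  apply: compact_closedI; first exact: segment_compact.
  by apply: closed_comp; [move=> x _; exact: ec|exact: closed_eq].
have [||b bS bmin] := @compact_EVT_min _ _ id S _ Sc.
- by have [x x1 ex] := exx; exists x; split => //=; rewrite in_itv.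
- by apply: continuous_subspaceT => x.
have {bS} [/= b1 eb] := set_mem bS; rewrite in_itv /= in b1; case/andP: b1 => a0b b1.
have bfirst x : a0 <= x < b -> e x != t * E.
  move=> /andP [h1 h2]; apply/eqP => h; have := bmin x (mem_set _); rewrite leNgt h2 => H.
  by have : false; [apply: H; split => //=; rewrite in_itv /= h1 (le_trans (ltW h2))|].
have ab : a0 < b by rewrite lt_neqAle a0b andbT; apply: contra ea0 => /eqP ->; rewrite eb.
have t0 : t != 0 by rewrite -normr_gt0 t1.
have [||[s [ss salt sb]]|[q [sq qe qb]]] := IH (- t) b _ b1.
- by rewrite normrN.
- by rewrite eb mulNr -subr_eq0 opprK -mulr2n mulrn_eq0 /= mulf_neq0 // gt_eqF.
- left; exists (b :: s); split; [by rewrite /= ss| |].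
    apply/and3P; split; [|by rewrite eb|by []].
    case: s ss salt sb => // y s _ /and3P [_ /eqP ey _] sb.
    have /andP [yb _] := sb y (mem_head _ _).
    rewrite lt_neqAle yb andbT; apply/eqP => by_; move: ey; rewrite -by_ eb mulNr => /eqP.
    by rewrite -subr_eq0 opprK -mulr2n mulrn_eq0 /= mulf_eq0 (negPf t0) gt_eqF.
  move=> x; rewrite inE => /predU1P [->|/sb /andP [xb ->]]; first by rewrite a0b b1.
  by rewrite (le_trans a0b).
right.
(* On [a0, b[ only the level -t E can occur, and just before b the error has the sign of t. A root
   at c therefore separates the extremal points before b from b. *)
have [c /andP [ac cb] hc] : exists2 c, a0 < c < b & forall x, c <= x < b -> 0 < t * e x.
  have hb : 0 < t * e b by rewrite eb mulrA t2 mul1r.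
  have : \forall x \near b, 0 < t * e x.
    have : (fun x => t * e x) @ b --> t * e b.
      by apply: cvgM; [exact: cvg_cst|exact: ec].
    by move=> /cvgr_gt; apply.
  rewrite -nearE => /nbhs_ballP [d /= d0 hd].
  exists (Num.max ((a0 + b) / 2) (b - d / 2)).
    by rewrite lt_max gt_max; apply/andP; split; [apply/orP; left|apply/andP; split]; lra.
  move=> x /andP [h1 h2]; apply: hd; rewrite /ball /= ltr_norml.
  by move: h1; rewrite ge_max => /andP [_ h1]; lra.
exists (q * ('X - c%:P)); split.
- apply: leq_trans (size_polyMleq _ _) _; rewrite size_XsubC; lia.
- move=> x /andP [h1 h2] exE; rewrite hornerM hornerXsubC.
  case: (leP b x) => xb.
    rewrite mulrAC; apply: mulr_gt0; last by lra.
    by apply: qe => //; rewrite xb h2.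
  have ex : e x = - t * E by apply: dich => //; apply: bfirst; rewrite h1.
  have xc : x < c.
    rewrite ltNge; apply/negP => cx; have := hc x; rewrite cx xb ex => /(_ isT).
    by rewrite mulrA mulrN t2; lra.
  have -> : q.[x] * (x - c) * e x = (t * q.[x]) * (c - x) * E by rewrite ex; ring.
  have := qb x (ltW xb); rewrite opprK => h.
  by apply: mulr_gt0 => //; apply: mulr_gt0 => //; rewrite subr_gt0.
- move=> x xa; rewrite hornerM hornerXsubC.
  have := qb x (le_trans xa a0b); rewrite opprK => h.
  have -> : - t * (q.[x] * (x - c)) = (t * q.[x]) * (c - x) by ring.
  by apply: mulr_gt0 => //; lra.
Qed.

Lemma poly_eq0_on_itv (R : realFieldType) (p : {poly R}) (a b : R) :
  a < b -> (forall x, a < x < b -> p.[x] = 0) -> p = 0.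
Proof.
move=> ab p0; pose y (i : nat) : R := b - (b - a) / (i.+2)%:R.
have y_in i : a < y i < b.
  have h : 0 < (b - a) / (i.+2)%:R by rewrite divr_gt0 ?subr_gt0 ?ltr0n.
  have h' : (b - a) / (i.+2)%:R < b - a.
    by rewrite ltr_pdivrMr ?ltr0n // ltr_pMr ?subr_gt0 // ltr1n.
  by rewrite /y; move: h h'; set d := _ / _; lra.
apply: (@weak_alternation_eq0 _ (size p) y 1) => //.
- move=> i _; rewrite /y ltrD2l ltrN2 ltr_pM2l ?subr_gt0 // ltf_pV2 ?posrE ?ltr0n //.
  by rewrite ltr_nat.
- by move=> i _; rewrite p0 ?mulr0.
Qed.

(** Otherwise [p] would coincide with both x - a and a - x. *)
Lemma approx_err_neq0 (R : realType) (a : R) (p : {poly R}) :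
  -1 < a < 1 -> exists2 x, -1 <= x <= 1 & approx_err a p x != 0.
Proof.
move=> /andP [a1 a2]; apply: contrapT => h.
have {}h x : -1 <= x <= 1 -> p.[x] = `|x - a|.
  move=> x1; have [/eqP|ne] := eqVneq (approx_err a p x) 0.
    by rewrite subr_eq0 => /eqP.
  by case: h; exists x.
have e1 : p - ('X - a%:P) = 0.
  apply: (@poly_eq0_on_itv _ _ a 1) => // x /andP [h1 h2].
  by rewrite hornerD hornerN hornerXsubC h; [rewrite ger0_norm; lra|lra].
have e2 : p + ('X - a%:P) = 0.
  apply: (@poly_eq0_on_itv _ _ (-1) a) => // x /andP [h1 h2].
  by rewrite hornerD hornerXsubC h; [rewrite ltr0_norm; lra|lra].
have /= := congr1 (fun q : {poly R} => q.[a + 1]) e1.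
have /= := congr1 (fun q : {poly R} => q.[a + 1]) e2.
rewrite !(hornerD, hornerN, hornerX, hornerC) ?horner0; lra.
Qed.

Lemma Eerr_gt0 (R : realType) (n : nat) (a : R) : -1 < a < 1 -> 0 < Eerr n a.
Proof.
move=> a1; have [_ <-] := minimax_spec n a.
have [x x1 e0] := approx_err_neq0 (minimax n a) a1.
apply: lt_le_trans (le_unorm (@continuous_approx_err _ _ _) x1).
by rewrite normr_gt0.
Qed.

(** Where |e| = E, the polynomial q has the sign of e, and subtracting a small multiple of it lowers
    |e|; elsewhere continuity leaves room. Both hold near each x for all small l > 0, and
    compactness provides a common l. *)
Lemma separating_poly_improves (R : realType) (e : R -> R) (E : R) (q : {poly R}) :
  continuous e -> (forall x, -1 <= x <= 1 -> `|e x| <= E) ->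
  (forall x, -1 <= x <= 1 -> `|e x| = E -> 0 < q.[x] * e x) ->
  exists l : R, forall x, -1 <= x <= 1 -> `|e x - l * q.[x]| < E.
Proof.
move=> ec eE eq.
have : \forall l \near 0^'+, `[(-1 : R), 1]%classic `<=`
      (fun x => -1 <= x <= 1 -> `|e x - l * q.[x]| < E).
  apply: (iffLR (compact_near_coveringP _) (@segment_compact R (-1) 1)) => x /=.
  rewrite in_itv /= => x1.
  have cvx : z.1 @[z --> filter_prod (nbhs x) (nbhs (0 : R)^'+)] --> x.
    by move=> A hA; exact: cvg_fst.
  have cvl : z.2 @[z --> filter_prod (nbhs x) (nbhs (0 : R)^'+)] --> (0 : R).
    move=> A hA; have : \forall z \near filter_prod (nbhs x) (nbhs (0 : R)^'+), A z.2.
      by apply: cvg_snd; exact: cvg_within.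
    by [].
  have cve : e z.1 @[z --> filter_prod (nbhs x) (nbhs (0 : R)^'+)] --> e x.
    by apply: cvg_comp cvx _; exact: ec.
  have cvq : q.[z.1] @[z --> filter_prod (nbhs x) (nbhs (0 : R)^'+)] --> q.[x].
    by apply: cvg_comp cvx _; exact: continuous_horner.
  have cvlq : z.2 * q.[z.1] @[z --> filter_prod (nbhs x) (nbhs (0 : R)^'+)] --> 0 * q.[x].
    exact: cvgM.
  rewrite mul0r in cvlq.
  have := eE x x1; rewrite le_eqVlt => /predU1P [exE|exE]; last first.
    have cvd : `|e z.1 - z.2 * q.[z.1]|
        @[z --> filter_prod (nbhs x) (nbhs (0 : R)^'+)] --> `|e x - 0|.
      by apply: cvg_norm; apply: cvgB.
    rewrite subr0 in cvd; move/cvgr_lt: cvd => /(_ _ exE) n0.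
    by near=> z => _; near: z.
  have qe := eq x x1 exE.
  have [s s1 se] : exists2 s, `|s| = 1 & 0 < s * e x.
    case: (ltgtP (e x) 0) qe => h; last by rewrite h mulr0 ltxx.
      by exists (-1) => //; rewrite ?normrN ?normr1 //; lra.
    by exists 1; rewrite ?normr1 //; lra.
  have sq : 0 < s * q.[x].
    by case: (norm1_cases s1) se qe => ->; rewrite ?mul1r ?mulN1r; nra.
  have n1 : \forall z \near filter_prod (nbhs x) (nbhs (0 : R)^'+), 0 < s * q.[z.1].
    by apply: cvgr_gt sq; apply: cvgM => //; exact: cvg_cst.
  have n2 : \forall z \near filter_prod (nbhs x) (nbhs (0 : R)^'+),
      0 < s * (e z.1 - z.2 * q.[z.1]).
    apply: cvgr_gt; last by rewrite -[e x]subr0 in se; exact: se.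
    by apply: cvgM; [exact: cvg_cst|exact: cvgB].
  have n4 : \forall z \near filter_prod (nbhs x) (nbhs (0 : R)^'+), 0 < z.2.
    exact: (@cvg_snd _ _ (nbhs x) (nbhs (0 : R)^'+) _ [set y | 0 < y] (nbhs_right_gt 0)).
  near=> z => z1.
  have h1 : 0 < s * q.[z.1] by near: z.
  have h2 : 0 < s * (e z.1 - z.2 * q.[z.1]) by near: z.
  have h3 : 0 < z.2 by near: z.
  apply: lt_le_trans (eE z.1 z1).
  have h4 : 0 < s * e z.1.
    have -> : s * e z.1 = s * (e z.1 - z.2 * q.[z.1]) + z.2 * (s * q.[z.1]) by ring.
    by rewrite addr_gt0 // mulr_gt0.
  have -> : `|e z.1 - z.2 * q.[z.1]| = s * (e z.1 - z.2 * q.[z.1]).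
    by rewrite -[RHS]gtr0_norm // normrM s1 mul1r.
  have -> : `|e z.1| = s * e z.1 by rewrite -[RHS]gtr0_norm // normrM s1 mul1r.
  have : 0 < z.2 * (s * q.[z.1]) by rewrite mulr_gt0.
  by move: (z.2) (q.[z.1]) (e z.1) => u v w; lra.
move=> h; have [l hl] := @filter_ex _ _ _ _ h.
by exists l => x x1; apply: hl => //=; rewrite in_itv.
Unshelve. all: by end_near. Qed.

(** Necessity in Chebyshev's theorem: a greedy choice that stops early leaves a separating
    polynomial, which would improve the minimax polynomial. *)
Lemma minimax_alternates (R : realType) (n : nat) (a : R) : -1 < a < 1 ->
  exists t s, [/\ `|t| = 1, size s = n.+2,
    alternates (approx_err a (minimax n a)) (Eerr n a) t s &
    {in s, forall x, -1 <= x <= 1}].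
Proof.
move=> a1; have E0 := Eerr_gt0 n a1; have [sp ep] := minimax_spec n a.
set p := minimax n a in sp ep *; set E := Eerr n a in E0 ep *.
have ec := @continuous_approx_err R a p; set e := approx_err a p in ec ep *.
have eE x : -1 <= x <= 1 -> `|e x| <= E by move=> x1; rewrite -ep; exact: le_unorm.
pose S := `[(-1 : R), 1]%classic `&` (fun x => `|e x|) @^-1` [set E].
have Sc : compact S.
  apply: compact_closedI; first exact: segment_compact.
  apply: closed_comp; last exact: closed_eq.
  by move=> x _; apply: cvg_norm; exact: ec.
have [||b bS bmin] := @compact_EVT_min _ _ id S _ Sc.
(* The point b is the leftmost extremal point, so a greedy choice starting there loses nothing. *)
- have [c c1 [ce _]] := unorm_max ec; exists c; by split => //=; rewrite ?in_itv ?ce.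
- by apply: continuous_subspaceT => x.
have {bS} [/= b1 eb] := set_mem bS; rewrite in_itv /= in b1.
have bfirst x : -1 <= x <= 1 -> `|e x| = E -> b <= x.
  by move=> x1 ex; apply: (bmin x); apply: mem_set; split => //=; rewrite ?in_itv.
have [t t1 ebt] : exists2 t, `|t| = 1 & e b = t * E.
  exists (e b / E); last by rewrite divfK // gt_eqF.
  by rewrite normrM eb normfV gtr0_norm // divff // gt_eqF.
have t0 : t != 0 by rewrite -normr_gt0 t1.
have eb' : e b != - t * E.
  by rewrite ebt mulNr -subr_eq0 opprK -mulr2n mulrn_eq0 /= mulf_neq0 // gt_eqF.
case/andP: b1 => b1 b2.
have [|[s [ss salt sb]]|[q [sq qe _]]] :=
    @alternation_or_separating_poly _ e E n ec E0 (- t) b _ b2 eb'.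
- by rewrite normrN.
- exists t, (b :: s); split => //; first by rewrite /= ss.
    apply/and3P; split; [|by rewrite ebt|by []].
    case: s ss salt sb => // y s _ /and3P [_ /eqP ey _] sb.
    have /andP [yb _] := sb y (mem_head _ _).
    by rewrite lt_neqAle yb andbT; apply: contra eb' => /eqP ->; rewrite ey.
  move=> x; rewrite inE => /predU1P [->|/sb /andP [xb ->]]; first by rewrite b1 b2.
  by rewrite (le_trans b1).
have [l hl] : exists l : R, forall x, -1 <= x <= 1 -> `|e x - l * q.[x]| < E.
  apply: separating_poly_improves => // x x1 ex; apply: qe => //.
  by rewrite bfirst //; case/andP: x1.
have : unorm (approx_err a (p + l *: q)) < E.
  have [c c1 [<- _]] := unorm_max (@continuous_approx_err _ a (p + l *: q)).
  suff -> : approx_err a (p + l *: q) c = e c - l * q.[c] by exact: hl.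
  by rewrite /e /approx_err !hornerE; ring.
rewrite ltNge Eerr_le // (leq_trans (size_polyD _ _)) // geq_max sp.
exact: leq_trans (size_scale_leq _ _) sq.
Qed.

(** * Nondegeneracy of the alternation points *)

Lemma alternates_zigzag (R : realType) (e : R -> R) (E t : R) (s : seq R) :
  0 < E -> `|t| = 1 -> alternates e E t s -> zigzag e (- t) s.
Proof.
move=> E0; elim: s t => // x s IH t t1 /and3P [xs /eqP ex alt].
apply/andP; split; last by apply: IH; rewrite ?normrN.
case: s xs alt {IH} => // y s -> /and3P [_ /eqP ey _] /=.
rewrite ey ex; have -> : - t * (- t * E - t * E) = 2 * (t * t) * E by ring.
by rewrite (norm1_sqr t1); lra.
Qed.

(** An alternation is so long that one of its changes of direction must be due to the kink. *)
Lemma minimax_deriv_kink (R : realType) (n : nat) (a : R) : -1 < a < 1 ->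
  `|(minimax n a)^`().[a]| < 1.
Proof.
move=> a1; have [sp _] := minimax_spec n a.
have [t [s [t1 ss alt _]]] := minimax_alternates n a1.
(* For n = 0 two alternation points are too few for the bound on zigzags, but [p] is constant. *)
case: n sp ss alt => [|n] sp ss alt.
  by rewrite (size1_polyC sp) derivC horner0 normr0 ltr01.
have zz := alternates_zigzag (Eerr_gt0 _ a1) t1 alt.
have t1' : `|- t| = 1 by rewrite normrN.
by have [] := zigzag_bound t1' sp zz ltac:(lia) ltac:(lia).
Qed.

(** An error that is constant on an interval would make [p] affine with slope 1 or -1, against
    |p'(a)| < 1. *)
Lemma approx_err_not_locally_constant (R : realType) (a : R) (p : {poly R}) (x y : R) :
  `|p^`().[a]| < 1 -> x < y -> approx_err a p x = approx_err a p y ->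
  exists2 w, x < w < y & approx_err a p w != approx_err a p x.
Proof.
move=> pa xy exy; apply: contrapT => h.
have {}h w : x < w < y -> approx_err a p w = approx_err a p x.
  by move=> xwy; apply: contrapT => /eqP ne; apply: h; exists w.
have key s u v : `|s| = 1 -> x <= u -> u < v -> v <= y ->
    (forall z, u < z < v -> 0 <= s * (z - a)) -> False.
  move=> s1 xu uv vy hs.
  have p0 : s *: ('X - a%:P) - p - (approx_err a p x)%:P = 0.
    apply: (poly_eq0_on_itv uv) => z /andP [z1 z2].
    have zz : u < z < v by rewrite z1.
    rewrite !(hornerD, hornerN, hornerZ, hornerX, hornerC).
    rewrite -(h z); last by rewrite (le_lt_trans xu) //= (lt_le_trans z2).
    by rewrite (approx_err_side _ s1 (hs z zz)); ring.
  have := congr1 (fun q : {poly R} => q^`().[a]) p0.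
  rewrite /= !(derivB, derivN, derivZ, derivX, derivC) => H.
  move: H; rewrite !(hornerD, hornerN, hornerZ, hornerX, hornerC, horner0) => H.
  by move: pa; rewrite (_ : p^`().[a] = s) ?s1 ?ltxx //; lra.
case: (leP y a) => [ya|ay].
  by apply: (key (-1) x y) => //; [rewrite normrN normr1| move=> z /andP []; lra].
case: (leP a x) => [ax|xa].
  by apply: (key 1 x y) => //; [rewrite normr1| move=> z /andP []; lra].
by apply: (key 1 a y) => //; [rewrite normr1|exact: ltW| move=> z /andP []; lra].
Qed.

(** Two consecutive extremal points of the same sign enclose a point where the error differs, and
    this point can be inserted. A list that does not alternate thus produces a strictly longer
    zigzag. *)
Lemma zigzag_refine (R : realType) (e : R -> R) (E : R) (x : R) (s : seq R) (t : R) :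
  0 < E -> (forall z, -1 <= z <= 1 -> `|e z| <= E) ->
  (forall u v, u < v -> e u = e v -> exists2 w, u < w < v & e w != e u) ->
  sorted <%R (x :: s) -> {in x :: s, forall z, -1 <= z <= 1} ->
  {in x :: s, forall z, `|e z| = E} -> `|t| = 1 -> e x = t * E ->
  exists s', [/\ zigzag e (- t) (x :: s'), (size s <= size s')%N &
    alternates e E t (x :: s) \/ (size s < size s')%N].
Proof.
move=> E0 eE dip; elim: s x t => [|y s IH] x t.
  by move=> _ _ _ _ ex; exists [::]; split => //; left; rewrite /= ex eqxx.
move=> /= /andP [xy srt] s1 sE t1 ex.
have [x1 xE] : -1 <= x <= 1 /\ `|e x| = E by split; [apply: s1|apply: sE]; rewrite mem_head.
have [y1 yE] : -1 <= y <= 1 /\ `|e y| = E.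
  by split; [apply: s1|apply: sE]; rewrite !inE eqxx orbT.
have s1' : {in y :: s, forall z, -1 <= z <= 1}.
  by move=> z zs; apply: s1; rewrite inE zs orbT.
have sE' : {in y :: s, forall z, `|e z| = E}.
  by move=> z zs; apply: sE; rewrite inE zs orbT.
have t2 := norm1_sqr t1.
have [ey|ey] := eqVneq (e y) (t * E); last first.
  have {}ey := norm1_level t1 yE ey.
  have [|s' [zz ss alt]] := IH y (- t) srt s1' sE' _ ey; first by rewrite normrN.
  exists (y :: s'); split => //.
    apply/andP; split => //; rewrite xy /= ey ex.
    have -> : - t * (- t * E - t * E) = 2 * (t * t) * E by ring.
    by rewrite t2; lra.
  by case: alt => alt; [left|right]; rewrite //= xy ex eqxx.
have [s' [zz ss alt]] := IH y t srt s1' sE' t1 ey.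
have [|w /andP [xw wy] ew] := dip x y xy; first by rewrite ey.
exists (w :: y :: s'); split; [|by rewrite /= ltnS leqW|by right; rewrite /= !ltnS].
have tw : t * e w < E.
  have w1 : -1 <= w <= 1 by lra.
  rewrite lt_neqAle; apply/andP; split.
    by apply: contra ew => /eqP twE; rewrite ex -twE mulrA t2 mul1r.
  by apply: le_trans (ler_norm _) _; rewrite normrM t1 mul1r eE.
rewrite /= xw wy /= opprK; apply/and3P; split; last exact: zz.
  rewrite ex; have -> : - t * (e w - t * E) = (t * t) * E - t * e w by ring.
  by rewrite t2; lra.
rewrite ey; have -> : t * (t * E - e w) = (t * t) * E - t * e w by ring.
by rewrite t2; lra.
Qed.

Lemma Eerr_ub (R : realType) (n : nat) (a x : R) : -1 <= x <= 1 ->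
  `|approx_err a (minimax n a) x| <= Eerr n a.
Proof.
move=> x1; have [_ <-] := minimax_spec n a.
by apply: le_unorm => //; exact: continuous_approx_err.
Qed.

Lemma alternationP (R : realType) (n : nat) (a x : R) :
  alternation n a x <-> -1 <= x <= 1 /\ `|approx_err a (minimax n a) x| = Eerr n a.
Proof. by rewrite /alternation /= in_itv. Qed.

Lemma sorted_alternation_zigzag (R : realType) (n : nat) (a x : R) (s : seq R) :
  -1 < a < 1 -> sorted <%R (x :: s) ->
  (forall z, z \in x :: s -> alternation n a z) ->
  exists t s', [/\ `|t| = 1, zigzag (approx_err a (minimax n a)) (- t) (x :: s'),
    (size s <= size s')%N &
    alternates (approx_err a (minimax n a)) (Eerr n a) t (x :: s) \/
    (size s < size s')%N].
Proof.
move=> a1 srt sA; have E0 := Eerr_gt0 n a1.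
have [_ ex] := (alternationP _ _ _).1 (sA x (mem_head _ _)).
set e := approx_err _ _ in ex *; set E := Eerr n a in E0 ex *.
have [t t1 et] : exists2 t, `|t| = 1 & e x = t * E.
  exists (e x / E); last by rewrite divfK // gt_eqF.
  by rewrite normrM ex normfV gtr0_norm // divff // gt_eqF.
have dip u v : u < v -> e u = e v -> exists2 w, u < w < v & e w != e u.
  exact: approx_err_not_locally_constant (minimax_deriv_kink n a1).
have [z /sA /alternationP []|z /sA /alternationP [] //|s' [zz ss alt]] //:=
  zigzag_refine E0 (@Eerr_ub _ n a) dip srt _ _ t1 et.
by exists t, s'.
Qed.

(** Zigzags have at most n + 3 points, so there is a longest list of alternation points, and it
    contains them all. With n + 2 points it is the same set as the alternating list already known;
    with n + 3 points, a repeated sign would yield a zigzag of n + 4 points. *)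
Lemma alternation_list (R : realType) (n : nat) (a : R) : -1 < a < 1 ->
  exists t s, [/\ `|t| = 1, alternates (approx_err a (minimax n a)) (Eerr n a) t s,
    (forall x, alternation n a x <-> x \in s) & (n.+2 <= size s <= n.+3)%N].
Proof.
move=> a1; have [sp _] := minimax_spec n a.
pose P m := `[< exists s : seq R, [/\ sorted <%R s, (forall z, z \in s -> alternation n a z)
  & size s = m] >].
have [t [s0 [t1 s0s s0alt s01]]] := minimax_alternates n a1.
have s0A z : z \in s0 -> alternation n a z.
  move=> zs; apply/alternationP; split; first exact: s01.
  have [_ h] := alternates_nth s0alt; have := h (index z s0); rewrite index_mem nth_index //.
  move=> ->//; rewrite !normrM normrX normrN normr1 expr1n t1 !mul1r ger0_norm //.
  by rewrite ltW // Eerr_gt0.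
have Pn : P n.+2 by apply/asboolP; exists s0; split => //; exact: alternates_sorted s0alt.
have Pub m : P m -> (m <= n.+3)%N.
  move=> /asboolP [[|x s] [srt sA <-]] //; rewrite leqNgt; apply/negP => ms.
  have [t' [s' [t1' zz ss _]]] := sorted_alternation_zigzag a1 srt sA.
  have [|||+ _ _ _] := @zigzag_bound _ n a (- t') _ _ _ sp zz; rewrite ?normrN //=.
  - by move: ms ss => /=; lia.
  - by move: ms ss => /=; lia.
  - by move: ms ss => /=; lia.
have exP : exists m, P m by exists n.+2.
case: (ex_maxnP exP Pub) => N /asboolP [s [srt sA sN]] Nmax.
have sfull x : alternation n a x <-> x \in s.
  split; last exact: sA.
  move=> xA; apply: contrapT => /negP xs.
  suff : P N.+1 by move/Nmax; rewrite ltnn.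
  apply/asboolP; exists (sort <=%R (x :: s)); split.
  - rewrite sort_lt_sorted /= xs.
    by move: srt; rewrite lt_sorted_uniq_le => /andP [].
  - by move=> z; rewrite mem_sort inE => /predU1P [->|/sA].
  - by rewrite size_sort /= sN.
have nN : (n.+2 <= N)%N by exact: Nmax.
have Nn : (N <= n.+3)%N by apply: Pub; apply/asboolP; exists s.
have [NE|NE] : N = n.+2 \/ N = n.+3 by lia.
  exists t, s0; split => //; last by rewrite s0s; lia.
  have u0 : uniq s0 by have := alternates_sorted s0alt; rewrite lt_sorted_uniq_le => /andP [].
  have [|_ h] := uniq_min_size u0 (fun z zs => (sfull z).1 (s0A z zs)).
    by rewrite sN NE s0s.
  by move=> x; rewrite sfull h.
case: s srt sA sN sfull => [|x s] srt sA sN sfull; first by rewrite -sN in nN.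
have [t' [s' [t1' zz ss [alt|lt]]]] := sorted_alternation_zigzag a1 srt sA.
  by exists t', (x :: s); split => //; rewrite sN; lia.
have : (size (x :: s') <= n.+3)%N.
  have [|||//] := @zigzag_bound _ n a (- t') _ _ _ sp zz; rewrite ?normrN //=;
    by move: sN lt => /=; lia.
by move: sN lt => /=; lia.
Qed.

(** * Local behaviour of the error and first-order conditions *)

Lemma poly_strict_local_sign (R : realType) (p : {poly R}) (x t : R) :
  0 < t * p^`().[x] -> exists2 d, 0 < d &
    forall y, 0 < `|y - x| < d -> 0 < t * (p.[y] - p.[x]) * (y - x).
Proof.
move=> tp; have /factor_theorem [h ph] : root (p - p.[x]%:P) x.
  by rewrite /root !hornerE subrr.
have hx : h.[x] = p^`().[x].
  have := congr1 (fun q : {poly R} => q^`().[x]) ph.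
  rewrite /= derivB derivC subr0 derivM derivB derivX derivC subr0 => ->.
  by rewrite !hornerE subrr mulr0 add0r.
rewrite -hx in tp.
have [d d0 hd] := poly_cont x (t *: h) tp.
exists d => // y /andP [y0 yd]; have := hd y yd; rewrite !hornerZ => {}hd.
have -> : p.[y] - p.[x] = h.[y] * (y - x).
  have := congr1 (fun q : {poly R} => q.[y]) ph.
  by rewrite /= hornerD hornerN hornerC hornerM hornerXsubC.
have -> : t * (h.[y] * (y - x)) * (y - x) = (t * h.[y]) * (y - x) ^+ 2 by ring.
rewrite mulr_gt0 //; last by rewrite exprn_even_gt0 //= -normr_gt0.
by move: hd; rewrite ltr_norml; lra.
Qed.

Lemma near_same_side (R : realType) (a x : R) : x != a ->
  exists2 d, 0 < d & forall (p : {poly R}) y, `|y - x| < d ->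
    slope a y = slope a x /\ approx_err a p y = (slope a x *: ('X - a%:P) - p).[y].
Proof.
move=> xa; exists `|x - a|; first by rewrite normr_gt0 subr_eq0.
move=> p y yx; rewrite hornerD hornerN hornerZ hornerXsubC.
have side : 0 <= slope a x * (y - a) /\ slope a y = slope a x.
  move: yx xa; rewrite /slope; case: (ltgtP x a) => // xa yx _.
    have e : `|x - a| = a - x by rewrite ltr0_norm ?subr_lt0 // opprB.
    move: yx; rewrite e ltr_norml => yx; rewrite ifT; lra.
  have e : `|x - a| = x - a by rewrite gtr0_norm ?subr_gt0.
  move: yx; rewrite e ltr_norml => yx.
  by rewrite ifF; [lra|apply/negbTE; rewrite -leNgt; lra].
by have [h1 h2] := side; split => //; rewrite (approx_err_side _ (normr_slope a x) h1).
Qed.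

Lemma approx_err_local_sign (R : realType) (a x t : R) (p : {poly R}) :
  x != a -> 0 < t * (slope a x - p^`().[x]) -> exists2 d, 0 < d &
    forall y, 0 < `|y - x| < d -> 0 < t * (approx_err a p y - approx_err a p x) * (y - x).
Proof.
move=> xa h; have [d1 d10 h1] := near_same_side xa.
pose g := slope a x *: ('X - a%:P) - p.
have [|d2 d20 h2] := @poly_strict_local_sign _ g x t.
  by rewrite /g derivB derivZ derivB derivX derivC subr0 !hornerE.
exists (Num.min d1 d2); first by rewrite lt_min d10.
move=> y; rewrite lt_min => /and3P [y0 y1 y2].
have [_ ->] := h1 p y y1; have [_ ->] := h1 p x (ltac:(by rewrite subrr normr0)).
by apply: h2; rewrite y0.
Qed.

(** The sign v is a direction in which one can leave x inside [-1, 1]; a derivative of the wrong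
    sign would let the error exceed E there. Interior points admit both directions, end points only
    the inward one. *)
Lemma extremum_slope_sign (R : realType) (a x t v E : R) (p : {poly R}) :
  x != a -> `|t| = 1 -> `|v| = 1 -> approx_err a p x = t * E ->
  (forall y, -1 <= y <= 1 -> `|approx_err a p y| <= E) ->
  (exists2 d, 0 < d & forall h, 0 < h < d -> -1 <= x + v * h <= 1) ->
  v * t * (slope a x - p^`().[x]) <= 0.
Proof.
move=> xa t1 v1 ex eE [d d0 hd]; rewrite leNgt; apply/negP => h.
have [d' d'0 hd'] := approx_err_local_sign xa h.
pose k := Num.min d d' / 2.
have [k0 kd kd'] : [/\ 0 < k, k < d & k < d'].
  have m0 : 0 < Num.min d d' by rewrite lt_min d0.
  have : Num.min d d' <= d /\ Num.min d d' <= d' by rewrite !ge_min !lexx orbT.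
  by rewrite /k => -[]; split; lra.
have in1 := hd k (ltac:(by rewrite k0 kd)).
have := hd' (x + v * k).
have -> : x + v * k - x = v * k by ring.
rewrite normrM v1 mul1r gtr0_norm // k0 kd' ex => /(_ isT).
have -> : v * t * (approx_err a p (x + v * k) - t * E) * (v * k) =
  (v * v) * (t * approx_err a p (x + v * k) - (t * t) * E) * k by ring.
rewrite !norm1_sqr // !mul1r pmulr_lgt0 // subr_gt0 => H.
have := eE _ in1; rewrite leNgt => /negP; apply.
by apply: lt_le_trans H _; apply: le_trans (ler_norm _) _; rewrite normrM t1 mul1r.
Qed.

Lemma interior_extremum_critical (R : realType) (a x E : R) (p : {poly R}) :
  x != a -> -1 < x < 1 -> 0 < E -> `|approx_err a p x| = E ->
  (forall y, -1 <= y <= 1 -> `|approx_err a p y| <= E) -> slope a x - p^`().[x] = 0.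
Proof.
move=> xa /andP [x1 x2] E0 ex eE.
have [t t1 et] : exists2 t, `|t| = 1 & approx_err a p x = t * E.
  exists (approx_err a p x / E); last by rewrite divfK // gt_eqF.
  by rewrite normrM ex normfV gtr0_norm // divff // gt_eqF.
have h1 : 1 * t * (slope a x - p^`().[x]) <= 0.
  apply: extremum_slope_sign et eE _ => //; rewrite ?normr1 //.
  by exists (1 - x) => [|h]; lra.
have h2 : -1 * t * (slope a x - p^`().[x]) <= 0.
  apply: extremum_slope_sign et eE _ => //; rewrite ?normrN ?normr1 //.
  by exists (x + 1) => [|h]; lra.
have : t * (slope a x - p^`().[x]) = 0 by lra.
by move/eqP; rewrite mulf_eq0 -normr_eq0 t1 oner_eq0 => /eqP.
Qed.

(** * Lengthening zigzags by small perturbations *)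

Lemma approx_err_perturb (R : realType) (a c : R) (p r : {poly R}) :
  approx_err a (p + c *: r) = (fun y => approx_err a p y - c * r.[y]).
Proof. by apply/funext => y; rewrite /approx_err !(hornerD, hornerZ); ring. Qed.

Lemma zigzag_perturb (R : realType) (a t : R) (p r : {poly R}) (s : seq R) :
  zigzag (approx_err a p) t s -> exists2 c0, 0 < c0 &
    forall c, 0 < c < c0 -> zigzag (approx_err a (p + c *: r)) t s.
Proof.
elim: s t => [|x s IH] t; first by exists 1.
move=> /andP [hx /IH [c1 c10 h1]].
case: s hx h1 {IH} => [|y s] hx h1; first by exists 1.
move: hx => /andP [xy h].
set d := t * _ in h; set k := t * (r.[y] - r.[x]).
have k0 : 0 < 1 + `|k| by rewrite ltr_pwDl.
exists (Num.min c1 (d / (1 + `|k|))); first by rewrite lt_min c10 divr_gt0.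
move=> c /andP [c0]; rewrite lt_min => /andP [cc1 ck].
apply/andP; split; last by apply: h1; rewrite c0.
rewrite xy /= approx_err_perturb.
have -> : t * (approx_err a p y - c * r.[y] - (approx_err a p x - c * r.[x])) =
  d - c * k by rewrite /d /k; ring.
rewrite ltr_pdivlMr // in ck; rewrite subr_gt0; apply: le_lt_trans ck.
by rewrite ler_pM2l // (le_trans (ler_norm _)) // lerDr.
Qed.

Lemma zigzag_replace_tail (R : realType) (e : R -> R) (t y : R) (l s1 s2 : seq R) :
  (zigzag e (t * (-1) ^+ size l) (y :: s1) -> zigzag e (t * (-1) ^+ size l) (y :: s2)) ->
  zigzag e t (l ++ y :: s1) -> zigzag e t (l ++ y :: s2).
Proof.
elim: l t => [|x l IH] t; first by rewrite /= expr0 mulr1.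
move=> h /andP [hx hl]; apply/andP; split; first by case: (l) hx.
by apply: IH hl; move: h; rewrite /= exprS mulN1r mulrN mulNr.
Qed.

Lemma zigzag_insert_head (R : realType) (e : R -> R) (t x w y : R) (s : seq R) :
  x < w < y -> 0 < t * (e w - e x) -> zigzag e (- t) (x :: y :: s) ->
  zigzag e t (x :: w :: y :: s).
Proof.
move=> /andP [xw wy] tw /andP [/andP [_ txy] zz]; rewrite opprK in zz.
have twy : 0 < - t * (e y - e w).
  have -> : - t * (e y - e w) = - t * (e y - e x) + t * (e w - e x) by ring.
  exact: addr_gt0.
apply/andP; split; first by rewrite xw tw.
by apply/andP; split; [rewrite wy twy|rewrite opprK].
Qed.

Lemma zigzag_insert_last (R : realType) (e : R -> R) (t x w y : R) (l : seq R) :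
  y < w < x -> 0 < t * (-1) ^+ size l * (e w - e x) ->
  zigzag e t (l ++ [:: y; x]) -> zigzag e t (l ++ [:: y; w; x]).
Proof.
move=> /andP [yw wx] tw; apply: zigzag_replace_tail.
move: tw; set u := t * _ => tw; rewrite /= !andbT => /andP [yx h].
rewrite yw wx /=; apply/andP; split.
  have -> : u * (e w - e y) = u * (e x - e y) + u * (e w - e x) by ring.
  exact: addr_gt0.
by have -> : - u * (e x - e w) = u * (e w - e x) by ring.
Qed.

(** The sign [t * (-1) ^+ size l] is the direction of the step from y to x. The two new points
    overshoot x in that direction, and x becomes an extremum of the opposite kind. *)
Lemma zigzag_insert_around (R : realType) (e : R -> R) (t x w1 w2 y z : R) (l s : seq R) :
  y < w1 < x -> x < w2 < z ->
  0 < t * (-1) ^+ size l * (e w1 - e x) -> 0 < t * (-1) ^+ size l * (e w2 - e x) ->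
  zigzag e t (l ++ [:: y, x, z & s]) -> zigzag e t (l ++ [:: y, w1, x, w2, z & s]).
Proof.
move=> /andP [yw wx] xwz tw1 tw2; apply: zigzag_replace_tail.
move: tw1 tw2; set u := t * _ => tw1 tw2 /andP [/andP [yx h] zz].
apply/andP; split.
  rewrite yw /=; have -> : u * (e w1 - e y) = u * (e x - e y) + u * (e w1 - e x) by ring.
  exact: addr_gt0.
apply/andP; split.
  by rewrite wx /=; have -> : - u * (e x - e w1) = u * (e w1 - e x) by ring.
by rewrite opprK; apply: zigzag_insert_head.
Qed.

(** At a critical point the derivative of the perturbed error comes from [r] alone, so its sign can
    be prescribed. *)
Lemma tilt_at_critical (R : realType) (a x u v c d : R) (p r : {poly R}) :
  x != a -> slope a x - p^`().[x] = 0 -> 0 < c -> `|v| = 1 -> 0 < d ->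
  0 < - (u * v * r^`().[x]) ->
  exists2 w, 0 < v * (w - x) < d &
    0 < u * (approx_err a (p + c *: r) w - approx_err a (p + c *: r) x).
Proof.
move=> xa crit c0 v1 d0 h.
have [|d' d'0 hd'] := @approx_err_local_sign _ a x (u * v) (p + c *: r) xa.
  rewrite derivD derivZ hornerD hornerZ.
  have -> : slope a x - (p^`().[x] + c * r^`().[x]) = - (c * r^`().[x]).
    by rewrite -[RHS]add0r -crit; ring.
  have -> : u * v * - (c * r^`().[x]) = c * - (u * v * r^`().[x]) by ring.
  exact: mulr_gt0.
pose k := Num.min d d' / 2.
have [k0 kd kd'] : [/\ 0 < k, k < d & k < d'].
  have m0 : 0 < Num.min d d' by rewrite lt_min d0.
  have : Num.min d d' <= d /\ Num.min d d' <= d' by rewrite !ge_min !lexx orbT.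
  by rewrite /k => -[]; split; lra.
exists (x + v * k).
  have -> : v * (x + v * k - x) = (v * v) * k by ring.
  by rewrite norm1_sqr // mul1r k0.
have := hd' (x + v * k).
have -> : x + v * k - x = v * k by ring.
rewrite normrM v1 mul1r gtr0_norm // k0 kd' => /(_ isT).
set D := approx_err _ _ _ - _.
have -> : u * v * D * (v * k) = (v * v) * ((u * D) * k) by ring.
by rewrite norm1_sqr // mul1r pmulr_lgt0.
Qed.

(** X - x is divided out twice; the second derivative of g at x is twice the value of the quotient
    k. *)
Lemma degenerate_point_factor (R : realFieldType) (g : {poly R}) (x : R) :
  g^`().[x] = 0 -> g^`()^`().[x] = 0 -> exists2 k : {poly R}, k.[x] = 0 &
    forall y, g.[y] = g.[x] + k.[y] * ((y - x) * (y - x)).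
Proof.
move=> g1 g2.
have /factor_theorem [h gh] : root (g - g.[x]%:P) x by rewrite /root !hornerE subrr.
have dg : g^`() = h^`() * ('X - x%:P) + h.
  have := congr1 (@deriv R) gh.
  by rewrite derivB derivC subr0 derivM derivXsubC mulr1.
have hx : root h x.
  by move: g1; rewrite dg !hornerE subrr mulr0 add0r /root => ->.
have [k hk] := factor_theorem _ _ hx; exists k.
  have dh : h^`() = k^`() * ('X - x%:P) + k by rewrite hk derivM derivXsubC mulr1.
  move: g2; rewrite dg derivD derivM derivXsubC mulr1 dh.
  by rewrite !(hornerD _ _ x) !(hornerM _ _ x) hornerXsubC subrr !mulr0 !add0r => H; lra.
move=> y; have := congr1 (fun r : {poly R} => r.[y]) gh.
rewrite hk /= !(hornerM, hornerD, hornerN, hornerX, hornerC) => H.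
by rewrite -[LHS](subrK g.[x]) H; ring.
Qed.

(** With vanishing first and second derivatives, the error varies by less than any multiple of (y -
    x)^2 near x. The added square therefore decides the direction on both sides, however small c
    is. *)
Lemma bend_at_degenerate (R : realType) (a x u v c d : R) (p : {poly R}) :
  x != a -> slope a x - p^`().[x] = 0 -> p^`()^`().[x] = 0 -> `|u| = 1 ->
  0 < c -> `|v| = 1 -> 0 < d ->
  let q := p + c *: ((- u) *: ('X - x%:P) ^+ 2) in
  exists2 w, 0 < v * (w - x) < d & 0 < u * (approx_err a q w - approx_err a q x).
Proof.
move=> xa crit p2 u1 c0 v1 d0 q.
have [d1 d10 h1] := near_same_side xa.
pose g : {poly R} := slope a x *: ('X - a%:P) - p.
have g1 : g^`().[x] = 0.
  by rewrite /g !(derivB, derivZ, derivX, derivC) subr0 !hornerE.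
have g2 : g^`()^`().[x] = 0.
  rewrite /g !(derivB, derivZ, derivX, derivC) ?subr0 scaler0 sub0r.
  by rewrite hornerN p2 oppr0.
have [k kx gk] := degenerate_point_factor g1 g2.
have [d2 d20 h2] := poly_cont x k c0; rewrite kx in h2.
pose m := Num.min d (Num.min d1 d2); pose b := m / 2.
have [b0 bd bd1 bd2] : [/\ 0 < b, b < d, b < d1 & b < d2].
  have m0 : 0 < m by rewrite !lt_min d0 d10.
  have : [/\ m <= d, m <= d1 & m <= d2] by rewrite /m !ge_min !lexx !orbT.
  by rewrite /b => -[]; split; lra.
have nb : `|x + v * b - x| = b.
  have -> : x + v * b - x = v * b by ring.
  by rewrite normrM v1 mul1r gtr0_norm.
exists (x + v * b).
  have -> : v * (x + v * b - x) = (v * v) * b by ring.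
  by rewrite norm1_sqr // mul1r b0.
rewrite /q !approx_err_perturb.
have := h2 (x + v * b); have := h1 p (x + v * b).
rewrite nb => /(_ bd1) [_ ->] /(_ bd2); have [_ ->] := h1 p x (ltac:(by rewrite subrr normr0)).
rewrite -/g subr0 => hkb.
have gw : g.[x + v * b] = g.[x] + k.[x + v * b] * (b * b).
  rewrite gk; have -> : x + v * b - x = v * b by ring.
  have -> : v * b * (v * b) = (v * v) * (b * b) by ring.
  by rewrite (norm1_sqr v1) mul1r.
rewrite gw !(hornerZ, horner_exp, hornerXsubC).
set K := k.[_] in hkb *.
have -> : u * (g.[x] + K * (b * b) - c * (- u * (x + v * b - x) ^+ 2) -
   (g.[x] - c * (- u * (x - x) ^+ 2))) = (u * K + (u * u) * (v * v) * c) * (b * b) by ring.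
rewrite (norm1_sqr u1) (norm1_sqr v1) !mul1r mulr_gt0 //; last exact: mulr_gt0.
have : - (u * K) <= `|K|.
  by rewrite -[leRHS]mul1r -u1 -normrM -normrN ler_norm.
lra.
Qed.

Lemma size_perturb (R : realFieldType) (n : nat) (c : R) (p r : {poly R}) :
  (size p <= n.+1)%N -> (size r <= n.+1)%N -> (size (p + c *: r)%R <= n.+1)%N.
Proof.
move=> sp sr; rewrite (leq_trans (size_polyD _ _)) // geq_max sp.
exact: leq_trans (size_scale_leq _ _) sr.
Qed.

(** For n <= 1 the derivative is a constant of absolute value less than 1 and cannot equal a slope.
    The conclusion leaves room for a quadratic perturbation. *)
Lemma critical_degree (R : realType) (n : nat) (a x : R) (p : {poly R}) :
  (size p <= n.+1)%N -> `|p^`().[a]| < 1 -> slope a x - p^`().[x] = 0 -> (1 < n)%N.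
Proof.
move=> sp pa crit; rewrite ltnNge; apply/negP => n1.
have /size1_polyC dp : (size p^`() <= 1)%N.
  by rewrite (leq_trans (size_poly _ _)) //; move: sp n1; case: (size p) => //=; lia.
move: pa crit; rewrite dp !hornerC; set c := _`_0 => c1 /eqP.
by rewrite subr_eq0 => /eqP cs; move: c1; rewrite -cs normr_slope ltxx.
Qed.

Lemma size_XsubC_sqr (R : realFieldType) (c x : R) : (size (c *: ('X - x%:P) ^+ 2)%R <= 3)%N.
Proof. by rewrite (leq_trans (size_scale_leq _ _)) // size_exp_XsubC. Qed.

Lemma deriv_XsubC_sqr (R : realFieldType) (c x y : R) :
  (c *: ('X - x%:P) ^+ 2)^`().[y] = 2 * c * (y - x).
Proof.
rewrite derivZ expr2 derivM derivXsubC mulr1 mul1r hornerZ hornerD hornerXsubC; ring.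
Qed.

Lemma zigzag_consecutive (R : realType) (e : R -> R) (t x y : R) (l s : seq R) :
  zigzag e t (l ++ [:: x, y & s]) -> x < y.
Proof.
by elim: l t => [|z l IH] t; [case/andP => /andP []|case/andP => _ /IH].
Qed.

(* At a critical end point the error is stationary, so tilting p slightly adds an
   extremum next to it and makes the zigzag too long. *)
Lemma critical_head_bound (R : realType) (n : nat) (a t x y : R) (p : {poly R}) (s : seq R) :
  (size p <= n.+1)%N -> (0 < n)%N -> `|t| = 1 -> x != a ->
  zigzag (approx_err a p) t (x :: y :: s) -> slope a x - p^`().[x] = 0 ->
  (size (x :: y :: s) <= n.+2)%N.
Proof.
move=> sp n0 t1 xa zz crit; rewrite leqNgt; apply/negP => ns.
pose r : {poly R} := t *: 'X.
have rx : r^`().[x] = t by rewrite derivZ derivX hornerZ hornerC mulr1.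
have sr : (size r <= n.+1)%N.
  by rewrite (leq_trans (size_scale_leq _ _)) // size_polyX.
have [c0 c00 hc] := zigzag_perturb r zz.
have c1 : 0 < c0 / 2 < c0 by lra.
have {hc} zz' := hc _ c1; have /andP [cpos _] := c1.
have /andP [/andP [xy _] _] := zz.
have [||w /andP [w1 w2] hw] := @tilt_at_critical _ a x (- t) 1 _ (y - x) p r xa crit cpos (normr1 _).
- by rewrite subr_gt0.
- by rewrite rx mulr1 mulNr norm1_sqr // opprK ltr01.
have zz2 : zigzag (approx_err a (p + (c0 / 2) *: r)) (- t) (x :: w :: y :: s).
  by apply: zigzag_insert_head => //; [lra|rewrite opprK].
have [|||+ _ _ _] := @zigzag_bound _ n a (- t) _ _ _ (size_perturb _ sp sr) zz2.
- by rewrite normrN.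
- by move: ns => /=; clear; lia.
- by [].
- by move: ns => /=; clear; lia.
Qed.

(** The counterpart at the other end of the list, where the sign of the tilt depends on the parity
    of the length through u. *)
Lemma critical_last_bound (R : realType) (n : nat) (a t x y : R) (p : {poly R}) (l : seq R) :
  (size p <= n.+1)%N -> (0 < n)%N -> `|t| = 1 -> x != a ->
  zigzag (approx_err a p) t (l ++ [:: y; x]) -> slope a x - p^`().[x] = 0 ->
  (size (l ++ [:: y; x]) <= n.+2)%N.
Proof.
move=> sp n0 t1 xa zz crit; rewrite leqNgt; apply/negP => ns.
pose u := t * (-1) ^+ size l.
have u1 : `|u| = 1 by rewrite normrM normrX normrN normr1 expr1n t1 mul1r.
pose r : {poly R} := u *: 'X.
have rx : r^`().[x] = u by rewrite derivZ derivX hornerZ hornerC mulr1.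
have sr : (size r <= n.+1)%N.
  by rewrite (leq_trans (size_scale_leq _ _)) // size_polyX.
have [c0 c00 hc] := zigzag_perturb r zz.
have c1 : 0 < c0 / 2 < c0 by lra.
have {hc} zz' := hc _ c1; have /andP [cpos _] := c1.
have yx : y < x by exact: zigzag_consecutive zz.
have [|||w /andP [w1 w2] hw] := @tilt_at_critical _ a x u (-1) _ (x - y) p r xa crit cpos.
- by rewrite normrN normr1.
- by rewrite subr_gt0.
- by rewrite rx mulrN1 mulNr norm1_sqr // opprK ltr01.
have zz2 : zigzag (approx_err a (p + (c0 / 2) *: r)) t (l ++ [:: y; w; x]).
  by apply: zigzag_insert_last => //; lra.
have [||+ _ _ _] := @zigzag_bound _ n a t _ _ t1 (size_perturb _ sp sr) zz2.
- by move: ns; rewrite !size_cat /=; clear; lia.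
- by rewrite size_cat /=; clear; lia.
- by move: ns; rewrite !size_cat /=; clear; lia.
Qed.

(** Bending the error at a degenerate point inside the list adds two points, which makes at least n
    + 4. At the first or last point of the list it adds only one, but x stays critical, and a zigzag
    with a critical end cannot have n + 3 points. *)
Lemma critical_nondegenerate (R : realType) (n : nat) (a t x : R) (p : {poly R}) (s : seq R) :
  (size p <= n.+1)%N -> `|p^`().[a]| < 1 -> `|t| = 1 -> x != a ->
  zigzag (approx_err a p) t s -> (n.+2 <= size s)%N -> x \in s ->
  slope a x - p^`().[x] = 0 -> p^`()^`().[x] != 0.
Proof.
move=> sp pa t1 xa zz ns xs crit; apply/eqP => p2.
have n1 := critical_degree sp pa crit.
case/splitPr: xs zz ns => l r zz ns.
pose u := t * (-1) ^+ size l.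
have u1 : `|u| = 1 by rewrite normrM normrX normrN normr1 expr1n t1 mul1r.
pose b (v : R) : {poly R} := (- v) *: ('X - x%:P) ^+ 2.
have sb v : (size (b v) <= n.+1)%N by apply: leq_trans (size_XsubC_sqr _ _) _.
(* The added square has a double root at x, so x remains critical. *)
have critb v c : slope a x - (p + c *: b v)^`().[x] = 0.
  by rewrite derivD derivZ hornerD hornerZ deriv_XsubC_sqr subrr !mulr0 addr0.
have [c0 c00 hc] := zigzag_perturb (b (- u)) zz.
have c1 : 0 < c0 / 2 < c0 by lra.
have {hc} zz' := hc _ c1; have /andP [cpos _] := c1.
have uN1 : `|- u| = 1 by rewrite normrN.
have bend v d := @bend_at_degenerate _ a x (- u) v _ d p xa crit p2 uN1 cpos.
case: (lastP l) @u u1 uN1 bend zz zz' ns => [|{}l y] u u1 uN1 bend zz zz' ns.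
  have ut : u = t by rewrite /u expr0 mulr1.
  case: r zz zz' ns => [|z r] zz zz' ns; first by move: ns => /=; clear; lia.
  have /andP [/andP [xz _] _] := zz.
  have [||w /andP [w1 w2] hw] := bend 1 (z - x); rewrite ?normr1 ?subr_gt0 //.
  rewrite ut in hw zz' uN1 *.
  have zz2 : zigzag (approx_err a (p + (c0 / 2) *: b (- t))) (- t) [:: x, w, z & r].
    by apply: zigzag_insert_head => //; [lra|rewrite opprK].
  have := critical_head_bound (size_perturb _ sp (sb _)) (ltnW n1) uN1 xa zz2 (critb _ _).
  by move: ns => /=; clear; lia.
have uE : - u = t * (-1) ^+ size l by rewrite /u size_rcons exprS; ring.
rewrite cat_rcons in zz zz' ns.
have yx : y < x by exact: zigzag_consecutive zz.
have [||w1 /andP [w11 w12] hw1] := bend (-1) (x - y); rewrite ?normrN ?normr1 ?subr_gt0 //.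
case: r zz zz' ns => [|z r] zz zz' ns.
  have zz2 : zigzag (approx_err a (p + (c0 / 2) *: b (- u))) t ((l ++ [:: y]) ++ [:: w1; x]).
    by rewrite -catA; apply: zigzag_insert_last => //; [lra|rewrite -uE].
  have := critical_last_bound (size_perturb _ sp (sb _)) (ltnW n1) t1 xa zz2 (critb _ _).
  by move: ns; rewrite !size_cat /=; clear; lia.
have xz : x < z.
  by rewrite -cat_rcons in zz; exact: zigzag_consecutive zz.
have [||w2 /andP [w21 w22] hw2] := bend 1 (z - x); rewrite ?normr1 ?subr_gt0 //.
have zz2 : zigzag (approx_err a (p + (c0 / 2) *: b (- u))) t (l ++ [:: y, w1, x, w2, z & r]).
  by apply: zigzag_insert_around => //; rewrite -?uE //; lra.
have [||+ _ _ _] := @zigzag_bound _ n a t _ _ t1 (size_perturb _ sp (sb _)) zz2.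
- by move: ns; rewrite !size_cat /=; clear; lia.
- by rewrite size_cat /=; clear; lia.
- by move: ns; rewrite !size_cat /=; clear; lia.
Qed.

(** * Rescaling and V-shapes *)

(** The homothety of centre k and ratio tau. As |x - a| is positively homogeneous, [rescale_poly]
    turns an error into tau times the transported error. *)
Definition rescale (R : realType) (k tau y : R) : R := k - (k - y) * tau.

Definition rescale_poly (R : realType) (k tau : R) (p : {poly R}) : {poly R} :=
  tau *: (p \Po (k%:P - (k%:P - 'X) * (tau^-1)%:P)).

Lemma rescaleK (R : realType) (k tau y : R) : tau != 0 ->
  rescale k tau (rescale k tau^-1 y) = y.
Proof. by move=> t0; rewrite /rescale; field. Qed.

Lemma rescaleVK (R : realType) (k tau y : R) : tau != 0 ->
  rescale k tau^-1 (rescale k tau y) = y.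
Proof. by move=> t0; rewrite /rescale; field. Qed.

Lemma size_rescale_poly (R : realType) (n : nat) (k tau : R) (p : {poly R}) :
  (size p <= n.+1)%N -> (size (rescale_poly k tau p) <= n.+1)%N.
Proof.
move=> sp; apply: leq_trans (size_scale_leq _ _) _.
apply: leq_trans (size_comp_poly_leq _ _) _; rewrite ltnS.
have sq : (size (k%:P - (k%:P - 'X) * (tau^-1)%:P)%R <= 2)%N.
  rewrite (leq_trans (size_polyD _ _)) // geq_max size_polyN.
  rewrite (leq_trans (size_polyC_leq1 _)) //= (leq_trans (size_polyMleq _ _)) //.
  have : (size (k%:P - 'X : {poly R})%R <= 2)%N.
    rewrite (leq_trans (size_polyD _ _)) // geq_max size_polyN size_polyX.
    by rewrite (leq_trans (size_polyC_leq1 _)).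
  have := size_polyC_leq1 (tau^-1).
  by case: (size _) => [|[|?]] //; case: (size _) => [|[|[|?]]].
apply: (@leq_trans ((size p).-1 * 1)%N); last by rewrite muln1; move: sp; case: (size p).
rewrite leq_mul2l; apply/orP; right; move: sq; by case: (size _) => [|[|[|?]]].
Qed.

Lemma approx_err_rescale (R : realType) (k tau a : R) (p : {poly R}) (y : R) : 0 < tau ->
  approx_err (rescale k tau a) (rescale_poly k tau p) y =
  tau * approx_err a p (rescale k tau^-1 y).
Proof.
move=> t0; have tn : tau != 0 by rewrite gt_eqF.
rewrite /approx_err /rescale_poly hornerZ horner_comp.
rewrite !(hornerD, hornerN, hornerM, hornerC, hornerX) mulrBr; congr (_ - _).
rewrite -{2}(gtr0_norm t0) -normrM; congr (`|_|).
by rewrite /rescale; field.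
Qed.

Lemma alternates_map (R : realType) (e e' f : R -> R) (E E' t : R) (s : seq R) :
  {homo f : x y / x < y} -> (forall x, e x = t * E -> e' (f x) = t * E') ->
  (forall x, e x = - t * E -> e' (f x) = - t * E') ->
  alternates e E t s -> alternates e' E' t (map f s).
Proof.
move=> fh; elim: s t => // x s IH t h1 h2 /and3P [xs /eqP ex alt]; apply/and3P; split.
- by case: s xs {IH alt} => //= y s /fh.
- by rewrite h1.
- by apply: IH => //; rewrite opprK.
Qed.

(** The conditions concern the image of s and the preimage of [-1, 1]. This covers both an
    alternation with one point dropped and an error followed beyond an end of [-1, 1]. *)
Lemma Eerr_rescale (R : realType) (n : nat) (k tau a t E : R) (p : {poly R}) (s : seq R) :
  `|t| = 1 -> (size p <= n.+1)%N -> 0 < tau ->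
  alternates (approx_err a p) E t s -> (n.+2 <= size s)%N ->
  {in s, forall x, -1 <= rescale k tau x <= 1} ->
  (forall y, -1 <= y <= 1 -> `|approx_err a p (rescale k tau^-1 y)| <= E) ->
  [/\ minimax n (rescale k tau a) = rescale_poly k tau p,
    Eerr n (rescale k tau a) = tau * E &
    alternates (approx_err (rescale k tau a) (rescale_poly k tau p)) (tau * E) t
      (map (rescale k tau) s)].
Proof.
move=> t1 sp t0 alt ns s1 eE; have tn : tau != 0 by rewrite gt_eqF.
have alt' : alternates (approx_err (rescale k tau a) (rescale_poly k tau p)) (tau * E) t
      (map (rescale k tau) s).
  apply: alternates_map alt => [x y xy|x ex|x ex]; last 2 first.
  - by rewrite approx_err_rescale // rescaleVK // ex; ring.
  - by rewrite approx_err_rescale // rescaleVK // ex; ring.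
  by rewrite /rescale; nra.
have [|||h1 h2] := @alternates_minimax _ n _ t _ _ _ t1 (size_rescale_poly _ _ sp) alt'.
- by rewrite size_map.
- by move=> _ /mapP [x xs ->]; exact: s1.
- by move=> x x1; rewrite approx_err_rescale // normrM gtr0_norm // ler_pM2l // eE.
by split.
Qed.

(** Moving the kink changes |x - a| by at most the displacement, so [Eerr] is 1-Lipschitz. *)
Lemma continuous_Eerr (R : realType) (n : nat) : continuous (@Eerr R n).
Proof.
have lip (x y : R) : Eerr n x <= Eerr n y + `|x - y|.
  have [sp ep] := minimax_spec n y; apply: le_trans (Eerr_le x sp) _.
  apply: unorm_le => [|z z1]; first exact: continuous_approx_err.
  have -> : approx_err x (minimax n y) z =
    approx_err y (minimax n y) z + (`|z - x| - `|z - y|) by rewrite /approx_err; ring.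
  apply: le_trans (ler_normD _ _) _; apply: lerD; first exact: Eerr_ub.
  apply: le_trans (ler_dist_dist _ _) _.
  have -> : z - x - (z - y) = - (x - y) by ring.
  by rewrite normrN.
move=> x; apply/cvgrPdist_lt => e e0; near=> y.
have h : `|x - y| < e by near: y; apply: cvgr_dist_lt => //; exact: cvg_id.
have h1 := lip x y; have h2 := lip y x; rewrite distrC in h2.
by rewrite ltr_norml; apply/andP; split; lra.
Unshelve. all: by end_near. Qed.

(** The homothety fixes 1 and takes a to x. The first inequality on x keeps the preimage of [-1, 1]
    inside [z, 1], the second keeps the image of [w, 1] inside [-1, 1]. *)
Lemma Eerr_rescale_right (R : realType) (n : nat) (a t E z w x : R) (p : {poly R})
    (s : seq R) :
  a < 1 -> `|t| = 1 -> (size p <= n.+1)%N ->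
  alternates (approx_err a p) E t s -> (n.+2 <= size s)%N ->
  {in s, forall y, w <= y <= 1} ->
  (forall y, z <= y <= 1 -> `|approx_err a p y| <= E) ->
  x < 1 -> 2 * (1 - a) <= (1 - x) * (1 - z) -> (1 - x) * (1 - w) <= 2 * (1 - a) ->
  let tau := (1 - x) / (1 - a) in
  [/\ rescale 1 tau a = x, minimax n x = rescale_poly 1 tau p,
    Eerr n x = E / (1 - a) * (1 - x) &
    alternates (approx_err x (minimax n x)) (Eerr n x) t (map (rescale 1 tau) s)].
Proof.
move=> a1 t1 sp alt ns sw ez x1 hz hw tau.
have a0 : 0 < 1 - a by rewrite subr_gt0.
have tau0 : 0 < tau by rewrite divr_gt0 // subr_gt0.
have tauE : tau * (1 - a) = 1 - x by rewrite divfK // gt_eqF.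
have ra : rescale 1 tau a = x by rewrite /rescale mulrC tauE; ring.
have tauw : tau * (1 - w) <= 2.
  by rewrite -(ler_pM2r a0) mulrAC tauE.
have tauz : 2 <= tau * (1 - z).
  by rewrite -(ler_pM2r a0) mulrAC tauE.
clearbody tau; clear hz hw.
have [||m Ex altx] := @Eerr_rescale _ n 1 tau a t E p s t1 sp tau0 alt ns.
- move=> y /sw /andP [y1 y2]; rewrite /rescale; clear -y1 y2 tau0 tauw.
  by apply/andP; split; nra.
- move=> y /andP [y1 y2]; apply: ez; rewrite /rescale.
  have ti : 0 < tau^-1 by rewrite invr_gt0.
  have tz : 2 * tau^-1 <= 1 - z by rewrite ler_pdivrMr // mulrC.
  by clear -y1 y2 ti tz; apply/andP; split; nra.
rewrite ra in m Ex altx; split => //.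
  by rewrite Ex -tauE; field; rewrite gt_eqF.
by rewrite m Ex.
Qed.

(** Without its first point the alternation still has n + 2 points, enough to certify a minimax
    polynomial, and there is room to expand from 1 until the next point reaches -1. *)
Lemma tip_left (R : realType) (n : nat) (a t : R) (s : seq R) :
  -1 < a < 1 -> `|t| = 1 ->
  alternates (approx_err a (minimax n a)) (Eerr n a) t s -> (n.+3 <= size s)%N ->
  {in s, forall x, -1 <= x <= 1} ->
  exists2 d, 0 < d & forall x, a - d <= x <= a -> Eerr n x = Eerr n a / (1 - a) * (1 - x).
Proof.
move=> /andP [_ a1] t1 alt ns s1; have [sp _] := minimax_spec n a.
case: s alt ns s1 => [|x1 [|x2 [|x3 s]]] // alt ns s1.
have x23 : x2 < x3 by case/and3P: alt => _ _ /and3P [].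
have srt := alternates_sorted alt.
have [/andP [x11 _] /andP [_ x31]] : -1 <= x1 <= 1 /\ -1 <= x3 <= 1.
  by split; apply: s1; rewrite !inE eqxx ?orbT.
have x12 : x1 < x2 by case/and3P: alt.
have x2_le x : x \in [:: x2, x3 & s] -> x2 <= x <= 1.
  move=> xs; have /andP [_ ->] : -1 <= x <= 1 by apply: s1; rewrite inE xs orbT.
  rewrite andbT; move: xs; rewrite inE => /predU1P [->//|xs].
  have : path <%R x2 (x3 :: s) by move: srt => /= /andP [].
  by rewrite lt_path_sortedE => /andP [/allP /(_ _ xs) /ltW].
have alt' : alternates (approx_err a (minimax n a)) (Eerr n a) (- t) [:: x2, x3 & s].
  by case/and3P: alt.
have t1N : `|- t| = 1 by rewrite normrN.
have x20 : 0 < 1 - x2 by lra.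
(* At distance d the second point x2 is moved exactly to -1. *)
exists ((1 + x2) * (1 - a) / (1 - x2)); first by rewrite !mulr_gt0 ?invr_gt0 //; lra.
move=> x /andP [xl xr].
have h : (1 - x) * (1 - x2) <= 2 * (1 - a).
  have -> : 2 * (1 - a) = (1 - a + (1 + x2) * (1 - a) / (1 - x2)) * (1 - x2).
    by rewrite [RHS]mulrDl divfK ?gt_eqF //; ring.
  by rewrite ler_pM2r //; lra.
have x1' : x < 1 by lra.
have h' : 2 * (1 - a) <= (1 - x) * (1 - -1) by lra.
by have [] := Eerr_rescale_right a1 t1N sp alt' ns x2_le (@Eerr_ub _ n a) x1' h' h.
Qed.

Lemma alternates_rcons (R : realType) (e : R -> R) (E t x : R) (s : seq R) :
  alternates e E t (rcons s x) -> alternates e E t s.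
Proof.
elim: s t => // y s IH t /and3P [yx ey /IH h]; apply/and3P; split => //.
by case: s yx {IH h}.
Qed.

Lemma sorted_rcons_le (R : realType) (l : seq R) (x y : R) :
  sorted <%R (rcons l y) -> x \in rcons l y -> x <= y.
Proof.
elim: l => [|z l IH]; first by rewrite inE => _ /eqP ->.
rewrite rcons_cons /= lt_path_sortedE all_rcons => /andP [/andP [zy _] /IH h].
by rewrite inE => /predU1P [->|/h //]; exact: ltW.
Qed.

Lemma tip_right (R : realType) (n : nat) (a t : R) (s : seq R) :
  -1 < a < 1 -> `|t| = 1 ->
  alternates (approx_err a (minimax n a)) (Eerr n a) t s -> (n.+3 <= size s)%N ->
  {in s, forall x, -1 <= x <= 1} ->
  exists2 d, 0 < d & forall x, a <= x <= a + d -> Eerr n x = Eerr n a / (1 + a) * (1 + x).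
Proof.
move=> a1 t1 alt ns s1; have [sp _] := minimax_spec n a.
case/lastP: s alt ns s1 => [|s x1]; first by [].
case/lastP: s => [|s x2]; first by [].
case: s => [|x3 s]; first by [].
move=> alt ns s1; have srt := alternates_sorted alt.
have := srt; rewrite !rcons_cons /= lt_path_sortedE.
rewrite /= !all_rcons => /andP [/and3P [_ x32 _] _].
have x21 : x2 < x1.
  move: srt; rewrite -cats1 cat_rcons; move: (x3 :: s) => l.
  by elim: l => [|z l IH] /= => [/andP []|/path_sorted].
have [x11 x31] : -1 <= x1 <= 1 /\ -1 <= x3 <= 1.
  by split; apply: s1; rewrite ?mem_rcons ?inE ?eqxx ?orbT.
have alt' := alternates_rcons alt.
have x2_ge x : x \in rcons (x3 :: s) x2 -> -1 <= x <= x2.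
  move=> xs; have /andP [-> _] : -1 <= x <= 1.
    by apply: s1; rewrite mem_rcons inE xs orbT.
  exact: sorted_rcons_le (alternates_sorted alt') xs.
have a0 : 0 < 1 + a by lra.
have x20 : 0 < 1 + x2 by lra.
(* Now the last point is dropped and the centre is -1; at distance d the last point but one is moved
   exactly to 1. *)
exists ((1 - x2) * (1 + a) / (1 + x2)); first by rewrite !mulr_gt0 ?invr_gt0 //; lra.
move=> x /andP [xl xr]; pose tau := (1 + x) / (1 + a).
have tau1 : 1 <= tau by rewrite ler_pdivlMr // mul1r; lra.
have tau2 : (1 + x2) * tau <= 2.
  rewrite mulrA ler_pdivrMr //.
  have -> : 2 * (1 + a) = (1 + x2) * (1 + a) + (1 - x2) * (1 + a) / (1 + x2) * (1 + x2).
    by rewrite divfK ?gt_eqF //; ring.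
  by rewrite [_ / _ * _]mulrC -mulrDr ler_pM2l //; lra.
have xE : x = rescale (-1) tau a.
  have -> : rescale (-1) tau a = tau * (1 + a) - 1 by rewrite /rescale; ring.
  by rewrite divfK ?gt_eqF //; ring.
have tau0 : 0 < tau by lra.
have [|||_ + _] := @Eerr_rescale _ n (-1) tau a t _ _ _ t1 sp tau0 alt'.
- by move: ns; rewrite !size_rcons; clear.
- by move=> y /x2_ge; rewrite /rescale => /andP [y1 y2]; apply/andP; split; nra.
- move=> y y1; apply: Eerr_ub; rewrite /rescale.
  have t1' : 0 < tau^-1 <= 1 by rewrite invr_gt0 tau0 invf_le1.
  by case/andP: t1' => ? ?; apply/andP; split; nra.
by rewrite -xE => ->; rewrite /tau; field; rewrite gt_eqF.
Qed.

Lemma vshape_of_lines (R : realType) (E : R -> R) (a c b k l : R) :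
  continuous E -> a < c < b -> 0 < k -> 0 < l ->
  (forall x, a <= x <= c -> E x = k * (1 - x)) ->
  (forall x, c <= x <= b -> E x = l * (1 + x)) -> has_Vshape E a c b.
Proof.
move=> Ec acb k0 l0 hl hr; split => //.
- exact: continuous_subspaceT.
- split; first by exists (- k), k => x; rewrite in_itv /= => /hl ->; ring.
  move=> x y; rewrite !in_itv /= => xa ya yx; rewrite !hl // ltr_pM2l //; lra.
- split; first by exists l, l => x; rewrite in_itv /= => /hr ->; ring.
  move=> x y; rewrite !in_itv /= => xa ya xy; rewrite !hr // ltr_pM2l //; lra.
Qed.

(** By continuity the agreement persists at the infimum of the admissible left ends. *)
Lemma extend_agreement_left (R : realType) (f g : R -> R) (a0 c : R) :
  continuous f -> continuous g -> -1 <= a0 -> a0 < c ->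
  (forall x, a0 <= x <= c -> f x = g x) ->
  exists a, [/\ -1 <= a, a <= a0, forall x, a <= x <= c -> f x = g x &
    forall a', -1 <= a' -> a' < c -> (forall x, a' <= x <= c -> f x = g x) -> a <= a'].
Proof.
move=> fc gc a01 a0c fg.
pose S := [set a' | [/\ -1 <= a', a' < c & forall x, a' <= x <= c -> f x = g x]].
have Sa0 : S a0 by split.
have lb : lbound S (-1) by move=> x [].
have hi : has_inf S by split; [exists a0|exists (-1)].
have aa0 : inf S <= a0 by apply: ge_inf => //; exists (-1).
have eq_gt x : inf S < x <= c -> f x = g x.
  move=> /andP [ax xc]; have e0 : 0 < x - inf S by rewrite subr_gt0.
  have [a' [_ _ h] a'x] := inf_adherent e0 hi.
  by apply: h; rewrite xc andbT; move: a'x; rewrite addrC subrK; exact: ltW.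
exists (inf S); split => //.
- by apply: lb_le_inf => //; exists a0.
- move=> x /andP; rewrite le_eqVlt => -[/predU1P [<- _|ax xc]]; last by apply: eq_gt; rewrite ax.
  apply/eqP; rewrite -subr_eq0; apply/negPn/negP => ne.
  have cfg : f x - g x @[x --> inf S] --> f (inf S) - g (inf S).
    by apply: cvgB; [exact: fc|exact: gc].
  have : \forall x \near inf S, f x - g x != 0 by apply: cvgr_neq0 cfg ne.
  move=> /nbhs_ballP [d /= d0 hd].
  pose y := Num.min c (inf S + d / 2).
  have yP : inf S < y <= c.
    by rewrite /y lt_min ge_min lexx !andbT; apply/andP; split; lra.
  suff : f y - g y != 0 by rewrite eq_gt // subrr eqxx.
  apply: hd; rewrite /ball /= distrC ger0_norm; last by case/andP: yP => /ltW; rewrite subr_ge0.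
  by have : y <= inf S + d / 2 by [rewrite /y ge_min lexx orbT]; lra.
- by move=> a' h1 h2 h3; apply: ge_inf; [exists (-1)|split].
Qed.

Lemma extend_agreement_right (R : realType) (f g : R -> R) (b0 c : R) :
  continuous f -> continuous g -> b0 <= 1 -> c < b0 ->
  (forall x, c <= x <= b0 -> f x = g x) ->
  exists b, [/\ b <= 1, b0 <= b, forall x, c <= x <= b -> f x = g x &
    forall b', b' <= 1 -> c < b' -> (forall x, c <= x <= b' -> f x = g x) -> b' <= b].
Proof.
move=> fc gc b01 cb0 fg.
have oc : continuous (-%R : R -> R) by move=> x; exact: opp_continuous.
have [|||||a [a1 a0 h1 h2]] := @extend_agreement_left _ (f \o -%R) (g \o -%R) (- b0) (- c).
- by move=> x; apply: continuous_comp; [exact: oc|exact: fc].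
- by move=> x; apply: continuous_comp; [exact: oc|exact: gc].
- by rewrite lerN2.
- by rewrite ltrN2.
- by move=> x xb; apply: fg; lra.
exists (- a); split; [lra|lra| |].
- by move=> x xb; have /= := h1 (- x); rewrite opprK; apply; lra.
- move=> b' b1 b2 h; rewrite lerNr; apply: h2; [lra|lra|].
  by move=> x xb; apply: h; lra.
Qed.

(** Both arms are prolonged as long as [E] follows the two lines inside [-1, 1]. A V-shape
    containing the result has the same tip, because the monotonicity changes there. Its arms share
    two points with the lines, so they are no longer than the prolonged ones. *)
Lemma maximal_vshape (R : realType) (E : R -> R) (a0 c b0 k l : R) :
  continuous E -> -1 <= a0 -> b0 <= 1 -> a0 < c < b0 -> 0 < k -> 0 < l ->
  (forall x, a0 <= x <= c -> E x = k * (1 - x)) ->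
  (forall x, c <= x <= b0 -> E x = l * (1 + x)) ->
  exists a b, [/\ a <= a0, forall x, a <= x <= c -> E x = k * (1 - x) & is_Vshape E a c b].
Proof.
move=> Ec a01 b01 /andP [a0c cb0] k0 l0 hl hr.
have lin_c (u v : R) : continuous (fun x : R => u * (v + x)).
  by move=> x; apply: cvgM; [exact: cvg_cst|apply: cvgD; [exact: cvg_cst|exact: cvg_id]].
have lin_c' (u v : R) : continuous (fun x : R => u * (v - x)).
  by move=> x; apply: cvgM; [exact: cvg_cst|apply: cvgB; [exact: cvg_cst|exact: cvg_id]].
have [a [a1 aa0 ha amin]] := extend_agreement_left Ec (lin_c' k 1) a01 a0c hl.
have [b [b1 bb0 hb bmax]] := extend_agreement_right Ec (lin_c l 1) b01 cb0 hr.
have ac : a < c by lra.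
have cb : c < b by lra.
have acb : a < c < b by rewrite ac.
exists a, b; split => //; split; [by split|exact: (vshape_of_lines Ec acb k0 l0 ha hb)|].
move=> a' c' b' a'1 b'1 [/andP [ac' cb'] _ [[s1 [t1 lin1]] dec] [[s2 [t2 lin2]] inc]] aa bb.
have cc : c' = c.
  apply/eqP; rewrite eq_le; apply/andP; split; rewrite leNgt; apply/negP => lt.
    pose y := Num.min c' b; have [y1 y2 y3] : [/\ c < y, y <= c' & y <= b].
      by rewrite /y lt_min lt !ge_min !lexx orbT cb.
    have := dec y c; rewrite !in_itv /= => H.
    have : E y < E c by apply: H => //; lra.
    by rewrite !hb ?ltr_pM2l //; lra.
  pose y := Num.max c' a; have [y1 y2 y3] : [/\ y < c, c' <= y & a <= y].
    by rewrite /y gt_max lt !le_max !lexx orbT ac.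
  have := inc y c; rewrite !in_itv /= => H.
  have : E y < E c by apply: H => //; lra.
  by rewrite !ha ?ltr_pM2l //; lra.
rewrite cc in ac' cb' lin1 lin2.
have a'a : a' = a.
  apply/eqP; rewrite eq_le aa /=; apply: amin => // x /andP [x1 x2].
  have := lin1 a; have := lin1 c; have := lin1 x; rewrite !in_itv /= x1 x2.
  rewrite (ltW ac') lexx aa (ltW ac) (ha a) ?(ha c); [|lra|lra].
  move=> /(_ isT) -> /(_ isT) e1 /(_ isT) e2.
  have s1E : s1 = - k by apply: (mulIf (_ : c - a != 0)); [lra|nra].
  by rewrite s1E in e1 *; lra.
have b'b : b' = b.
  apply/eqP; rewrite eq_le bb andbT; apply: bmax => // x /andP [x1 x2].
  have := lin2 b; have := lin2 c; have := lin2 x; rewrite !in_itv /= x1 x2.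
  rewrite (ltW cb') lexx bb (ltW cb) (hb b) ?(hb c); [|lra|lra].
  move=> /(_ isT) -> /(_ isT) e1 /(_ isT) e2.
  have s2E : s2 = l by apply: (mulIf (_ : b - c != 0)); [lra|nra].
  by rewrite s2E in e1 *; lra.
by [].
Qed.

Lemma tip_exceptional (R : realType) (n : nat) (a t : R) (s : seq R) :
  -1 < a < 1 -> `|t| = 1 ->
  alternates (approx_err a (minimax n a)) (Eerr n a) t s -> (n.+3 <= size s)%N ->
  {in s, forall x, -1 <= x <= 1} -> Vshape_exceptional (@Eerr R n) a.
Proof.
move=> a1 t1 alt ns s1; have E0 := Eerr_gt0 n a1.
have [d1 d10 hl] := tip_left a1 t1 alt ns s1.
have [d2 d20 hr] := tip_right a1 t1 alt ns s1.
have [l1 l2] : a - d1 <= Num.max (-1) (a - d1) /\ Num.max (-1) (a - d1) < a.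
  by rewrite le_max lexx orbT gt_max; split => //; apply/andP; split; lra.
have [r1 r2] : Num.min 1 (a + d2) <= a + d2 /\ a < Num.min 1 (a + d2).
  by rewrite ge_min lexx orbT lt_min; split => //; apply/andP; split; lra.
have [|||||||a' [b' [_ _ vs]]] :=
  @maximal_vshape _ _ (Num.max (-1) (a - d1)) a (Num.min 1 (a + d2)) (Eerr n a / (1 - a))
   (Eerr n a / (1 + a)) (@continuous_Eerr R n).
- by rewrite le_max lexx.
- by rewrite ge_min lexx.
- by rewrite l2 r2.
- by rewrite divr_gt0 //; lra.
- by rewrite divr_gt0 //; lra.
- by move=> x /andP [x1 x2]; apply: hl; rewrite x2 (le_trans l1).
- by move=> x /andP [x1 x2]; apply: hr; rewrite x1 (le_trans x2).
by exists a', a, b'; split => //; apply: Or32.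
Qed.

(** * Critical end points of [-1, 1] *)

Lemma critical_point_local_growth (R : realType) (h : {poly R}) (x t v : R) :
  `|v| = 1 -> h^`().[x] = 0 -> 0 < t * h^`()^`().[x] -> exists2 d, 0 < d &
    forall y, 0 < v * (y - x) < d -> 0 < t * (h.[y] - h.[x]).
Proof.
move=> v1 h1 h2; have [d d0 hd] := poly_strict_local_sign h2; exists d => // y.
have key z : 0 < `|z - x| < d -> 0 < t * h^`().[z] * (z - x).
  by move=> /hd; rewrite h1 subr0.
case: (norm1_cases v1) => ->; rewrite ?mul1r ?mulN1r ?opprB => /andP [y0 yd].
  have [|z /itvP zP ->] := poly_mvt h (_ : x < y); first lra.
  have xz : x < z by rewrite zP.
  have zy : z < y by rewrite zP.
  have := key z; rewrite gtr0_norm; last lra.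
  by rewrite pmulr_lgt0; [move=> H; rewrite mulrA mulr_gt0 //; apply: H; lra|lra].
have [|z /itvP zP e] := poly_mvt h (_ : y < x); first lra.
have yz : y < z by rewrite zP.
have zx : z < x by rewrite zP.
have := key z; rewrite ltr0_norm; last lra.
rewrite nmulr_lgt0; [move=> H|lra].
have -> : h.[y] - h.[x] = - (h^`().[z] * (x - y)) by rewrite -e; ring.
have -> : t * - (h^`().[z] * (x - y)) = - (t * h^`().[z]) * (x - y) by ring.
by apply: mulr_gt0; [rewrite oppr_gt0; apply: H; lra|lra].
Qed.

(** A nonconstant polynomial has an infinite limit at minus infinity; the upper bound excludes plus
    infinity. *)
Lemma poly_bounded_above_left (R : realType) (h : {poly R}) (E c : R) :
  (1 < size h)%N -> (forall y, y < c -> h.[y] < E) -> exists2 z, z < c & h.[z] <= - E.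
Proof.
move=> sh hE; pose H := h \Po (- 'X).
have Hv x : H.[x] = h.[- x] by rewrite horner_comp !hornerE.
have sH : size H = size h by rewrite size_comp_poly2 // size_polyN size_polyX.
pose m (n0 : R) := Num.max n0 (1 - c).
have mP n0 : n0 <= m n0 /\ - m n0 < c.
  have : 1 - c <= m n0 by rewrite /m le_max lexx orbT.
  by split; [rewrite /m le_max lexx|lra].
case: (ltgtP (lead_coef H) 0) => [lt|gt|/eqP].
- have lp : 0 < lead_coef (- H) by rewrite lead_coefN oppr_gt0.
  have [|n0 hn] := @poly_lim_infty _ (- H) E lp; first by rewrite size_polyN sH.
  have [m1 m2] := mP n0; exists (- m n0) => //.
  by have := hn _ m1; rewrite hornerN Hv; lra.
- have [|n0 hn] := @poly_lim_infty _ H E gt; first by rewrite sH.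
  have [m1 m2] := mP n0; have := hn _ m1; rewrite Hv.
  by have := hE _ m2; lra.
by rewrite lead_coef_eq0 -size_poly_eq0 sH; case: (size h) sh.
Qed.

(* Follow the minimax polynomial beyond -1: its error first comes back to the opposite
   level at some s* < -1, and rescaling [s*, 1] to [-1, 1] moves the kink to a tip. *)
Lemma critical_left_end_extension (R : realType) (n : nat) (a t : R) (s : seq R) (p : {poly R}) :
  -1 < a < 1 -> `|t| = 1 -> (size p <= n.+1)%N -> 0 < Eerr n a ->
  alternates (approx_err a p) (Eerr n a) t (-1 :: s) -> size s = n.+1 ->
  (forall x, -1 <= x <= 1 -> `|approx_err a p x| <= Eerr n a) ->
  -1 - p^`().[-1] = 0 -> p^`()^`().[-1] != 0 ->
  exists z, [/\ z < -1, approx_err a p z = - t * Eerr n a &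
    forall x, z <= x <= 1 -> `|approx_err a p x| <= Eerr n a].
Proof.
move=> a1 t1 sp E0 alt ss eE crit p2; set E := Eerr n a in E0 alt eE *.
have t2 := norm1_sqr t1.
have tN1 : `|- t| = 1 by rewrite normrN.
pose g : {poly R} := (-1) *: ('X - a%:P) - p.
have ge y : y <= -1 -> approx_err a p y = g.[y].
  move=> y1; rewrite (@approx_err_side _ a (-1)) ?normrN ?normr1 //; last by lra.
  by rewrite /g hornerD hornerN hornerZ hornerXsubC.
pose h : {poly R} := t *: g.
have he y : y <= -1 -> h.[y] = t * approx_err a p y by move=> y1; rewrite hornerZ ge.
have e1 : approx_err a p (-1) = t * E by case/and3P: alt => _ /eqP.
have h1 : h.[-1] = E by rewrite he // e1 mulrA t2 mul1r.
have g' : g^`() = (-1)%:P - p^`().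
  by rewrite /g derivB derivZ derivXsubC -mul_polyC mulr1.
have dh : h^`().[-1] = 0.
  by rewrite /h derivZ g' hornerZ hornerD hornerN hornerC crit mulr0.
have ddh : h^`()^`().[-1] = - (t * p^`()^`().[-1]).
  by rewrite /h !derivZ g' derivB derivC sub0r hornerZ hornerN mulrN.
have zz : zigzag (approx_err a p) (- t) (-1 :: s) by exact: alternates_zigzag alt.
(* A positive second derivative of h at -1 would make the error exceed its bound just to the right
   of -1; with a negative one, h is below E just to the left. *)
have near_lt : exists2 d, 0 < d & forall y, -1 - d < y < -1 -> h.[y] < E.
  have [ddh0|ddh0] : h^`()^`().[-1] < 0 \/ 0 < h^`()^`().[-1].
    have : h^`()^`().[-1] != 0.
      by rewrite ddh oppr_eq0 mulf_neq0 // -normr_gt0 t1.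
    by case: (ltgtP h^`()^`().[-1] 0) => //; [left|right].
  - have [||d d0 hd] := @critical_point_local_growth _ h (-1) (-1) (-1) _ dh _.
    + by rewrite normrN normr1.
    + by rewrite mulN1r oppr_gt0.
    exists d => // y y1; have := hd y; rewrite h1 => H.
    by have : 0 < -1 * (h.[y] - E); [apply: H; lra|lra].
  have [||d d0 hd] := @critical_point_local_growth _ h (-1) 1 1 _ dh _.
  + by rewrite normr1.
  + by rewrite mul1r.
  pose y := -1 + Num.min d (1 + a) / 2.
  have m0 : 0 < Num.min d (1 + a) by rewrite lt_min d0; lra.
  have [m1 m2] : Num.min d (1 + a) <= d /\ Num.min d (1 + a) <= 1 + a.
    by rewrite !ge_min !lexx orbT.
  have y1 : -1 <= y <= 1 by rewrite /y; lra.
  have hy : h.[y] = t * approx_err a p y.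
    rewrite (@approx_err_side _ a (-1)) ?normrN ?normr1 //; last by rewrite /y; lra.
    by rewrite /h hornerZ /g hornerD hornerN hornerZ hornerXsubC.
  have := hd y; rewrite h1 hy => H.
  have {}H : 0 < 1 * (t * approx_err a p y - E) by apply: H; rewrite /y; lra.
  have := eE y y1; rewrite leNgt => /negP; case.
  apply: lt_le_trans (_ : t * approx_err a p y <= _); first by lra.
  by apply: le_trans (ler_norm _) _; rewrite normrM t1 mul1r.
clearbody h.
(* Such a pair to the left of -1 would prolong the zigzag of n + 2 points to one of n + 4 points. *)
have nozig y0 w : y0 < w -> w < -1 -> h.[w] < h.[y0] -> h.[w] < E -> False.
  move=> y0w w1 hw hw'.
  have zz2 : zigzag (approx_err a p) (- t) [:: y0, w, -1 & s].
    apply/andP; split.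
      rewrite y0w /=; have -> : - t * (approx_err a p w - approx_err a p y0) =
        t * approx_err a p y0 - t * approx_err a p w by ring.
      by rewrite -!he; lra.
    apply/andP; split; last by rewrite opprK.
    rewrite w1 /= opprK e1 mulrBr mulrA t2 mul1r -he; lra.
  have [||+ _ _ _] := @zigzag_bound _ n a (- t) _ _ tN1 sp zz2; rewrite /= ?ss; clear; lia.
have [d d0 hd] := near_lt.
have h_lt y : y < -1 -> h.[y] < E.
  move=> y1; rewrite ltNge; apply/negP => hy.
  pose w := Num.max ((y - 1) / 2) (-1 - d / 2).
  have [w1 w2 w3] : [/\ y < w, w < -1 & -1 - d < w].
    by rewrite /w !lt_max gt_max; split; [apply/orP; left|apply/andP; split|apply/orP; right]; lra.
  have hw : h.[w] < E by apply: hd; rewrite w3.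
  by apply: (nozig y w); lra.
have sh : (1 < size h)%N.
  rewrite ltnNge; apply/negP => /size1_polyC hc.
  move: p2; have -> : p^`()^`().[-1] = - (t * h^`()^`().[-1]).
    by rewrite ddh mulrN opprK mulrA t2 mul1r.
  by rewrite hc !derivC horner0 mulr0 oppr0 eqxx.
have [z0 z01 hz0] := poly_bounded_above_left sh h_lt.
have [|z /itvP zP zr] := polyrcf.poly_ivt (p := h + E%:P) (ltW z01).
  by rewrite !hornerE h1; nra.
have hz : h.[z] = - E.
  by move: zr; rewrite /root !hornerE addr_eq0 => /eqP.
have z1 : z < -1.
  have : z <= -1 by rewrite zP.
  by rewrite le_eqVlt => /predU1P [z1|//]; move: hz; rewrite z1 h1; lra.
exists z; split=> //.
  have := he z (ltW z1); rewrite hz => H.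
  by rewrite -[LHS]mul1r -t2 -mulrA -H; ring.
move=> x /andP [zx x1]; case: (leP (-1) x) => x2; first by apply: eE; rewrite x2.
have -> : `|approx_err a p x| = `|h.[x]|.
  by rewrite he ?ltW // normrM t1 mul1r.
have hx := h_lt x x2; rewrite ler_norml (ltW hx) andbT leNgt; apply/negP => hx'.
move: zx; rewrite le_eqVlt => /predU1P [zx|zx]; first by move: hx'; rewrite -zx hz ltxx.
by apply: (nozig z x) => //; rewrite hz.
Qed.

(* If E_n continued along the line through (1, 0) to the left of a, a rescaling of the
   minimax polynomial at a would be optimal there, with n + 2 alternation points coming
   from those in ]-1, 1]. *)
Lemma line_through_right_end_stops (R : realType) (n : nat) (a x : R) (l : seq R) :
  a < 1 -> (forall y, alternation n a y -> y \in -1 :: l) -> size l = n.+1 ->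
  -1 < x < a -> Eerr n x = Eerr n a / (1 - a) * (1 - x) -> False.
Proof.
move=> a1 sA sl /andP [x1 xa] Ex; have [sp _] := minimax_spec n a.
set p := minimax n a in sA sp *.
have x11 : -1 < x < 1 by rewrite x1 (lt_trans xa).
have a0 : 0 < 1 - a by rewrite subr_gt0.
pose tau : R := (1 - x) / (1 - a).
have tau1 : 1 < tau by rewrite ltr_pdivlMr // mul1r ltrD2l ltrN2.
have tau0 : 0 < tau by exact: lt_trans tau1.
have xE : rescale 1 tau a = x by rewrite /rescale mulrC divfK ?gt_eqF //; ring.
have {}Ex : Eerr n x = tau * Eerr n a by rewrite Ex /tau; field; rewrite gt_eqF.
have E0 := Eerr_gt0 n x11.
have [t [s [t1 ss alt s1]]] := minimax_alternates n x11.
have back y : -1 <= y <= 1 -> -1 < rescale 1 tau^-1 y <= 1.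
  have ti : 0 < tau^-1 < 1 by rewrite invr_gt0 tau0 invf_lt1.
  case/andP: ti => t2 t3 /andP [y1 y2]; rewrite /rescale; clear -t2 t3 y1 y2.
  by apply/andP; split; nra.
have mx : rescale_poly 1 tau p = minimax n x.
  have [sm _] := minimax_spec n x.
  apply: (alternates_unique t1 sm (size_rescale_poly _ _ sp) alt); first by rewrite ss.
  move=> y /s1 y1; rewrite -{1}xE approx_err_rescale // normrM gtr0_norm // Ex ler_pM2l //.
  by apply: Eerr_ub; have /andP [/ltW -> ->] := back y y1.
have sub : {subset map (rescale 1 tau^-1) s <= l}.
  move=> _ /mapP [y ys ->]; have yb := back y (s1 y ys).
  have : rescale 1 tau^-1 y \in -1 :: l.
    apply/sA/alternationP; split; first by case/andP: yb => /ltW -> ->.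
    apply: (mulfI (_ : tau != 0)); first by rewrite gt_eqF.
    rewrite -{1}(gtr0_norm tau0) -normrM -approx_err_rescale // xE mx -Ex.
    have [_ h] := alternates_nth alt; have := h (index y s); rewrite index_mem nth_index //.
    by move=> -> //; rewrite !normrM normrX normrN normr1 expr1n t1 !mul1r gtr0_norm.
  by rewrite inE => /predU1P [e|//]; move: yb; rewrite e ltxx.
have um : uniq (map (rescale 1 tau^-1) s).
  rewrite map_inj_uniq; last by apply: (can_inj (fun y => rescaleK _ _ _)); rewrite gt_eqF.
  by have := alternates_sorted alt; rewrite lt_sorted_uniq_le => /andP [].
by have := uniq_leq_size um sub; rewrite size_map ss sl ltnn.
Qed.

Lemma alternation_list_with_left_end (R : realType) (n : nat) (a : R) (s : seq R) :
  -1 < a < 1 -> (forall x, alternation n a x <-> x \in s) -> uniq s -> size s = n.+2 ->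
  -1 \in s -> exists t l, [/\ `|t| = 1, size l = n.+1,
    alternates (approx_err a (minimax n a)) (Eerr n a) t (-1 :: l),
    (forall x, alternation n a x <-> x \in -1 :: l) &
    {in -1 :: l, forall x, -1 <= x <= 1}].
Proof.
move=> a1 sA us ss ms.
have [t [s' [t1 alt s'A _]]] := alternation_list n a1.
have srt := alternates_sorted alt.
have us' : uniq s' by move: srt; rewrite lt_sorted_uniq_le => /andP [].
have ss' : size s' = n.+2.
  rewrite -ss; apply/eqP; rewrite eqn_leq !uniq_leq_size // => x.
  - by move=> /sA /s'A.
  - by move=> /s'A /sA.
have s'1 : {in s', forall x, -1 <= x <= 1} by move=> x /s'A /alternationP [].
case: s' alt s'A srt us' ss' s'1 => // x0 l alt s'A srt us' ss' s'1.
have x0E : x0 = -1.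
  have : -1 \in x0 :: l by apply/s'A/sA.
  rewrite inE => /predU1P [//|ml]; move: srt; rewrite /= lt_path_sortedE.
  move=> /andP [/allP /(_ _ ml) lt _].
  have /andP [h _] := s'1 x0 (mem_head _ _).
  by have := lt_le_trans lt h; rewrite ltxx.
by case: ss' => sl; rewrite x0E in alt s'A s'1; exists t, l.
Qed.

(** Rescaling from 1 keeps [Eerr] on one line between a and the parameter c for which z is moved to
    -1. At c there are n + 3 alternation points, so c is a tip. Since the line does not continue to
    the left of a, the maximal V-shape with tip c starts at a. *)
Lemma critical_left_end_exceptional (R : realType) (n : nat) (a : R) (s : seq R) :
  -1 < a < 1 -> (forall x, alternation n a x <-> x \in s) -> uniq s -> size s = n.+2 ->
  -1 \in s -> -1 - (minimax n a)^`().[-1] = 0 -> Vshape_exceptional (@Eerr R n) a.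
Proof.
move=> a11 sA us ss ms crit; have E0 := Eerr_gt0 n a11; have [sp _] := minimax_spec n a.
have [t [l [t1 sl alt lA l1]]] := alternation_list_with_left_end a11 sA us ss ms.
clear sA us ss ms s; have /andP [a_gt a1] := a11.
have t1N : `|- t| = 1 by rewrite normrN.
have eE := @Eerr_ub _ n a.
have p2 : (minimax n a)^`()^`().[-1] != 0.
  have sz0 : (n.+2 <= size (-1 :: l)%R)%N by rewrite /= sl.
  have na1 : -1 != a by rewrite lt_eqF.
  have crit' : slope a (-1) - (minimax n a)^`().[-1] = 0 by rewrite /slope a_gt.
  exact: (critical_nondegenerate sp (minimax_deriv_kink n a11) t1N na1
    (alternates_zigzag E0 t1 alt) sz0 (mem_head _ _) crit').
have [z [z1 ez ezE]] := critical_left_end_extension a11 t1 sp E0 alt sl eE crit p2.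
clear crit p2.
have altz : alternates (approx_err a (minimax n a)) (Eerr n a) (- t) [:: z, -1 & l].
  by apply/and3P; split; rewrite ?ez ?opprK.
have a0 : 0 < 1 - a by rewrite subr_gt0.
have z0 : 0 < 1 - z by rewrite subr_gt0 (lt_trans z1) // ltrN10.
have lz : {in [:: z, -1 & l], forall y, z <= y <= 1}.
  move=> y; rewrite inE => /predU1P [->|/l1 /andP [h1 ->]].
    by rewrite lexx (ltW (lt_trans z1 _)) // ltrN10.
  by rewrite (le_trans (ltW z1)).
(* For this c the homothety of ratio (1 - c) / (1 - a) maps [z, 1] onto [-1, 1]. *)
pose c : R := 1 - 2 * (1 - a) / (1 - z).
have cz : (1 - c) * (1 - z) = 2 * (1 - a).
  have -> : 1 - c = 2 * (1 - a) / (1 - z) by rewrite /c; ring.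
  by rewrite divfK // gt_eqF.
have [ac c1] : a < c /\ c < 1 by clear -cz a0 z0 z1; split; nra.
clearbody c.
have c11 : -1 < c < 1 by rewrite (lt_trans a_gt).
have szz : (n.+3 <= size [:: z, -1 & l]%R)%N by rewrite /= sl.
have hz : 2 * (1 - a) <= (1 - c) * (1 - z) by rewrite cz.
have hz' : (1 - c) * (1 - z) <= 2 * (1 - a) by rewrite cz.
have [rc _ Ec altc] := Eerr_rescale_right a1 t1N sp altz (ltnW szz) lz ezE c1 hz hz'.
have sc1 : {in map (rescale 1 ((1 - c) / (1 - a))) [:: z, -1 & l], forall x, -1 <= x <= 1}.
  have te : (1 - c) / (1 - a) * (1 - z) = 2 by rewrite mulrAC cz mulfK // gt_eqF.
  have t0 : 0 < (1 - c) / (1 - a) by rewrite divr_gt0 // subr_gt0.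
  move: te t0; set tau := _ / _ => te t0 _ /mapP [y /lz /andP [y1 y2] ->].
  by rewrite /rescale; clear -te t0 y1 y2; apply/andP; split; nra.
have szc : (n.+3 <= size (map (rescale 1 ((1 - c) / (1 - a))) [:: z, -1 & l]%R))%N.
  by rewrite size_map.
have [d d0 hr] := tip_right c11 t1N altc szc sc1.
clear altc sc1 szc altz szz lz hz hz'.
have hl x : a <= x <= c -> Eerr n x = Eerr n a / (1 - a) * (1 - x).
  move=> /andP [ax xc].
  have x1 : x < 1 by exact: le_lt_trans c1.
  have h1 : 2 * (1 - a) <= (1 - x) * (1 - z) by rewrite -cz ler_pM2r // lerD2l lerN2.
  have h2 : (1 - x) * (1 - -1) <= 2 * (1 - a) by clear -ax; lra.
  have sz0 : (n.+2 <= size (-1 :: l)%R)%N by rewrite /= sl.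
  by have [] := Eerr_rescale_right a1 t1 sp alt sz0 l1 ezE x1 h1 h2.
pose b : R := Num.min 1 (c + d).
have [r1 r2 r3] : [/\ b <= c + d, b <= 1 & c < b].
  by rewrite /b !ge_min !lexx orbT lt_min c1 ltrDl d0.
have k0 : 0 < Eerr n a / (1 - a) by rewrite divr_gt0.
have l0 : 0 < Eerr n c / (1 + c).
  by rewrite divr_gt0 ?Eerr_gt0 // -ltrBlDl sub0r; case/andP: c11.
have acb : a < c < b by rewrite ac.
have hr' x : c <= x <= b -> Eerr n x = Eerr n c / (1 + c) * (1 + x).
  by move=> /andP [x1 x2]; apply: hr; rewrite x1 (le_trans x2).
have [a' [b' [a'a ha' vs]]] :=
  maximal_vshape (@continuous_Eerr R n) (ltW a_gt) r2 acb k0 l0 hl hr'.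
have [a'1 _] : -1 <= a' /\ b' <= 1 by case: vs.
move: a'a; rewrite le_eqVlt => /predU1P [a'a|a'a].
  by exists a', c, b'; split => //; apply: Or31.
have xa : -1 < (a' + a) / 2 < a by clear -a'a a'1; lra.
case: (@line_through_right_end_stops R n a ((a' + a) / 2) l a1 _ sl xa) => [y /lA //|].
by apply: ha'; clear -a'a ac; lra.
Qed.

(** * Reflection, and the right end by symmetry *)

Lemma approx_err_opp (R : realType) (a x : R) (p : {poly R}) :
  approx_err (- a) (p \Po (- 'X)) x = approx_err a p (- x).
Proof.
rewrite /approx_err horner_comp hornerN hornerX; congr (_ - _).
by rewrite -normrN; congr (`|_|); ring.
Qed.

Lemma size_comp_polyN (R : realFieldType) (n : nat) (p : {poly R}) :
  (size p <= n)%N -> (size (p \Po (- 'X)) <= n)%N.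
Proof. by rewrite size_comp_poly2 // size_polyN size_polyX. Qed.

Lemma Eerr_opp (R : realType) (n : nat) (a : R) : Eerr n (- a) = Eerr n a.
Proof.
have le (b : R) : Eerr n (- b) <= Eerr n b.
  have [sp ep] := minimax_spec n b.
  apply: le_trans (Eerr_le _ (size_comp_polyN sp)) _.
  apply: unorm_le => [|x x1]; first exact: continuous_approx_err.
  by rewrite approx_err_opp Eerr_ub //; lra.
by apply/eqP; rewrite eq_le le -{1}[a]opprK le.
Qed.

Lemma minimax_opp (R : realType) (n : nat) (a : R) : -1 < a < 1 ->
  minimax n (- a) = minimax n a \Po (- 'X).
Proof.
move=> a1; have Na1 : -1 < - a < 1 by lra.
have [t [s [t1 ss alt s1]]] := minimax_alternates n Na1.
have [sp _] := minimax_spec n (- a); have [sp' _] := minimax_spec n a.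
apply/esym; apply: (alternates_unique t1 sp (size_comp_polyN sp') alt); first by rewrite ss.
by move=> x /s1 x1; rewrite approx_err_opp Eerr_opp Eerr_ub //; lra.
Qed.

Lemma alternation_opp (R : realType) (n : nat) (a x : R) : -1 < a < 1 ->
  alternation n (- a) x <-> alternation n a (- x).
Proof.
move=> a1; rewrite !alternationP minimax_opp // approx_err_opp Eerr_opp.
by split=> -[h ->]; split => //; lra.
Qed.

Lemma has_Vshape_opp (R : realType) (E : R -> R) (a c b : R) :
  continuous E -> (forall x, E (- x) = E x) ->
  has_Vshape E a c b -> has_Vshape E (- b) (- c) (- a).
Proof.
move=> Ec Eo [acb _ [[s1 [t1 h1]] dec] [[s2 [t2 h2]] inc]].
have flip (u v x : R) : x \in `[(- u), (- v)] -> - x \in `[v, u] by rewrite !in_itv /=; lra.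
split; [lra|exact: continuous_subspaceT| |].
- split; first by exists (- s2), t2 => x /flip /h2; rewrite Eo => ->; ring.
  by move=> x y /flip hx /flip hy yx; rewrite -(Eo x) -(Eo y); apply: inc; rewrite ?ltrN2.
- split; first by exists (- s1), t1 => x /flip /h1; rewrite Eo => ->; ring.
  by move=> x y /flip hx /flip hy yx; rewrite -(Eo x) -(Eo y); apply: dec; rewrite ?ltrN2.
Qed.

Lemma Vshape_exceptional_opp (R : realType) (n : nat) (a : R) :
  Vshape_exceptional (@Eerr R n) (- a) -> Vshape_exceptional (@Eerr R n) a.
Proof.
move=> [x [c [y [[[x1 y1] vs mx] h]]]].
have opp u v w := @has_Vshape_opp _ _ u v w (@continuous_Eerr R n) (@Eerr_opp R n).
exists (- y), (- c), (- x); split; last first.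
  by case: h => h; [apply: Or33|apply: Or32|apply: Or31]; lra.
split; [lra|exact: opp|].
move=> u w v u1 v1 vs' uy xv.
have [||||h1 h2] := mx (- v) (- w) (- u) _ _ (opp _ _ _ vs'); [lra|lra|lra|lra|].
by have [] := (h1, h2); lra.
Qed.

Lemma critical_right_end_exceptional (R : realType) (n : nat) (a : R) (s : seq R) :
  -1 < a < 1 -> (forall x, alternation n a x <-> x \in s) -> uniq s -> size s = n.+2 ->
  1 \in s -> 1 - (minimax n a)^`().[1] = 0 -> Vshape_exceptional (@Eerr R n) a.
Proof.
move=> a1 sA us ss ms crit; apply: Vshape_exceptional_opp.
apply: (@critical_left_end_exceptional _ _ _ (map -%R s)).
- lra.
- move=> x; rewrite alternation_opp // sA -{2}[x]opprK mem_map //; exact: oppr_inj.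
- by rewrite map_inj_uniq //; exact: oppr_inj.
- by rewrite size_map.
- by rewrite mem_map //; exact: oppr_inj.
rewrite minimax_opp // deriv_comp hornerM horner_comp derivN derivX.
by rewrite !(hornerN, hornerX, hornerC) opprK mulrN1 opprK; lra.
Qed.

(** Each case provides the equation that governs the point for neighbouring parameters: it follows
    the kink, it stays critical, or it stays at the end of the interval. *)
Definition regular_point (R : realType) (a : R) (p : {poly R}) (x : R) : Prop :=
  [\/ x = a,
      [/\ x != a, -1 < x < 1, slope a x - p^`().[x] = 0 & p^`()^`().[x] != 0] |
      (x = -1 \/ x = 1) /\ slope a x - p^`().[x] != 0].

Lemma regular_alternation (R : realType) (n : nat) (a : R) :
  -1 < a < 1 -> ~ Vshape_exceptional (@Eerr R n) a ->
  exists t s, [/\ `|t| = 1, size s = n.+2,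
    alternates (approx_err a (minimax n a)) (Eerr n a) t s,
    (forall x, alternation n a x <-> x \in s) &
    {in s, forall x, regular_point a (minimax n a) x}].
Proof.
move=> a11 nexc; have [t [s [t1 alt sA ns]]] := alternation_list n a11.
have /andP [a_gt a_lt] := a11.
have s1 : {in s, forall x, -1 <= x <= 1} by move=> x /sA /alternationP [].
have ss : size s = n.+2.
  apply/eqP; rewrite eqn_leq; case/andP: ns => -> n3; rewrite andbT leqNgt.
  by apply/negP => n3'; apply: nexc; exact: tip_exceptional alt n3' s1.
have us : uniq s.
  by have := alternates_sorted alt; rewrite lt_sorted_uniq_le => /andP [].
have E0 := Eerr_gt0 n a11; have [sp _] := minimax_spec n a.
exists t, s; split => // x xs.
have [->|xa] := eqVneq x a; first exact: Or31.
have [xm|xm] := eqVneq x (-1).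
  apply: Or33; split; first by left.
  apply/eqP => crit; apply: nexc.
  rewrite xm in xs crit; rewrite /slope a_gt in crit.
  exact: critical_left_end_exceptional sA us ss xs crit.
have [xp|xp] := eqVneq x 1.
  apply: Or33; split; first by right.
  apply/eqP => crit; apply: nexc.
  rewrite xp in xs crit; rewrite /slope ltNge (ltW a_lt) /= in crit.
  exact: critical_right_end_exceptional sA us ss xs crit.
have x1 : -1 < x < 1.
  by have := s1 x xs; rewrite !le_eqVlt eq_sym (negPf xm) (negPf xp).
have [_ ex] := (alternationP n a x).1 ((sA x).2 xs).
have crit := interior_extremum_critical xa x1 E0 ex (@Eerr_ub _ n a).
apply: Or32; split => //.
have t1N : `|- t| = 1 by rewrite normrN.
apply: (critical_nondegenerate sp (minimax_deriv_kink n a11) t1N xa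
  (alternates_zigzag E0 t1 alt) _ xs crit); by rewrite ss.
Qed.

(** * Power series solutions of quadratic systems *)

Definition abs_poly (R : realFieldType) (p : {poly R}) : {poly R} :=
  \poly_(i < size p) `|p`_i|.

(** The sum of |p_k| r^k, written as a value of a polynomial so that its inequalities reduce to
    comparisons of coefficients. *)
Definition l1norm (R : realFieldType) (r : R) (p : {poly R}) : R := (abs_poly p).[r].

Lemma coef_abs_poly (R : realFieldType) (p : {poly R}) (k : nat) :
  (abs_poly p)`_k = `|p`_k|.
Proof.
by rewrite coef_poly; case: ltnP => // kp; rewrite nth_default ?normr0.
Qed.

Lemma ler_horner_coef (R : realFieldType) (p q : {poly R}) (r : R) :
  0 <= r -> (forall k, p`_k <= q`_k) -> p.[r] <= q.[r].
Proof.
move=> r0 pq; rewrite -subr_ge0 -hornerN -hornerD horner_coef sumr_ge0 // => i _.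
by rewrite mulr_ge0 ?exprn_ge0 // coefD coefN subr_ge0.
Qed.

Lemma l1norm_ge0 (R : realFieldType) (r : R) (p : {poly R}) : 0 <= r -> 0 <= l1norm r p.
Proof.
move=> r0; rewrite -(horner0 r) ler_horner_coef // => k.
by rewrite coef0 coef_abs_poly.
Qed.

Lemma l1norm0 (R : realFieldType) (r : R) : l1norm r 0 = 0.
Proof.
rewrite /l1norm (_ : abs_poly 0 = 0) ?horner0 //.
by apply/polyP => k; rewrite coef_abs_poly coef0 normr0.
Qed.

Lemma l1normD (R : realFieldType) (r : R) (p q : {poly R}) :
  0 <= r -> l1norm r (p + q) <= l1norm r p + l1norm r q.
Proof.
move=> r0; rewrite /l1norm -hornerD ler_horner_coef // => k.
by rewrite coefD !coef_abs_poly coefD ler_normD.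
Qed.

Lemma l1normZ (R : realFieldType) (r c : R) (p : {poly R}) :
  0 <= r -> l1norm r (c *: p) <= `|c| * l1norm r p.
Proof.
move=> r0; rewrite /l1norm -hornerZ ler_horner_coef // => k.
by rewrite coefZ !coef_abs_poly coefZ normrM.
Qed.

Lemma l1normM (R : realFieldType) (r : R) (p q : {poly R}) :
  0 <= r -> l1norm r (p * q) <= l1norm r p * l1norm r q.
Proof.
move=> r0; rewrite /l1norm -hornerM ler_horner_coef // => k.
rewrite coef_abs_poly !coefM (le_trans (ler_norm_sum _ _ _)) // ler_sum // => i _.
by rewrite normrM !coef_abs_poly.
Qed.

Lemma l1norm_sum (R : realFieldType) (r : R) (I : finType) (F : I -> {poly R}) :
  0 <= r -> l1norm r (\sum_i F i) <= \sum_i l1norm r (F i).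
Proof.
move=> r0; elim/big_rec2: _ => [|i x p _ h]; first by rewrite l1norm0.
by apply: le_trans (l1normD _ _ r0) _; rewrite lerD2l.
Qed.

Lemma l1normX (R : realFieldType) (r : R) : l1norm r 'X = r.
Proof.
rewrite /l1norm (_ : abs_poly 'X = 'X) ?hornerX //.
apply/polyP => k; rewrite coef_abs_poly coefX ger0_norm //.
Qed.

Lemma norm_horner_le (R : realFieldType) (r t : R) (p : {poly R}) :
  `|t| <= r -> `|p.[t]| <= l1norm r p.
Proof.
move=> tr; have r0 : 0 <= r by exact: le_trans tr.
rewrite /l1norm /abs_poly horner_poly horner_coef.
rewrite (le_trans (ler_norm_sum _ _ _)) // ler_sum // => i _.
by rewrite normrM ler_wpM2l // normrX lerXn2r // nnegrE.
Qed.

Lemma l1norm_mulXn (R : realFieldType) (r : R) (N : nat) (p : {poly R}) :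
  0 < r -> l1norm r p = l1norm r (p * 'X^N) / r ^+ N.
Proof.
move=> r0; have -> : l1norm r (p * 'X^N) = l1norm r p * r ^+ N.
  rewrite /l1norm -[in RHS]hornerXn -hornerM; congr (_.[_]); apply/polyP => k.
  rewrite coef_abs_poly !coefMXn; case: ifP => _; first by rewrite normr0.
  by rewrite coef_abs_poly.
by rewrite mulfK // expf_neq0 // gt_eqF.
Qed.

(** A form of Schwarz's lemma for the weighted norm: dividing by X^N divides the norm by r^N. *)
Lemma norm_horner_vanishing (R : realFieldType) (r t : R) (N : nat) (p : {poly R}) :
  0 < r -> `|t| <= r -> 'X^N %| p -> `|p.[t]| <= (`|t| / r) ^+ N * l1norm r p.
Proof.
move=> r0 tr /dvdpP [q ->]; rewrite hornerM hornerXn normrM normrX mulrC expr_div_n -mulrA.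
rewrite ler_wpM2l ?exprn_ge0 // mulrC -l1norm_mulXn //; exact: norm_horner_le.
Qed.

Lemma cvg_finsum (R : realType) (T : Type) (F : set_system T) (I : finType)
    (u : I -> T -> R) (l : I -> R) : Filter F ->
  (forall i, u i x @[x --> F] --> l i) ->
  \sum_i u i x @[x --> F] --> \sum_i l i.
Proof.
move=> FF ul; elim: (index_enum I) => [|i s IH].
  by rewrite big_nil; under eq_fun do rewrite big_nil; exact: cvg_cst.
by rewrite big_cons; under eq_fun do rewrite big_cons; exact: cvgD.
Qed.

Section FixedPointIteration.
Variables (R : realType) (I : finType) (c : I -> R) (K : I -> I -> R) (f g : I -> I).

(** A Picard step for the system W_i = c_i t + sum_j K_ij W_(f j) W_(g j), carried out on
    polynomials in t. *)
Definition fp_step (P : I -> {poly R}) (i : I) : {poly R} :=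
  c i *: 'X + \sum_j K i j *: (P (f j) * P (g j)).

Definition fp_iter (N : nat) : I -> {poly R} := iter N fp_step (fun=> 0).

(** The coefficient of degree k no longer changes after k steps, hence the diagonal. *)
Definition fp_coef (i : I) : R^nat := fun k => (fp_iter k i)`_k.

Lemma dvdp_sumK (d : {poly R}) (F : I -> {poly R}) (k : I -> R) :
  (forall j, d %| F j) -> d %| \sum_j k j *: F j.
Proof.
move=> dF; elim/big_ind: _ => [|p q dp dq|j _]; first exact: dvdp0.
  exact: dvdp_add.
by rewrite -mul_polyC dvdp_mull.
Qed.

Lemma dvdX_fp_iter (N : nat) (i : I) : 'X %| fp_iter N i.
Proof.
elim: N i => [|N IH] i; first exact: dvdp0.
rewrite /fp_iter iterS -/(fp_iter N) /fp_step dvdp_add //.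
  by rewrite -mul_polyC dvdp_mull.
by apply: dvdp_sumK => j; rewrite dvdp_mull.
Qed.

(** A difference of products splits into terms with a factor divisible by the previous power of X
    and another divisible by X, as the iterates have no constant term. Each step thus fixes one more
    coefficient. *)
Lemma dvdXn_fp_iterS (N : nat) (i : I) : 'X^(N.+1) %| fp_iter N.+1 i - fp_iter N i.
Proof.
elim: N i => [|N IH] i; first by rewrite subr0 expr1 dvdX_fp_iter.
rewrite {1}/fp_iter iterS -/(fp_iter N.+1) {2}/fp_iter iterS -/(fp_iter N) /fp_step.
rewrite opprD addrACA subrr add0r -sumrB.
rewrite (eq_bigr (fun j => K i j *: ((fp_iter N.+1 (f j) - fp_iter N (f j)) * fp_iter N.+1 (g j)
   + fp_iter N (f j) * (fp_iter N.+1 (g j) - fp_iter N (g j))))); last first.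
  by move=> j _; rewrite -scalerBr; congr (_ *: _); ring.
apply: dvdp_sumK => j; apply: dvdp_add.
  by rewrite exprSr dvdp_mul // dvdX_fp_iter.
by rewrite exprS dvdp_mul // dvdX_fp_iter.
Qed.

Lemma coef_fp_iter (N k : nat) (i : I) : (k <= N)%N -> (fp_iter N i)`_k = fp_coef i k.
Proof.
elim: N => [|N IH]; first by rewrite leqn0 => /eqP ->.
rewrite leq_eqVlt => /predU1P [->//|kN].
rewrite -IH //; apply/eqP; rewrite -subr_eq0 -coefB.
by have /dvdpP [q ->] := dvdXn_fp_iterS N i; rewrite coefMXn kN.
Qed.

Variables (r rho : R).
Hypotheses (r0 : 0 < r) (rho0 : 0 < rho).
Hypothesis stable : forall i, `|c i| * r + (\sum_j `|K i j|) * (rho * rho) <= rho.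

(** By [stable] a step maps the ball of radius rho into itself. *)
Lemma l1norm_fp_iter (N : nat) (i : I) : l1norm r (fp_iter N i) <= rho.
Proof.
have r0' := ltW r0.
elim: N i => [|N IH] i; first by rewrite l1norm0 ltW.
rewrite /fp_iter iterS -/(fp_iter N) /fp_step.
apply: le_trans (l1normD _ _ r0') _; apply: le_trans (stable i); apply: lerD.
  by rewrite -{2}(l1normX r) l1normZ.
apply: le_trans (l1norm_sum _ r0') _; rewrite mulr_suml; apply: ler_sum => j _.
apply: le_trans (l1normZ _ _ r0') _; rewrite ler_wpM2l //.
by apply: le_trans (l1normM _ _ r0') _; rewrite ler_pM ?l1norm_ge0.
Qed.

Definition fp_trunc (N : nat) (i : I) : {poly R} := \poly_(k < N) fp_coef i k.

Lemma dvd_fp_trunc (N : nat) (i : I) : 'X^N %| fp_iter N i - fp_trunc N i.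
Proof.
have -> : fp_iter N i - fp_trunc N i = drop_poly N (fp_iter N i) * 'X^N.
  rewrite -{1}(poly_take_drop N (fp_iter N i)) addrAC -[RHS]add0r; congr (_ + _).
  apply/eqP; rewrite subr_eq0; apply/eqP/polyP => k.
  rewrite coef_take_poly coef_poly; case: ltnP => // kN.
  by rewrite coef_fp_iter // ltnW.
exact: dvdp_mull.
Qed.

Lemma l1norm_fp_trunc (N : nat) (i : I) : l1norm r (fp_trunc N i) <= rho.
Proof.
apply: le_trans (l1norm_fp_iter N i); apply: ler_horner_coef (ltW r0) _ => k.
rewrite !coef_abs_poly coef_poly; case: ltnP => kN; last by rewrite normr0.
by rewrite coef_fp_iter // ltnW.
Qed.

Lemma pseries_fp_coef (t : R) (i : I) :
  pseries (fp_coef i) t = (fun N => (fp_trunc N i).[t]).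
Proof.
by apply/funext => N; rewrite /pseries /series /= horner_poly big_mkord.
Qed.

Lemma is_cvg_pseries_fp_coef (t : R) (i : I) : `|t| < r -> cvgn (pseries (fp_coef i) t).
Proof.
move=> tr; apply: normed_cvg; apply: nondecreasing_is_cvgn.
  by apply: nondecreasing_series => n _ _ /=.
exists rho => _ [N _ <-] /=.
apply: le_trans (l1norm_fp_trunc N i).
have sa : (size (abs_poly (fp_trunc N i)) <= N)%N.
  by apply: leq_trans (size_poly _ _) _; exact: size_poly.
rewrite /series /= big_mkord /l1norm (horner_coef_wide _ sa); apply: ler_sum => k _.
rewrite coef_abs_poly coef_poly ltn_ord normrM ler_wpM2l // normrX.
by rewrite lerXn2r ?nnegrE ?(ltW r0) // ltW.
Qed.

Definition fp_sol (t : R) (i : I) : R := limn (pseries (fp_coef i) t).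

Lemma cvg_pseries_fp_sol (t : R) (i : I) : `|t| < r ->
  pseries (fp_coef i) t @ \oo --> fp_sol t i.
Proof. exact: is_cvg_pseries_fp_coef. Qed.

(** The N-th iterate and the N-th partial sum agree below degree N and are bounded in norm, so their
    difference at t tends to 0. The equation for the limit can then be read off from the iterates,
    without multiplying series. *)
Lemma cvg_fp_iter (t : R) (i : I) : `|t| < r ->
  (fp_iter N i).[t] @[N --> \oo] --> fp_sol t i.
Proof.
move=> tr; have := @cvg_pseries_fp_sol t i tr; rewrite pseries_fp_coef => ct.
have c0 : (fp_iter N i).[t] - (fp_trunc N i).[t] @[N --> \oo] --> (0 : R).
  have th : `| `|t| / r | < 1 by rewrite ger0_norm ?divr_ge0 ?(ltW r0) // ltr_pdivrMr // mul1r.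
  have cz : (`|t| / r) ^+ N * (rho + rho) @[N --> \oo] --> (0 : R).
    by rewrite -[0](mul0r (rho + rho)); apply: cvgM; [exact: cvg_expr|exact: cvg_cst].
  have czN : - ((`|t| / r) ^+ N * (rho + rho)) @[N --> \oo] --> (0 : R).
    by rewrite -[0]oppr0; exact: cvgN.
  apply: (squeeze_cvgr _ czN cz); apply: nearW => N.
  rewrite -ler_norml -hornerN -hornerD.
  apply: le_trans (norm_horner_vanishing r0 (ltW tr) (dvd_fp_trunc N i)) _.
  rewrite ler_wpM2l ?exprn_ge0 ?divr_ge0 ?(ltW r0) //.
  apply: le_trans (l1normD _ _ (ltW r0)) _; apply: lerD; first exact: l1norm_fp_iter.
  apply: le_trans (l1norm_fp_trunc N i); rewrite -scaleN1r.
  by apply: le_trans (l1normZ _ _ (ltW r0)) _; rewrite normrN normr1 mul1r.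
have -> : (fun N => (fp_iter N i).[t]) =
    (fun N => ((fp_iter N i).[t] - (fp_trunc N i).[t]) + (fp_trunc N i).[t]).
  by apply/funext => N; rewrite subrK.
by rewrite -[fp_sol t i]add0r; exact: cvgD.
Qed.

Lemma fp_solE (t : R) (i : I) : `|t| < r ->
  fp_sol t i = c i * t + \sum_j K i j * (fp_sol t (f j) * fp_sol t (g j)).
Proof.
move=> tr; have h1 : (fp_iter N.+1 i).[t] @[N --> \oo] --> fp_sol t i.
  by rewrite (cvg_shiftS (fun N => (fp_iter N i).[t])); exact: cvg_fp_iter.
have h2 : (fp_iter N.+1 i).[t] @[N --> \oo] -->
    c i * t + \sum_j K i j * (fp_sol t (f j) * fp_sol t (g j)).
  have -> : (fun N => (fp_iter N.+1 i).[t]) = (fun N => c i * t +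
      \sum_j K i j * ((fp_iter N (f j)).[t] * (fp_iter N (g j)).[t])).
    apply/funext => N; rewrite /fp_iter iterS -/(fp_iter N) /fp_step.
    rewrite hornerD hornerZ hornerX horner_sum; congr (_ + _).
    by apply: eq_bigr => j _; rewrite hornerZ hornerM.
  apply: cvgD; first exact: cvg_cst.
  apply: cvg_finsum => j; apply: cvgM; first exact: cvg_cst.
  by apply: cvgM; exact: cvg_fp_iter.
exact: (cvg_unique _ h1 h2).
Qed.

Lemma norm_fp_sol (t : R) (i : I) : `|t| < r -> `|fp_sol t i| <= rho / r * `|t|.
Proof.
move=> tr; have h : `|(fp_iter N i).[t]| @[N --> \oo] --> `|fp_sol t i|.
  by apply: cvg_norm; exact: cvg_fp_iter.
apply: (ler_cvg_to h (cvg_cst (rho / r * `|t|))); apply: nearW => N.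
have := norm_horner_vanishing (N := 1) r0 (ltW tr).
move=> /(_ (fp_iter N i)); rewrite expr1 dvdX_fp_iter => /(_ isT) H.
apply: le_trans H _; rewrite expr1 mulrC mulrAC -mulrA ler_wpM2r ?l1norm_fp_iter //.
by rewrite divr_ge0 ?(ltW r0).
Qed.

End FixedPointIteration.

Lemma quadratic_fixed_point (R : realType) (I : finType) (c : I -> R) (K : I -> I -> R)
    (f g : I -> I) :
  exists (r B : R) (a : I -> R^nat) (W : R -> I -> R), 0 < r /\
    forall t, `|t| < r -> [/\ forall i, pseries (a i) t @ \oo --> W t i,
      forall i, W t i = c i * t + \sum_j K i j * (W t (f j) * W t (g j)) &
      forall i, `|W t i| <= B * `|t|].
Proof.
pose C := \sum_i `|c i|; pose k := \sum_i \sum_j `|K i j|.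
have C0 : 0 <= C by rewrite sumr_ge0.
have k0 : 0 <= k by rewrite sumr_ge0 // => i _; rewrite sumr_ge0.
(* With these radii the linear and the quadratic part of a step contribute at most rho / 2 each. *)
pose rho := (2 * (k + 1))^-1; pose r := rho / (2 * (C + 1)).
have rho0 : 0 < rho by rewrite invr_gt0; lra.
have r0 : 0 < r by rewrite divr_gt0 //; lra.
have stable i : `|c i| * r + (\sum_j `|K i j|) * (rho * rho) <= rho.
  have h1 : `|c i| <= C by rewrite /C (bigD1 i) //= lerDl sumr_ge0.
  have h2 : \sum_j `|K i j| <= k.
    by rewrite /k [leRHS](bigD1 i) //= lerDl sumr_ge0 // => i' _; rewrite sumr_ge0.
  rewrite [leRHS](_ : rho = rho / 2 + rho / 2); last lra.
  apply: lerD.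
    apply: le_trans (_ : C * r <= _); first by rewrite ler_wpM2r // ltW.
    rewrite /r mulrA ler_pdivrMr; last lra.
    have -> : rho / 2 * (2 * (C + 1)) = C * rho + rho by field.
    by rewrite lerDl ltW.
  apply: le_trans (_ : k * (rho * rho) <= _); first by rewrite ler_wpM2r // mulr_ge0 // ltW.
  have k1 : k + 1 != 0 by rewrite gt_eqF //; lra.
  have e : (k + 1) * rho = 2^-1 by rewrite /rho; field.
  have -> : k * (rho * rho) = (k + 1) * rho * rho - rho * rho by ring.
  have rr : 0 < rho * rho by rewrite mulr_gt0.
  by rewrite e; lra.
exists r, (rho / r), (fp_coef c K f g), (fp_sol c K f g); split => // t tr; split => i.
- exact: cvg_pseries_fp_sol r0 rho0 stable _ _ tr.
- exact: fp_solE r0 rho0 stable _ _ tr.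
- exact: norm_fp_sol r0 rho0 stable _ _ tr.
Qed.

(** A square system given by its equations, so that the alternation system can be written by cases
    on the kind of unknown rather than as a matrix. *)
Definition linear_family (R : realType) (I : finType) (L : (I -> R) -> I -> R) : Prop :=
  forall (a : R) (u v : I -> R) (j : I),
    L (fun i => a * u i + v i) j = a * L u j + L v j.

Lemma linear_family_expand (R : realType) (I : finType) (L : (I -> R) -> I -> R)
    (u : I -> R) (j : I) :
  linear_family L -> L u j = \sum_i u i * L (fun k => (k == i)%:R) j.
Proof.
move=> hL.
have L0 : L (fun=> 0) j = 0.
  have := hL 1 (fun=> 0) (fun=> 0) j.
  have -> : (fun _ : I => 1 * 0 + 0) = (fun=> 0 : R) by apply/funext => i; rewrite mulr0 addr0.
  by rewrite mul1r; move: (L _ j) => z; lra.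
have key s : uniq s -> L (fun k => if k \in s then u k else 0) j =
    \sum_(i <- s) u i * L (fun k => (k == i)%:R) j.
  elim: s => [|i s IH] us; first by rewrite big_nil -[RHS]L0.
  move: us => /= /andP [is_ us].
  rewrite big_cons -IH // -hL; congr (L _ j); apply/funext => k.
  rewrite inE; case: eqVneq => [->|ki] /=; last by rewrite mulr0 add0r.
  by rewrite (negPf is_) mulr1 addr0.
have -> : u = (fun k => if k \in index_enum I then u k else 0).
  by apply/funext => k; rewrite mem_index_enum.
rewrite key ?index_enum_uniq //; apply: eq_bigr => i _.
by rewrite mem_index_enum.
Qed.

Lemma linear_family_inverse (R : realType) (I : finType) (L : (I -> R) -> I -> R) :
  linear_family L -> (forall u, (forall j, L u j = 0) -> forall i, u i = 0) ->
  exists N : I -> I -> R, forall w j, L (fun i => \sum_k w k * N k i) j = w j.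
Proof.
move=> hL inj.
pose M : 'M[R]_#|I| := \matrix_(i, j) L (fun k => (k == enum_val i)%:R) (enum_val j).
have Mv (v : 'rV[R]_#|I|) j : (v *m M) 0 j = L (fun i => v 0 (enum_rank i)) (enum_val j).
  rewrite mxE linear_family_expand // [RHS](reindex _ (onW_bij _ (enum_val_bij I))) /=.
  by apply: eq_bigr => i _; rewrite mxE enum_valK.
have Mu : M \in unitmx.
  rewrite -row_free_unit; apply: inj_row_free => v vM; apply/rowP => i.
  rewrite mxE -[i]enum_valK.
  apply: (inj (fun i => v 0 (enum_rank i))) => j.
  by rewrite -[j]enum_rankK -Mv vM mxE.
exists (fun k i => invmx M (enum_rank k) (enum_rank i)) => w j.
pose v : 'rV[R]_#|I| := \row_k w (enum_val k).
transitivity ((v *m invmx M *m M) 0 (enum_rank j)); last first.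
  by rewrite mulmxKV // mxE enum_rankK.
rewrite Mv enum_rankK; congr (L _ j); apply/funext => i; rewrite mxE.
rewrite (reindex _ (onW_bij _ (enum_val_bij I))) /=.
by apply: eq_bigr => k _; rewrite mxE enum_valK.
Qed.

(** The inverse of [L] turns the system into a fixed-point equation. One product per equation, with
    freely chosen factors, is exactly what a Horner step produces. *)
Lemma quadratic_implicit_function (R : realType) (I : finType) (L : (I -> R) -> I -> R)
    (c b : I -> R) (f g : I -> I) :
  linear_family L -> (forall u, (forall j, L u j = 0) -> forall i, u i = 0) ->
  exists (r B : R) (a : I -> R^nat) (W : R -> I -> R), 0 < r /\
    forall t, `|t| < r -> [/\ forall i, pseries (a i) t @ \oo --> W t i,
      forall j, t * c j + L (W t) j + b j * (W t (f j) * W t (g j)) = 0 &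
      forall i, `|W t i| <= B * `|t|].
Proof.
move=> hL inj; have [N hN] := linear_family_inverse hL inj.
have [r [B [a [W [r0 h]]]]] := quadratic_fixed_point
  (fun i => - \sum_k c k * N k i) (fun i j => - (b j * N j i)) f g.
exists r, B, a, W; split => // t /h [ca eW bW]; split => // j.
suff -> : L (W t) j = - (t * c j + b j * (W t (f j) * W t (g j))) by ring.
rewrite -(hN (fun k => - (t * c k + b k * (W t (f k) * W t (g k)))) j).
congr (L _ j); apply/funext => i; rewrite {1}eW mulNr mulr_suml -sumrN -big_split /=.
by apply: eq_bigr => k _; ring.
Qed.

(** * The alternation system *)

(** The polynomials [drop_poly m q] are the tails that Horner's scheme evaluates. *)
Lemma drop_polyS (R : nzRingType) (m : nat) (q : {poly R}) :
  drop_poly m q = (q`_m)%:P + drop_poly m.+1 q * 'X.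
Proof.
apply/polyP => k; rewrite coefD coefC coefMX !coef_drop_poly.
by case: k => [|k] /=; rewrite ?addr0 ?add0r ?addSnnS.
Qed.

Lemma horner_drop_polyS (R : comNzRingType) (m : nat) (q : {poly R}) (x : R) :
  (drop_poly m q).[x] = q`_m + x * (drop_poly m.+1 q).[x].
Proof. by rewrite drop_polyS !hornerE mulrC. Qed.

Lemma deriv_drop_polyS (R : comNzRingType) (m : nat) (q : {poly R}) :
  (drop_poly m q)^`() = drop_poly m.+1 q + 'X * (drop_poly m.+1 q)^`().
Proof. by rewrite drop_polyS derivD derivC add0r derivM derivX mulr1 addrC mulrC. Qed.

Lemma horner_deriv_drop_polyS (R : comNzRingType) (m : nat) (q : {poly R}) (x : R) :
  (drop_poly m q)^`().[x] = (drop_poly m.+1 q).[x] + x * (drop_poly m.+1 q)^`().[x].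
Proof. by rewrite deriv_drop_polyS !hornerE. Qed.

Lemma horner_deriv2_drop_polyS (R : comNzRingType) (m : nat) (q : {poly R}) (x : R) :
  (drop_poly m q)^`()^`().[x] = 2 * (drop_poly m.+1 q)^`().[x] + x * (drop_poly m.+1 q)^`()^`().[x].
Proof.
rewrite deriv_drop_polyS derivD derivM derivX mul1r !(hornerD, hornerM, hornerX); ring.
Qed.

Lemma drop_poly_eq0 (R : nzRingType) (n : nat) (q : {poly R}) :
  (size q <= n)%N -> drop_poly n q = 0.
Proof.
move=> sq; apply/polyP => k; rewrite coef_drop_poly coef0 nth_default //.
exact: leq_trans (leq_addl _ _).
Qed.

(** The recurrences determine h and g downwards from index n, and the values of the tails of q and
    of their derivatives satisfy them. *)
Lemma horner_scheme (R : comNzRingType) (n : nat) (q : {poly R}) (x : R) (h g : nat -> R) :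
  (size q <= n)%N -> h n = 0 -> g n = 0 ->
  (forall m, (m < n)%N -> h m = q`_m + x * h m.+1) ->
  (forall m, (m < n)%N -> g m = h m.+1 + x * g m.+1) ->
  h 0%N = q.[x] /\ g 0%N = q^`().[x].
Proof.
move=> sq hn gn hS gS.
have key k : (k <= n)%N -> h (n - k)%N = (drop_poly (n - k) q).[x] /\
    g (n - k)%N = (drop_poly (n - k) q)^`().[x].
  elim: k => [_|k IH kn]; first by rewrite subn0 hn gn drop_poly_eq0 // deriv0 horner0.
  have e : (n - k = (n - k.+1).+1)%N by lia.
  have [h1 g1] := IH (ltnW kn); rewrite e in h1 g1.
  have lt : (n - k.+1 < n)%N by lia.
  rewrite hS // gS // h1 g1 -horner_drop_polyS; split => //.
  by rewrite (horner_deriv_drop_polyS (n - k.+1)).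
by have := key n (leqnn n); rewrite subnn drop_poly0l.
Qed.

Section AlternationSystem.
Variables (R : realType) (n : nat) (a E : R) (p : {poly R}).
Variables (x s sg kp : 'I_n.+2 -> R) (cr : 'I_n.+2 -> bool) (t0 : R).

Let J := 'I_n.+2.
Definition alt_index : finType := (J + J + (J * J) + (J * J))%type.

(* Unknowns: the coefficients of p followed by E, the alternation points, and the partial
   Horner values of p and p' at these points. *)
Definition iV (k : J) : alt_index := inl (inl (inl k)).
Definition iX (i : J) : alt_index := inl (inl (inr i)).
Definition iH (i m : J) : alt_index := inl (inr (i, m)).
Definition iG (i m : J) : alt_index := inr (i, m).

(** The linear part, in the increments w, of four kinds of equations: the level at point i; its
    criticality or prescribed motion; the Horner recurrences for p and for p'. The Horner values of
    index n + 1 are zero. *)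
Definition alt_linear (w : alt_index -> R) (j : alt_index) : R :=
  match j with
  | inl (inl (inl i)) => s i * w (iX i) - w (iH i ord0) - sg i * w (iV ord_max)
  | inl (inl (inr i)) => if cr i then w (iG i ord0) else w (iX i)
  | inl (inr (i, m)) =>
      if m == ord_max then w (iH i m) else
      w (iH i m) - w (iV m) - x i * w (iH i (inord m.+1))
        - (drop_poly m.+1 p).[x i] * w (iX i)
  | inr (i, m) =>
      if m == ord_max then w (iG i m) else
      w (iG i m) - w (iH i (inord m.+1)) - x i * w (iG i (inord m.+1))
        - (drop_poly m.+1 p)^`().[x i] * w (iX i)
  end.

(** The terms proportional to t come from the moving kink: directly through the slopes in the level
    equations, and through the motion [kp] of the points that are not critical. *)
Definition alt_param (j : alt_index) : R :=
  match j with
  | inl (inl (inl i)) => - s i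
  | inl (inl (inr i)) => if cr i then 0 else - kp i
  | _ => 0
  end.

Definition alt_quad (j : alt_index) : R :=
  match j with
  | inl (inr (i, m)) => if m == ord_max then 0 else -1
  | inr (i, m) => if m == ord_max then 0 else -1
  | _ => 0
  end.

Definition alt_fst (j : alt_index) : alt_index :=
  match j with
  | inl (inr (i, m)) => iX i
  | inr (i, m) => iX i
  | _ => j
  end.

Definition alt_snd (j : alt_index) : alt_index :=
  match j with
  | inl (inr (i, m)) => iH i (inord m.+1)
  | inr (i, m) => iG i (inord m.+1)
  | _ => j
  end.

Lemma linear_family_alt_linear : linear_family alt_linear.
Proof.
move=> c u v [[[i|i]|[i m]]|[i m]] /=; first ring; first by case: ifP.
- by case: ifP => _ //; ring.
- by case: ifP => _ //; ring.
Qed.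

Hypothesis sp : (size p <= n.+1)%N.
Hypothesis xinc : forall i j : J, (i < j)%N -> x i < x j.
Hypothesis t01 : `|t0| = 1.
Hypothesis sgE : forall i, sg i = t0 * (-1) ^+ i.
Hypothesis crE : forall i, cr i -> s i = p^`().[x i] /\ p^`()^`().[x i] != 0.

Lemma inord_ltS (m : nat) : (m < n.+1)%N -> ((inord m : J) == ord_max) = false.
Proof. by move=> mn; apply/negbTE/eqP => /(congr1 val) /=; rewrite inordK; lia. Qed.

Lemma inord_max : (inord n.+1 : J) = ord_max.
Proof. by apply/val_inj; rewrite /= inordK. Qed.

Lemma inord0' : (inord 0 : J) = ord0.
Proof. by apply/val_inj; rewrite /= inordK. Qed.

(** If e is not zero, q alternates at n + 2 points, too many for its degree. This is the
    nonsingularity of the linear system in Remez's exchange algorithm. *)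
Lemma alternating_values_eq0 (q : {poly R}) (e : R) : (size q <= n.+1)%N ->
  (forall i, q.[x i] = - (sg i * e)) -> q = 0 /\ e = 0.
Proof.
move=> sq qx.
have xi i : (i < n.+1)%N -> x (inord i) < x (inord i.+1).
  by move=> i_n; apply: xinc; rewrite !inordK; lia.
have [e0|e0] := eqVneq e 0.
  split => //; apply: (@weak_alternation_eq0 _ n.+1 (fun i => x (inord i)) 1) => //.
  by move=> i _; rewrite qx e0 mulr0 oppr0 mulr0.
have tn0 : - (t0 * e) != 0 by rewrite oppr_eq0 mulf_neq0 // -normr_gt0 t01.
have q0 : q = 0.
  apply: (@weak_alternation_eq0 _ n.+1 (fun i => x (inord i)) (- (t0 * e))) => // i i_n.
  rewrite qx sgE inordK ?ltnS // -mulrA.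
  have -> : - (t0 * e) * ((-1) ^+ i * - (t0 * (-1) ^+ i * e)) = (t0 * (-1) ^+ i * e) ^+ 2.
    by ring.
  exact: sqr_ge0.
split=> //; have := qx ord0; rewrite q0 horner0 sgE expr0 mulr1.
by move/eqP; rewrite eq_sym oppr_eq0 mulf_eq0 -normr_eq0 t01 oner_eq0 => /eqP.
Qed.

(** For an element of the kernel, with displacements u_i of the points, the Horner equations give
    q(x_i) + p'(x_i) u_i and q'(x_i) + p''(x_i) u_i. At a critical point s_i = p'(x_i) cancels u_i
    from the level equation; elsewhere u_i = 0. So q takes alternating values and vanishes, and then
    p''(x_i) <> 0 yields u_i = 0. *)
Lemma alt_linear_inj (u : alt_index -> R) :
  (forall j, alt_linear u j = 0) -> forall i, u i = 0.
Proof.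
move=> u0.
pose q : {poly R} := \poly_(m < n.+1) u (iV (inord m)).
have sq : (size q <= n.+1)%N by exact: size_poly.
have qE m : (m < n.+1)%N -> q`_m = u (iV (inord m)) by move=> mn; rewrite coef_poly mn.
have hS i m : (m < n.+1)%N -> u (iH i (inord m)) = q`_m + x i * u (iH i (inord m.+1)) +
    (drop_poly m.+1 p).[x i] * u (iX i).
  move=> mn; have := u0 (iH i (inord m)); rewrite /= inord_ltS // qE // inordK; last by lia.
  by lra.
have gS i m : (m < n.+1)%N -> u (iG i (inord m)) = u (iH i (inord m.+1)) +
    x i * u (iG i (inord m.+1)) + (drop_poly m.+1 p)^`().[x i] * u (iX i).
  move=> mn; have := u0 (iG i (inord m)); rewrite /= inord_ltS // inordK; last by lia.
  by lra.
have hN i : u (iH i (inord n.+1)) = 0.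
  by have := u0 (iH i ord_max); rewrite /= eqxx inord_max.
have gN i : u (iG i (inord n.+1)) = 0.
  by have := u0 (iG i ord_max); rewrite /= eqxx inord_max.
have hg i : u (iH i ord0) = q.[x i] + p^`().[x i] * u (iX i) /\
    u (iG i ord0) = q^`().[x i] + p^`()^`().[x i] * u (iX i).
  (* Subtracting the effect of the displacement leaves the Horner scheme of q at x i. *)
  have [||||h1 h2] := @horner_scheme _ n.+1 q (x i)
    (fun m => u (iH i (inord m)) - (drop_poly m p)^`().[x i] * u (iX i))
    (fun m => u (iG i (inord m)) - (drop_poly m p)^`()^`().[x i] * u (iX i)) sq.
  - by rewrite hN drop_poly_eq0 // deriv0 horner0 mul0r subr0.
  - by rewrite gN drop_poly_eq0 // !deriv0 horner0 mul0r subr0.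
  - by move=> m mn; rewrite hS // (horner_deriv_drop_polyS m); ring.
  - by move=> m mn; rewrite gS // (horner_deriv2_drop_polyS m); ring.
  by move: h1 h2; rewrite inord0' drop_poly0l => <- <-; split; ring.
have qv i : q.[x i] = - (sg i * u (iV ord_max)).
  have [h1 h2] := hg i; have /= := u0 (iV i); have /= := u0 (iX i); rewrite h1.
  case: ifP => [/crE [-> _]|_ ->]; last by rewrite !mulr0; lra.
  by move=> _; lra.
have [q0 e0] := alternating_values_eq0 sq qv.
have uV k : u (iV k) = 0.
  have [->//|kn] := eqVneq k ord_max.
  have kn' : (k < n.+1)%N.
    by rewrite ltn_neqAle -ltnS ltn_ord andbT; apply: contra kn => /eqP e; apply/eqP/val_inj.
  by have := qE k kn'; rewrite q0 coef0 inord_val.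
have uX i : u (iX i) = 0.
  have [_ h2] := hg i; have /= := u0 (iX i); case: ifP => [/crE [_ p2]|//].
  rewrite h2 q0 deriv0 horner0 add0r => /eqP.
  by rewrite mulf_eq0 (negPf p2) => /eqP.
have uHG i k : (k <= n.+1)%N ->
    u (iH i (inord (n.+1 - k))) = 0 /\ u (iG i (inord (n.+1 - k))) = 0.
  elim: k => [|k IH] kn; first by rewrite subn0.
  have [h1 h2] := IH (ltnW kn).
  have e : (n.+1 - k = (n.+1 - k.+1).+1)%N by lia.
  have lt : (n.+1 - k.+1 < n.+1)%N by lia.
  by rewrite hS // gS // -e h1 h2 uX q0 coef0 !mulr0 !addr0.
move=> [[[k|i]|[i m]]|[i m]]; [exact: uV|exact: uX| |].
- have [+ _] := uHG i (n.+1 - m)%N (leq_subr _ _).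
  by rewrite subKn ?inord_val // -ltnS ltn_ord.
- have [_ +] := uHG i (n.+1 - m)%N (leq_subr _ _).
  by rewrite subKn ?inord_val // -ltnS ltn_ord.
Qed.

Hypothesis value : forall i, s i * (x i - a) - p.[x i] = sg i * E.

(** The equations hold for the unperturbed data, so adding the increments gives genuine Horner
    values of the new polynomial at the moved points. *)
Lemma alternation_continuation :
  exists (r B : R) (c : alt_index -> R^nat) (W : R -> alt_index -> R), 0 < r /\
    forall t, `|t| < r ->
    let q : {poly R} := \poly_(m < n.+1) (p`_m + W t (iV (inord m))) in
    let y i := x i + W t (iX i) in
    [/\ forall j, pseries (c j) t @ \oo --> W t j,
      forall j, `|W t j| <= B * `|t|,
      forall i, s i * (y i - (a + t)) - q.[y i] = sg i * (E + W t (iV ord_max)),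
      forall i, cr i -> q^`().[y i] = s i &
      forall i, ~~ cr i -> y i = x i + kp i * t].
Proof.
have [r [B [c [W [r0 h]]]]] := quadratic_implicit_function alt_param alt_quad alt_fst alt_snd
  linear_family_alt_linear alt_linear_inj.
exists r, B, c, W; split=> // t /h [cW eW bW] q y.
have hg i : p.[x i] + W t (iH i ord0) = q.[y i] /\
    p^`().[x i] + W t (iG i ord0) = q^`().[y i].
  have [|||||h1 h2] := @horner_scheme _ n.+1 q (y i)
    (fun m => (drop_poly m p).[x i] + W t (iH i (inord m)))
    (fun m => (drop_poly m p)^`().[x i] + W t (iG i (inord m))).
  - exact: size_poly.
  - have := eW (iH i ord_max); rewrite /= eqxx inord_max drop_poly_eq0 // horner0.
    by rewrite mulr0 mul0r !add0r addr0.
  - have := eW (iG i ord_max); rewrite /= eqxx inord_max drop_poly_eq0 // deriv0 horner0.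
    by rewrite mulr0 mul0r !add0r addr0.
  - move=> m mn; have := eW (iH i (inord m)); rewrite /= inord_ltS //.
    rewrite inordK; last by lia.
    rewrite coef_poly mn (horner_drop_polyS m) /y => H.
    by apply: subr0_eq; rewrite -[RHS]H; ring.
  - move=> m mn; have := eW (iG i (inord m)); rewrite /= inord_ltS //.
    rewrite inordK; last by lia.
    rewrite (horner_deriv_drop_polyS m) /y => H.
    by apply: subr0_eq; rewrite -[RHS]H; ring.
  by move: h1 h2; rewrite inord0' drop_poly0l.
split=> // i.
- have [<- _] := hg i; have /= := eW (iV i); rewrite /y.
  move=> H; have {}H := congr2 +%R (value i) H.
  by apply: subr0_eq; apply: subr0_eq; rewrite -{2}(subrr (sg i * E + 0)) -{1}H; ring.
- move=> ci; have [_ <-] := hg i; have /= := eW (iX i); rewrite ci.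
  have [-> _] := crE ci; lra.
- move=> /negPf ci; have /= := eW (iX i); rewrite ci /y.
  by rewrite mul0r addr0 mulrN => /eqP; rewrite addrC subr_eq0 => /eqP ->; ring.
Qed.
End AlternationSystem.

(** * Perturbation of the minimax polynomial *)

Lemma common_radius (R : realType) (I : finType) (P : I -> R -> Prop) :
  (forall i, exists2 d : R, 0 < d & forall t, `|t| < d -> P i t) ->
  exists2 d : R, 0 < d & forall t, `|t| < d -> forall i, P i t.
Proof.
move=> h; have /choice [d hd] : forall i, exists d : R, 0 < d /\ forall t, `|t| < d -> P i t.
  by move=> i; have [d d0 Pd] := h i; exists d.
have S0 : 0 <= \sum_i (d i)^-1 by rewrite sumr_ge0 // => i _; rewrite invr_ge0 ltW //; case: (hd i).
(* This radius is at most every d i, and is positive also when I is empty. *)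
exists (1 + \sum_i (d i)^-1)^-1; first by rewrite invr_gt0; lra.
move=> t tS i; have [d0 hi] := hd i; apply: hi; apply: lt_le_trans tS _.
rewrite -[leRHS]invrK lef_pV2 ?posrE ?invr_gt0 //; last by lra.
rewrite (bigD1 i) //= addrCA lerDl addr_ge0 // sumr_ge0 // => j _.
by rewrite invr_ge0 ltW //; case: (hd j).
Qed.

Definition coef_close (R : realType) (N : nat) (r B : R) (Q : R -> {poly R}) (P : {poly R}) :=
  forall t, `|t| < r ->
    (size (Q t) <= N)%N /\ forall m, `|(Q t)`_m - P`_m| <= B * `|t|.

Lemma coef_close_deriv (R : realType) (N : nat) (r B : R) (Q : R -> {poly R}) (P : {poly R}) :
  (size P <= N)%N -> coef_close N r B Q P ->
  coef_close N r (N%:R * B) (fun t => (Q t)^`()) P^`().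
Proof.
move=> sP h t tr; have [sQ hQ] := h t tr; split.
  by apply: leq_trans (size_poly _ _) _; apply: leq_trans (leq_pred _) sQ.
have B0 : 0 <= B * `|t| by apply: le_trans (hQ 0%N).
move=> m; rewrite !coef_deriv -mulrnBl normrMn -mulrA.
case: (ltnP m.+1 N) => mN; last first.
  rewrite (nth_default _ (leq_trans sQ mN)) (nth_default _ (leq_trans sP mN)).
  by rewrite subrr normr0 mul0rn mulr_ge0.
rewrite -[leLHS]mulr_natl; apply: ler_pM => //.
by rewrite ler_nat; exact: ltnW.
Qed.

Lemma coef_close_box (R : realType) (N : nat) (r B : R) (Q : R -> {poly R}) (P : {poly R})
    (z0 e : R) :
  0 < r -> 0 <= B -> (size P <= N)%N -> coef_close N r B Q P -> -1 <= z0 <= 1 -> 0 < e ->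
  exists2 d, 0 < d & forall t z, `|t| < d -> `|z - z0| < d -> `|(Q t).[z] - P.[z0]| < e.
Proof.
move=> r0 B0 sP h z01 e0.
have e20 : 0 < e / 2 by lra.
have [d1 d10 h1] := poly_cont z0 P e20.
(* On |z| <= 2 each of the N monomials is at most 2^N. *)
pose C : R := N%:R * (B * 2 ^+ N).
have C0 : 0 <= C by rewrite !mulr_ge0 ?exprn_ge0.
pose d2 : R := e / 2 / (C + 1).
have d20 : 0 < d2 by rewrite divr_gt0 //; lra.
exists (Num.min (Num.min 1 r) (Num.min d1 d2)); first by rewrite !lt_min ltr01 r0 d10 d20.
move=> t z; rewrite !lt_min => /andP [/andP [_ tr] /andP [_ td]] /andP [/andP [z1 _] /andP [zd _]].
have -> : (Q t).[z] - P.[z0] = ((Q t).[z] - P.[z]) + (P.[z] - P.[z0]) by ring.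
have -> : e = e / 2 + e / 2 by lra.
apply: le_lt_trans (ler_normD _ _) _; apply: ltrD; last exact: h1.
have [sQ hQ] := h t tr.
have z2 : `|z| <= 2.
  have -> : z = (z - z0) + z0 by ring.
  apply: le_trans (ler_normD _ _) _; have -> : 2 = 1 + 1 :> R by lra.
  by apply: lerD; [exact: ltW|rewrite ler_norml].
apply: le_lt_trans (_ : C * `|t| < _); last first.
  move: td; rewrite /d2 ltr_pdivlMr; last lra.
  by apply: le_lt_trans; rewrite mulrC ler_wpM2l //; lra.
rewrite (horner_coef_wide _ sQ) (horner_coef_wide _ sP) -sumrB.
apply: le_trans (ler_norm_sum _ _ _) _.
apply: le_trans (_ : \sum_(i < N) (B * `|t|) * 2 ^+ N <= _); last first.
  rewrite sumr_const card_ord -[leLHS]mulr_natl /C le_eqVlt; apply/orP; left; apply/eqP; ring.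
apply: ler_sum => i _; rewrite -mulrBl normrM; apply: ler_pM => //.
rewrite normrX; apply: le_trans (_ : 2 ^+ i <= _); first by rewrite lerXn2r ?nnegrE.
by apply: ler_weXn2l; [lra|exact: ltnW].
Qed.

Lemma near_covering_box (R : realType) (P : R -> R -> Prop) :
  (forall z0, -1 <= z0 <= 1 -> exists2 d : R, 0 < d & forall t z : R,
     `|t| < d -> `|z - z0| < d -> -1 <= z <= 1 -> P t z) ->
  exists2 d : R, 0 < d & forall t z : R, `|t| < d -> -1 <= z <= 1 -> P t z.
Proof.
move=> h.
have : \forall t \near (0 : R), `[(-1 : R), 1]%classic `<=` (fun z => -1 <= z <= 1 -> P t z).
  have nc := iffLR (compact_near_coveringP _) (@segment_compact R (-1) 1).
  apply: (nc R (nbhs (0 : R)) (fun t z => -1 <= z <= 1 -> P t z) _) => z0 /=.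
  rewrite in_itv /= => /h [d d0 hd].
  exists (ball z0 d, ball (0 : R) d); first by split; exact: nbhsx_ballx.
  move=> [z t] /= [zd td] z1; apply: hd => //.
    by move: td; rewrite /ball /= sub0r normrN.
  by move: zd; rewrite /ball /= distrC.
move=> /nbhs_ballP [d /= d0 hd]; exists d => // t z td z1.
by apply: (hd t) => //=; rewrite ?in_itv // /ball /= sub0r normrN.
Qed.

(** The mean value theorem is used for g, and then for g' starting from the critical point y. *)
Lemma strict_max_of_concave (R : realType) (g : {poly R}) (u y z z0 d : R) :
  `|y - z0| < d -> `|z - z0| < d -> y != z -> g^`().[y] = 0 ->
  (forall w, `|w - z0| < d -> u * g^`()^`().[w] < 0) -> u * g.[z] < u * g.[y].
Proof.
move=> yd zd yz gy hd.
have cvx v w q : `|v - z0| < d -> `|w - z0| < d -> v <= q <= w -> `|q - z0| < d.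
  by rewrite !ltr_norml; lra.
case: (ltgtP y z) yz => // yz _.
  have [q qP e] := poly_mvt g yz; move: qP; rewrite in_itv /= => /andP [q1 q2].
  have [q' q'P e'] := poly_mvt g^`() q1; move: q'P; rewrite in_itv /= => /andP [q1' q2'].
  rewrite gy subr0 in e'.
  have qd : `|q' - z0| < d by apply: (cvx y z) => //; lra.
  rewrite -subr_lt0 -mulrBr e e' !mulrA.
  by rewrite pmulr_llt0 ?subr_gt0 // pmulr_llt0 ?subr_gt0 //; exact: hd.
have [q qP e] := poly_mvt g yz; move: qP; rewrite in_itv /= => /andP [q1 q2].
have [q' q'P e'] := poly_mvt g^`() q2; move: q'P; rewrite in_itv /= => /andP [q1' q2'].
rewrite gy sub0r in e'.
have qd : `|q' - z0| < d by apply: (cvx z y) => //; lra.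
have -> : u * g.[z] = u * g.[y] - u * (g.[y] - g.[z]) by ring.
rewrite e; have -> : g^`().[q] = - (g^`()^`().[q'] * (y - q)) by rewrite -e' opprK.
rewrite gtrDl oppr_lt0 mulNr mulrN oppr_gt0 !mulrA.
by rewrite pmulr_llt0 ?subr_gt0 // pmulr_llt0 ?subr_gt0 //; exact: hd.
Qed.

Lemma strict_max_of_monotone (R : realType) (g : {poly R}) (u v y z z0 d : R) :
  `|v| = 1 -> `|y - z0| < d -> `|z - z0| < d -> 0 < v * (z - y) ->
  (forall w, `|w - z0| < d -> v * u * g^`().[w] < 0) -> u * g.[z] < u * g.[y].
Proof.
move=> v1 yd zd vz hd.
have cvx p w q : `|p - z0| < d -> `|w - z0| < d -> p <= q <= w -> `|q - z0| < d.
  by rewrite !ltr_norml; lra.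
case: (norm1_cases v1) => ve; rewrite ve in vz hd.
  have yz : y < z by lra.
  have [q qP e] := poly_mvt g yz; move: qP; rewrite in_itv /= => /andP [q1 q2].
  have qd : `|q - z0| < d by apply: (cvx y z) => //; lra.
  have := hd q qd; rewrite mul1r => H.
  by rewrite -subr_lt0 -mulrBr e mulrA pmulr_llt0 ?subr_gt0.
have zy : z < y by lra.
have [q qP e] := poly_mvt g zy; move: qP; rewrite in_itv /= => /andP [q1 q2].
have qd : `|q - z0| < d by apply: (cvx z y) => //; lra.
have := hd q qd; rewrite mulN1r mulNr oppr_lt0 => H.
by rewrite -subr_gt0 -mulrBr e mulrA pmulr_lgt0 ?subr_gt0.
Qed.

(** Near the kink q varies more slowly than |z - y|, which is why the kink remains a strict local
    minimum of the error. *)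
Lemma contraction_gap (R : realType) (q : {poly R}) (y z z0 d : R) :
  `|y - z0| < d -> `|z - z0| < d -> y != z ->
  (forall w, `|w - z0| < d -> `|q^`().[w]| < 1) -> q.[z] - q.[y] < `|z - y|.
Proof.
move=> yd zd yz hd.
have cvx p w r : `|p - z0| < d -> `|w - z0| < d -> p <= r <= w -> `|r - z0| < d.
  by rewrite !ltr_norml; lra.
case: (ltgtP y z) yz => // yz _.
  have [r rP ->] := poly_mvt q yz; move: rP; rewrite in_itv /= => /andP [r1 r2].
  have := hd r (cvx y z r yd zd _); rewrite ltr_norml => H.
  have {}H := H ltac:(lra); rewrite gtr0_norm ?subr_gt0 //.
  by rewrite -[ltRHS]mul1r ltr_pM2r ?subr_gt0 //; case/andP: H.
have [r rP e] := poly_mvt q yz; move: rP; rewrite in_itv /= => /andP [r1 r2].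
have := hd r (cvx z y r zd yd _); rewrite ltr_norml => H.
have {}H := H ltac:(lra); rewrite ltr0_norm ?subr_lt0 // opprB.
have -> : q.[z] - q.[y] = (- q^`().[r]) * (y - z) by rewrite mulNr -e; ring.
by rewrite -[ltRHS]mul1r ltr_pM2r ?subr_gt0 //; lra.
Qed.

Section Perturbed.
Variables (R : realType) (N : nat) (I : finType) (a E : R) (p : {poly R}).
Variables (x s sg kp : I -> R) (cr : I -> bool).
Hypotheses (a1 : -1 < a < 1) (E0 : 0 < E) (sp : (size p <= N)%N).
Hypothesis eE : forall z, -1 <= z <= 1 -> `|approx_err a p z| <= E.
Hypothesis pk : `|p^`().[a]| < 1.
Hypothesis x1 : forall i, -1 <= x i <= 1.
Hypothesis reg : forall i, regular_point a p (x i).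
Hypothesis sg1 : forall i, `|sg i| = 1.
Hypothesis value : forall i, approx_err a p (x i) = sg i * E.
Hypothesis complete : forall z, -1 <= z <= 1 -> `|approx_err a p z| = E -> exists i, z = x i.
Hypothesis s_def : forall i, s i = if x i == a then 0 else slope a (x i).
Hypothesis kp_def : forall i, kp i = (x i == a)%:R.
Hypothesis cr_def : forall i, cr i = (x i != a) && (-1 < x i < 1).

Variables (r B : R) (Q : R -> {poly R}) (y : R -> I -> R) (F : R -> R).
Hypotheses (r0 : 0 < r) (B0 : 0 <= B).
Hypothesis closeQ : coef_close N r B Q p.
Hypothesis closeY : forall t, `|t| < r -> forall i, `|y t i - x i| <= B * `|t|.
Hypothesis closeF : forall t, `|t| < r -> `|F t - E| <= B * `|t|.
Hypothesis value_t : forall t, `|t| < r -> forall i,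
  s i * (y t i - (a + t)) - (Q t).[y t i] = sg i * F t.
Hypothesis crit_t : forall t, `|t| < r -> forall i, cr i -> (Q t)^`().[y t i] = s i.
Hypothesis fixed_t : forall t, `|t| < r -> forall i, ~~ cr i -> y t i = x i + kp i * t.

Let e t := approx_err (a + t) (Q t).

Lemma linear_rate_box (u : R -> R) (l e0 : R) : 0 < e0 ->
  (forall t, `|t| < r -> `|u t - l| <= B * `|t|) ->
  exists2 d, 0 < d <= r & forall t, `|t| < d -> `|u t - l| < e0.
Proof.
have BH := B0.
move=> e00 h; exists (Num.min r (e0 / (B + 1))).
  by rewrite lt_min r0 ge_min lexx /= andbT divr_gt0 //; lra.
move=> t; rewrite lt_min => /andP [/h tr]; rewrite ltr_pdivlMr; last lra.
by apply: le_lt_trans; apply: le_trans tr _; rewrite [leLHS]mulrC ler_wpM2l //; lra.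
Qed.

Lemma perturbed_err_box (z0 e0 : R) : -1 <= z0 <= 1 -> 0 < e0 ->
  exists2 d, 0 < d & forall t z, `|t| < d -> `|z - z0| < d ->
    `|e t z - approx_err a p z0| < e0.
Proof.
move=> z01 e00; have e30 : 0 < e0 / 3 by lra.
have [d d0 hd] := coef_close_box r0 B0 sp closeQ z01 e30.
exists (Num.min d (e0 / 3)); first by rewrite lt_min d0.
move=> t z; rewrite !lt_min => /andP [td t3] /andP [zd z3].
have -> : e t z - approx_err a p z0 =
    (`|z - (a + t)| - `|z0 - a|) - ((Q t).[z] - p.[z0]) by rewrite /e /approx_err; ring.
apply: le_lt_trans (ler_normB _ _) _.
have -> : e0 = (e0 / 3 + e0 / 3) + e0 / 3 by lra.
apply: ltrD; last exact: hd.
apply: le_lt_trans (ler_dist_dist _ _) _.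
have -> : z - (a + t) - (z0 - a) = (z - z0) - t by ring.
by apply: le_lt_trans (ler_normB _ _) _; apply: ltrD.
Qed.

(** The point follows the kink, y = a + t, and |p'| < 1 near a makes it a strict local minimum of
    the error; since the error is extremal there, its sign must be negative. *)
Lemma perturbed_kink (i : I) : x i = a -> exists2 d, 0 < d & forall t z,
  `|t| < d -> `|z - x i| < d -> z != y t i -> sg i * e t z < F t.
Proof.
have aH := a1.
move=> xa; rewrite xa.
have e0 : 0 < 1 - `|p^`().[a]| by rewrite subr_gt0.
have sp' : (size p^`() <= N)%N.
  by apply: leq_trans (size_poly _ _) _; apply: leq_trans (leq_pred _) sp.
have B0' : 0 <= N%:R * B by rewrite mulr_ge0.
have a1' : -1 <= a <= 1 by lra.
have [d1 d10 h1] := coef_close_box r0 B0' sp' (coef_close_deriv sp closeQ) a1' e0.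
have small t w : `|t| < d1 -> `|w - a| < d1 -> `|(Q t)^`().[w]| < 1.
  move=> td wd; have := h1 t w td wd.
  have := ler_normD ((Q t)^`().[w] - p^`().[a]) p^`().[a]; rewrite subrK; lra.
pose d := Num.min r d1.
have d0 : 0 < d by rewrite lt_min r0.
have ncr : ~~ cr i by rewrite cr_def xa eqxx.
have key t z : `|t| < d -> `|z - a| < d -> z != y t i -> sg i * F t < e t z.
  rewrite !lt_min => /andP [tr td] /andP [_ zd] zy.
  have yE : y t i = a + t by rewrite fixed_t // xa kp_def xa eqxx mul1r.
  have := value_t tr i; rewrite s_def xa eqxx mul0r sub0r => <-.
  have yd : `|y t i - a| < d1 by rewrite yE addrC addKr.
  have yz : y t i != z by rewrite eq_sym.
  have := contraction_gap yd zd yz (fun w => small t w td).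
  by rewrite /e /approx_err -yE; lra.
suff sgN : sg i = -1.
  by exists d => // t z td zd zy; have := key t z td zd zy; rewrite sgN; lra.
(* With a positive sign the unperturbed error would exceed E just to the right of a. *)
case: (norm1_cases (sg1 i)) => // sgP; exfalso.
have t0r : `|0 : R| < r by rewrite normr0.
have Q0 : Q 0 = p.
  apply/polyP => m; have [_ /(_ m)] := closeQ t0r.
  by rewrite normr0 mulr0 normr_le0 subr_eq0 => /eqP.
have F0 : F 0 = E.
  by have := closeF t0r; rewrite normr0 mulr0 normr_le0 subr_eq0 => /eqP.
have y0 : y 0 i = a by rewrite fixed_t // xa kp_def mulr0 addr0.
pose z := a + Num.min d (1 - a) / 2.
have m0 : 0 < Num.min d (1 - a) by rewrite lt_min d0; lra.
have [m1 m2] : Num.min d (1 - a) <= d /\ Num.min d (1 - a) <= 1 - a.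
  by split; rewrite ge_min lexx ?orbT.
have z1 : -1 <= z <= 1 by rewrite /z; lra.
have zd : `|z - a| < d by rewrite /z addrC addKr ger0_norm; lra.
have zy : z != y 0 i by rewrite y0 /z gt_eqF // ltrDl; lra.
have t0d : `|0 : R| < d by rewrite normr0.
have := key 0 z t0d zd zy; rewrite sgP mul1r F0 /e addr0 Q0.
by have := eE z1; rewrite ler_norml; lra.
Qed.

Lemma perturbed_same_side (i : I) : x i != a -> exists2 d, 0 < d & forall t z,
  `|t| < d -> `|z - x i| < d -> 0 <= s i * (z - (a + t)).
Proof.
move=> xa; exists (`|x i - a| / 2); first by rewrite divr_gt0 // normr_gt0 subr_eq0.
move=> t z; rewrite s_def (negPf xa) /slope.
case: (ltgtP (x i) a) xa => // xa _.
  have -> : `|x i - a| = a - x i by rewrite ltr0_norm ?subr_lt0 // opprB.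
  by rewrite !ltr_norml; lra.
have -> : `|x i - a| = x i - a by rewrite gtr0_norm ?subr_gt0.
by rewrite !ltr_norml; lra.
Qed.

(** The polynomial with which the error of [Q t] coincides on the side of x i. *)
Let g t i : {poly R} := s i *: ('X - (a + t)%:P) - Q t.

Lemma g_horner (t z : R) (i : I) : (g t i).[z] = s i * (z - (a + t)) - (Q t).[z].
Proof. by rewrite hornerD hornerN hornerZ hornerXsubC. Qed.

Lemma g_deriv (t z : R) (i : I) : (g t i)^`().[z] = s i - (Q t)^`().[z].
Proof. by rewrite derivB derivZ derivXsubC hornerD hornerN hornerZ hornerC mulr1. Qed.

Lemma g_deriv2 (t z : R) (i : I) : (g t i)^`()^`().[z] = - (Q t)^`()^`().[z].
Proof.
rewrite derivB derivZ derivXsubC derivB derivZ derivC scaler0 sub0r.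
by rewrite hornerN.
Qed.

Lemma side_norm (i : I) : x i != a -> `|s i| = 1.
Proof. by move=> xa; rewrite s_def (negPf xa) normr_slope. Qed.

Lemma err_side (i : I) (t z : R) : x i != a -> 0 <= s i * (z - (a + t)) ->
  e t z = (g t i).[z].
Proof. by move=> xa h; rewrite /e (approx_err_side _ (side_norm xa) h) g_horner. Qed.

(** As the error is extremal at x i, the product of sg i and p'' is positive there: the other sign
    would make it exceed E just to the right. This strict inequality persists nearby and makes y t i
    a strict maximum of sg i * e t. *)
Lemma perturbed_critical (i : I) : cr i -> p^`()^`().[x i] != 0 ->
  s i - p^`().[x i] = 0 -> exists2 d, 0 < d & forall t z,
  `|t| < d -> `|z - x i| < d -> z != y t i -> sg i * e t z < F t.
Proof.
have EH := E0.
move=> ci p2 crit; have := ci; rewrite cr_def => /andP [xa xin].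
have sgp : 0 < sg i * p^`()^`().[x i].
  have ne : sg i * p^`()^`().[x i] != 0 by rewrite mulf_neq0 // -normr_gt0 sg1.
  rewrite lt_neqAle eq_sym ne leNgt; apply/negP => neg.
  pose h : {poly R} := s i *: ('X - a%:P) - p.
  have h1 : h^`().[x i] = 0.
    by rewrite derivB derivZ derivXsubC hornerD hornerN hornerZ hornerC mulr1.
  have h2 : 0 < sg i * h^`()^`().[x i].
    rewrite derivB derivZ derivXsubC derivB derivZ derivC scaler0 sub0r hornerN mulrN.
    by rewrite oppr_gt0.
  have [d d0 hd] := critical_point_local_growth (normr1 R) h1 h2.
  have [d' d'0 hd'] := perturbed_same_side xa.
  pose m := Num.min (Num.min d d') (1 - x i).
  have m0 : 0 < m by rewrite !lt_min d0 d'0; lra.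
  have [m1 m2 m3] : [/\ m <= d, m <= d' & m <= 1 - x i] by rewrite /m !ge_min !lexx !orbT.
  pose z := x i + m / 2.
  have zx : z - x i = m / 2 by rewrite /z; ring.
  have z1 : -1 <= z <= 1 by rewrite /z; lra.
  have ez w : `|w - x i| < d' -> approx_err a p w = h.[w].
    move=> wd; have := hd' 0 w; rewrite addr0 normr0 => /(_ d'0 wd) hs.
    by rewrite (approx_err_side _ (side_norm xa) hs) hornerD hornerN hornerZ hornerXsubC.
  have := hd z; rewrite mul1r zx -!ez ?subrr ?normr0 //; last first.
    by rewrite zx ger0_norm; lra.
  move=> H; have {}H : 0 < sg i * (approx_err a p z - approx_err a p (x i)) by apply: H; lra.
  have := eE z1; rewrite leNgt => /negP; apply.
  apply: lt_le_trans (_ : sg i * approx_err a p z <= _); last first.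
    by apply: le_trans (ler_norm _) _; rewrite normrM sg1 mul1r.
  by move: H; rewrite value mulrBr mulrA norm1_sqr // mul1r; lra.
have e0 : 0 < `|p^`()^`().[x i]| by rewrite normr_gt0.
have sp' : (size p^`() <= N)%N.
  by apply: leq_trans (size_poly _ _) _; apply: leq_trans (leq_pred _) sp.
have sp'' : (size p^`()^`() <= N)%N.
  by apply: leq_trans (size_poly _ _) _; apply: leq_trans (leq_pred _) sp'.
have B0'' : 0 <= N%:R * (N%:R * B) by rewrite !mulr_ge0.
have [d1 d10 h1] := coef_close_box r0 B0'' sp''
  (coef_close_deriv sp' (coef_close_deriv sp closeQ)) (x1 i) e0.
have [d2 d20 h2] := perturbed_same_side xa.
pose dm := Num.min d1 d2.
have dm0 : 0 < dm by rewrite lt_min d10.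
have [d3 /andP [d30 d3r] h3] := linear_rate_box dm0 (fun t tr => closeY tr i).
exists (Num.min dm d3); first by rewrite lt_min dm0.
move=> t z; rewrite !lt_min -!andbA => /and3P [t1 t2 t3] /and3P [z1 z2 _] zy.
have tr : `|t| < r by exact: lt_le_trans d3r.
have := h3 t t3; rewrite lt_min => /andP [y1 y2].
rewrite (err_side xa (h2 t z t2 z2)).
have -> : F t = sg i * (g t i).[y t i].
  by rewrite g_horner value_t // mulrA norm1_sqr // mul1r.
apply: (strict_max_of_concave y1 z1); first by rewrite eq_sym.
  by rewrite g_deriv crit_t // subrr.
move=> w wd; rewrite g_deriv2 mulrN oppr_lt0.
have := h1 t w t1 wd; set q2 := (Q t)^`()^`().[w] => hq.
have -> : sg i * q2 = sg i * p^`()^`().[x i] + sg i * (q2 - p^`()^`().[x i]) by ring.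
have -> : sg i * p^`()^`().[x i] = `|p^`()^`().[x i]|.
  by rewrite -[LHS]gtr0_norm // normrM sg1 mul1r.
have : `|sg i * (q2 - p^`()^`().[x i])| < `|p^`()^`().[x i]| by rewrite normrM sg1 mul1r.
by rewrite ltr_norml; lra.
Qed.

(** The point stays at the end. By extremality and the nonzero derivative, sg i times the error
    strictly decreases inwards, and this persists for nearby parameters. *)
Lemma perturbed_endpoint (i : I) : x i = -1 \/ x i = 1 ->
  slope a (x i) - p^`().[x i] != 0 -> exists2 d, 0 < d & forall t z,
  `|t| < d -> `|z - x i| < d -> -1 <= z <= 1 -> z != y t i -> sg i * e t z < F t.
Proof.
have aH := a1.
move=> xe ncrit.
have xa : x i != a by case: xe => ->; [rewrite lt_eqF|rewrite gt_eqF]; lra.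
have sE : slope a (x i) = s i by rewrite s_def (negPf xa).
pose v := - x i; have v1 : `|v| = 1.
  by rewrite normrN; case: xe => ->; rewrite ?normrN normr1.
rewrite sE in ncrit.
have neg : v * sg i * (s i - p^`().[x i]) < 0.
  rewrite lt_neqAle; apply/andP; split.
    by rewrite !mulf_neq0 // -normr_gt0 ?v1 ?sg1.
  rewrite -sE; apply: (extremum_slope_sign xa (sg1 i) v1 (value i) eE).
  by exists 1 => // h; rewrite /v; case: xe => ->; lra.
have e0 : 0 < `|s i - p^`().[x i]| by rewrite normr_gt0.
have sp' : (size p^`() <= N)%N.
  by apply: leq_trans (size_poly _ _) _; apply: leq_trans (leq_pred _) sp.
have B0' : 0 <= N%:R * B by rewrite mulr_ge0.
have [d1 d10 h1] := coef_close_box r0 B0' sp' (coef_close_deriv sp closeQ) (x1 i) e0.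
have [d2 d20 h2] := perturbed_same_side xa.
exists (Num.min r (Num.min d1 d2)); first by rewrite !lt_min r0 d10.
move=> t z; rewrite !lt_min => /and3P [tr t1 t2] /and3P [_ z1 z2] z_in zy.
have ncr : ~~ cr i.
  by rewrite cr_def xa /=; case: xe => ->; rewrite ltxx ?andbF.
have yE : y t i = x i by rewrite fixed_t // kp_def (negPf xa) mul0r addr0.
rewrite (err_side xa (h2 t z t2 z2)).
have -> : F t = sg i * (g t i).[y t i].
  by rewrite g_horner value_t // mulrA norm1_sqr // mul1r.
have y1 : `|y t i - x i| < d1 by rewrite yE subrr normr0.
have vz : 0 < v * (z - y t i).
  by move: zy; rewrite yE /v; case: xe => ->; case: ltgtP => //; lra.
apply: (strict_max_of_monotone v1 y1 z1 vz) => w wd.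
rewrite g_deriv; have := h1 t w t1 wd; set q2 := (Q t)^`().[w] => hq.
have -> : v * sg i * (s i - q2) =
  v * sg i * (s i - p^`().[x i]) - v * sg i * (q2 - p^`().[x i]) by ring.
have -> : v * sg i * (s i - p^`().[x i]) = - `|s i - p^`().[x i]|.
  by have := ltr0_norm neg; rewrite !normrM v1 sg1 !mul1r => ->; rewrite opprK.
have : `|v * sg i * (q2 - p^`().[x i])| < `|s i - p^`().[x i]|.
  by rewrite !normrM v1 sg1 !mul1r.
by rewrite ltr_norml; lra.
Qed.

(** Near a point that is not extremal the gap below E persists. Near x i one of the three local
    lemmas bounds sg i * e t, and continuity makes this quantity positive, so that it is the
    absolute value. *)
Lemma perturbed_domination : exists2 d : R, 0 < d & forall t z : R,
  `|t| < d -> -1 <= z <= 1 -> `|e t z| < F t \/ exists i, z = y t i.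
Proof.
apply: near_covering_box => z0 z01.
have := eE z01; rewrite le_eqVlt => /predU1P [ez|ez]; last first.
  have gap : 0 < (E - `|approx_err a p z0|) / 2 by rewrite divr_gt0 // subr_gt0.
  have [d d0 hd] := perturbed_err_box z01 gap.
  have [d' /andP [d'0 _] hd'] := linear_rate_box gap closeF.
  exists (Num.min d d'); first by rewrite lt_min d0.
  move=> t z; rewrite !lt_min => /andP [t1 t2] /andP [z1 _] _; left.
  have := hd t z t1 z1; have := hd' t t2; rewrite ltr_norml => /andP [h1 _] h2.
  have := ler_normD (e t z - approx_err a p z0) (approx_err a p z0).
  by rewrite subrK; lra.
have [i xi] := complete z01 ez.
have [d d0 hd] : exists2 d, 0 < d & forall t z,
    `|t| < d -> `|z - x i| < d -> -1 <= z <= 1 -> z != y t i -> sg i * e t z < F t.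
  case: (reg i) => [xa|[xa xin crit p2]|[xe nc]].
  - by have [d d0 hd] := perturbed_kink xa; exists d => // t z *; exact: hd.
  - have ci : cr i by rewrite cr_def xa xin.
    have sE : s i = slope a (x i) by rewrite s_def (negPf xa).
    rewrite -sE in crit.
    by have [d d0 hd] := perturbed_critical ci p2 crit; exists d => // t z *; exact: hd.
  - exact: perturbed_endpoint.
have [d' d'0 hd'] := perturbed_err_box z01 E0.
exists (Num.min d d'); first by rewrite lt_min d0.
move=> t z; rewrite !lt_min => /andP [t1 t2] /andP [z1 z2] z_in.
have [zy|zy] := eqVneq z (y t i); first by right; exists i.
left; rewrite xi in z1 z2 hd'; have := hd t z t1 z1 z_in zy.
have pos : 0 < sg i * e t z.
  have := hd' t z t2 z2; rewrite value.
  have -> : sg i * e t z = E + sg i * (e t z - sg i * E).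
    have -> : E + sg i * (e t z - sg i * E) = sg i * e t z + (1 - sg i * sg i) * E by ring.
    by rewrite norm1_sqr // subrr mul0r addr0.
  move=> h; have : `|sg i * (e t z - sg i * E)| < E by rewrite normrM sg1 mul1r.
  by rewrite ltr_norml; lra.
have es : `|sg i * e t z| = `|e t z| by rewrite normrM sg1 mul1r.
by rewrite -es gtr0_norm.
Qed.

(** The position relative to the kink is recorded because it fixes which indices belong to the left
    and to the right enumeration. *)
Lemma perturbed_values : exists2 d : R, 0 < d & forall t, `|t| < d -> forall i,
  [/\ -1 <= y t i <= 1, e t (y t i) = sg i * F t, (y t i < a + t) = (x i < a) &
    (a + t < y t i) = (a < x i)].
Proof.
have aH := a1.
apply: common_radius => i.
have [xa|xa] := eqVneq (x i) a.
  have m0 : 0 < Num.min r (Num.min (1 - a) (1 + a)) by rewrite !lt_min r0; lra.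
  exists (Num.min r (Num.min (1 - a) (1 + a))) => // t.
  rewrite !lt_min !ltr_norml => /and3P [tr ta ta'].
  have ncr : ~~ cr i by rewrite cr_def xa eqxx.
  have tr' : `|t| < r by rewrite ltr_norml.
  have yE : y t i = a + t by rewrite fixed_t // xa kp_def xa eqxx mul1r.
  rewrite yE xa !ltxx; split => //; first lra.
  by rewrite -(value_t tr' i) yE /e /approx_err subrr normr0 mulr0.
have [d2 d20 h2] := perturbed_same_side xa.
have x_in : exists2 d, 0 < d & forall t, `|t| < d -> -1 <= y t i <= 1.
  case ci : (cr i); last first.
    exists r => // t tr; rewrite fixed_t ?ci // kp_def (negPf xa) mul0r addr0; exact: x1.
  have := ci; rewrite cr_def xa /= => xin.
  have m0 : 0 < Num.min (1 - x i) (1 + x i) by rewrite lt_min; lra.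
  have [d /andP [d0 _] hd] := linear_rate_box m0 (fun t tr => closeY tr i).
  by exists d => // t /hd; rewrite lt_min !ltr_norml; lra.
have [d1 d10 h1] := x_in.
have xa0 : 0 < `|x i - a| / 2 by rewrite divr_gt0 // normr_gt0 subr_eq0.
have m0 : 0 < Num.min d2 (`|x i - a| / 2) by rewrite lt_min d20.
have [d3 /andP [d30 d3r] h3] := linear_rate_box m0 (fun t tr => closeY tr i).
exists (Num.min (Num.min d1 (`|x i - a| / 2)) (Num.min d2 d3)).
  by rewrite !lt_min d10 xa0 d20.
move=> t; rewrite !lt_min => /andP [/andP [t1 ta] /andP [t2 t3]].
have tr : `|t| < r by exact: lt_le_trans d3r.
have := h3 t t3; rewrite lt_min => /andP [y2 ya].
have ord : (y t i < a + t) = (x i < a) /\ (a + t < y t i) = (a < x i).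
  move: ta ya; case: (ltgtP (x i) a) xa => // xa _.
    have -> : `|x i - a| = a - x i by rewrite ltr0_norm ?subr_lt0 // opprB.
    rewrite !ltr_norml => ta ya; have lt : y t i < a + t by lra.
    by rewrite lt lt_gtF.
  have -> : `|x i - a| = x i - a by rewrite gtr0_norm ?subr_gt0.
  rewrite !ltr_norml => ta ya; have lt : a + t < y t i by lra.
  by rewrite lt lt_gtF.
case: ord => o1 o2; split => //; first exact: h1.
by rewrite (err_side xa (h2 t _ t2 y2)) g_horner value_t.
Qed.

Lemma perturbed_order (i j : I) : x i < x j ->
  exists2 d : R, 0 < d & forall t, `|t| < d -> y t i < y t j.
Proof.
move=> xij; have m0 : 0 < (x j - x i) / 2 by rewrite divr_gt0 // subr_gt0.
have [d /andP [d0 _] hd] := linear_rate_box m0 (fun t tr => closeY tr i).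
have [d' /andP [d'0 _] hd'] := linear_rate_box m0 (fun t tr => closeY tr j).
exists (Num.min d d'); first by rewrite lt_min d0.
by move=> t; rewrite lt_min => /andP [/hd + /hd']; rewrite !ltr_norml; lra.
Qed.

Lemma perturbed_level_gt0 : exists2 d : R, 0 < d & forall t, `|t| < d -> 0 < F t.
Proof.
have EH := E0.
have [d /andP [d0 _] hd] := linear_rate_box E0 closeF.
by exists d => // t /hd; rewrite ltr_norml; lra.
Qed.

End Perturbed.

(** * Analyticity at regular parameters *)

Lemma analytic_at_of_series (R : realType) (G : R -> R) (a E d : R) (c : R^nat) (W : R -> R) :
  0 < d -> (forall t, `|t| < d -> pseries c t @ \oo --> W t) ->
  (forall t, `|t| < d -> G (a + t) = E + W t) -> analytic_at G a.
Proof.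
move=> d0 cW GW; exists d, (fun k => (if k is 0%N then E else 0) + c k); split => // z zd.
have -> : G z = E + W (z - a) by rewrite -GW //; congr G; ring.
set t := z - a in zd *.
(* The constant E sits in the coefficient of index 0 and is missing from the empty partial sum;
   hence the shift. *)
rewrite -(cvg_shiftS (pseries _ t)).
have -> : [sequence pseries (fun k => (if k is 0%N then E else 0) + c k) t n.+1]_n =
    (fun n => E + pseries c t n.+1).
  apply/funext => n; rewrite /pseries /series /= !big_nat_recl //= expr0 !mulr1 addrA.
  by congr (_ + _); apply: eq_bigr => k _; rewrite add0r.
apply: cvgD; first exact: cvg_cst.
by rewrite (cvg_shiftS (pseries c t)); exact: cW.
Qed.

Lemma nth_alternates (R : realType) (e : R -> R) (E t : R) (s : seq R) :
  (forall i, (i.+1 < size s)%N -> nth 0 s i < nth 0 s i.+1) ->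
  (forall i, (i < size s)%N -> e (nth 0 s i) = t * (-1) ^+ i * E) ->
  alternates e E t s.
Proof.
elim: s t => // x s IH t h1 h2; apply/and3P; split.
- by case: s h1 {h2 IH} => // y s /(_ 0%N isT).
- by have := h2 0%N isT; rewrite expr0 mulr1 => /= ->.
apply: IH => i iN; first exact: (h1 i.+1).
by have /= -> := h2 i.+1 iN; rewrite exprS; ring.
Qed.

Lemma finite_set_of_seq (R : realType) (A : set R) (l : seq R) :
  (forall x, A x -> x \in l) -> finite_set A.
Proof.
move=> h; apply: (@sub_finite_set _ _ [set` l]); first by move=> x /h.
exact: finite_seq.
Qed.

Lemma left_altE (R : realType) (n : nat) (a : R) (l : seq R) : sorted <%R l ->
  (forall x, alternation n a x <-> x \in l) ->
  left_alt n a = rev [seq x <- l | x < a].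
Proof.
move=> srt lA; have sf : sorted <%R [seq x <- l | x < a].
  by apply: sorted_filter srt; exact: lt_trans.
have /andP [uf sle] : uniq [seq x <- l | x < a] && sorted <=%R [seq x <- l | x < a].
  by rewrite -lt_sorted_uniq_le.
have fin : finite_set (alternation n a `&` [set x | x < a]).
  by apply: (@finite_set_of_seq _ _ l) => x [/lA].
apply: (@sorted_eq _ (>=%R : rel R) ge_trans).
- move=> u v /andP [uv vu]; apply/eqP; rewrite eq_le; apply/andP.
  by split; [exact: vu|exact: uv].
- by apply: sort_sorted => u v; exact: le_total.
- by rewrite rev_sorted.
rewrite perm_sort; apply: uniq_perm; rewrite ?rev_uniq ?fset_uniq //.
move=> x; rewrite mem_rev mem_filter in_fset_set //.
apply/idP/andP; first by move/set_mem => [/lA].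
by move=> [xa /lA xA]; apply: mem_set.
Qed.

Lemma right_altE (R : realType) (n : nat) (a : R) (l : seq R) : sorted <%R l ->
  (forall x, alternation n a x <-> x \in l) ->
  right_alt n a = [seq x <- l | a < x].
Proof.
move=> srt lA; have sf : sorted <%R [seq x <- l | a < x].
  by apply: sorted_filter srt; exact: lt_trans.
have /andP [uf sle] : uniq [seq x <- l | a < x] && sorted <=%R [seq x <- l | a < x].
  by rewrite -lt_sorted_uniq_le.
have fin : finite_set (alternation n a `&` [set x | a < x]).
  by apply: (@finite_set_of_seq _ _ l) => x [/lA].
apply: (@sorted_eq _ (<=%R : rel R) le_trans) => //.
- exact: le_anti.
- by apply: sort_sorted => u v; exact: le_total.
rewrite perm_sort; apply: uniq_perm; rewrite ?fset_uniq //.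
move=> x; rewrite mem_filter in_fset_set //.
apply/idP/andP; first by move/set_mem => [/lA].
by move=> [xa /lA xA]; apply: mem_set.
Qed.

(** One family of series serves all quantities. The index lists on the right-hand sides do not
    depend on t, so the enumerations do not jump. *)
Lemma regular_parameter_series (R : realType) (n : nat) (a : R) :
  -1 < a < 1 -> ~ Vshape_exceptional (@Eerr R n) a ->
  exists (d : R) (x : 'I_n.+2 -> R) (c : alt_index n -> R^nat) (W : R -> alt_index n -> R),
    0 < d /\ forall t, `|t| < d ->
    [/\ forall j, pseries (c j) t @ \oo --> W t j,
      Eerr n (a + t) = Eerr n a + W t (iV ord_max),
      forall m, (m <= n)%N ->
        (minimax n (a + t))`_m = (minimax n a)`_m + W t (iV (inord m)),
      left_alt n (a + t) =
        [seq x i + W t (iX i) | i <- rev [seq i <- enum 'I_n.+2 | x i < a]] &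
      right_alt n (a + t) =
        [seq x i + W t (iX i) | i <- [seq i <- enum 'I_n.+2 | a < x i]]].
Proof.
move=> a1 nexc; have E0 := Eerr_gt0 n a1.
have [t0 [l [t01 sl alt lA reg]]] := regular_alternation a1 nexc.
have [sp _] := minimax_spec n a; have pk := minimax_deriv_kink n a1.
have [l_inc l_val] := alternates_nth alt.
set p := minimax n a in alt lA reg sp pk l_val *; set E := Eerr n a in E0 alt l_val *.
pose x (i : 'I_n.+2) := nth 0 l i.
have xl i : x i \in l by rewrite mem_nth // sl.
(* The value 0 at the kink makes |y - (a + t)| disappear from the level equation of the point that
   follows it. *)
pose s i := if x i == a then 0 else slope a (x i).
pose sg (i : 'I_n.+2) := t0 * (-1) ^+ i.
pose kp i : R := (x i == a)%:R.
pose cr i := (x i != a) && (-1 < x i < 1).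
have x1 i : -1 <= x i <= 1 by have /lA /alternationP [] := xl i.
have sg1 i : `|sg i| = 1 by rewrite normrM normrX normrN normr1 expr1n t01 mul1r.
have xinc (i j : 'I_n.+2) : (i < j)%N -> x i < x j.
  have srt := alternates_sorted alt.
  by move=> ij; rewrite /x; apply: (sorted_ltn_nth lt_trans) => //; rewrite inE sl.
have value i : approx_err a p (x i) = sg i * E by rewrite /x l_val // sl.
have value' i : s i * (x i - a) - p.[x i] = sg i * E.
  rewrite -value /s; case: eqVneq => [->|xa]; first by rewrite /approx_err subrr normr0 mul0r.
  have [d d0 /(_ p (x i))] := near_same_side xa.
  by rewrite subrr normr0 => /(_ d0) [_ ->]; rewrite hornerD hornerN hornerZ hornerXsubC.
have crE i : cr i -> s i = p^`().[x i] /\ p^`()^`().[x i] != 0.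
  rewrite /cr /s => /andP [xa x11]; rewrite (negPf xa).
  case: (reg _ (xl i)) => [xa'|[_ _ crit p2]|[xe _]].
  - by rewrite xa' eqxx in xa.
  - by split => //; apply/eqP; rewrite -subr_eq0 crit.
  - by move: x11; case: xe => ->; rewrite ltxx ?andbF.
have [r [B [c [W [r0 h]]]]] := alternation_continuation kp sp xinc t01
  (fun=> erefl) crE value'.
pose Q t : {poly R} := \poly_(m < n.+1) (p`_m + W t (iV (inord m))).
pose y t i := x i + W t (iX i).
pose F t := E + W t (iV ord_max).
have B0 : 0 <= B.
  have r2 : `|r / 2| < r by rewrite gtr0_norm; lra.
  have [_ /(_ (iV ord0)) h1 _ _ _] := h _ r2.
  have : 0 <= B * `|r / 2| by apply: le_trans h1.
  by rewrite pmulr_lge0 // normr_gt0; lra.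
have closeQ : coef_close n.+1 r B Q p.
  move=> t /h [_ bW _ _ _]; split; first exact: size_poly.
  move=> m; rewrite coef_poly; case: ltnP => mn; first by rewrite addrAC subrr add0r.
  by rewrite nth_default ?subrr ?normr0 ?(le_trans _ (bW (iV ord0))) // (leq_trans sp).
have closeY t : `|t| < r -> forall i, `|y t i - x i| <= B * `|t|.
  by move=> /h [_ bW _ _ _] i; rewrite /y addrAC subrr add0r.
have closeF t : `|t| < r -> `|F t - E| <= B * `|t|.
  by move=> /h [_ bW _ _ _]; rewrite /F addrAC subrr add0r.
have value_t t : `|t| < r -> forall i,
    s i * (y t i - (a + t)) - (Q t).[y t i] = sg i * F t.
  by move=> /h [].
have crit_t t : `|t| < r -> forall i, cr i -> (Q t)^`().[y t i] = s i.
  by move=> /h [].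
have fixed_t t : `|t| < r -> forall i, ~~ cr i -> y t i = x i + kp i * t.
  by move=> /h [].
have complete z : -1 <= z <= 1 -> `|approx_err a p z| = E -> exists i, z = x i.
  move=> z1 ez; have zl : z \in l by apply/lA/alternationP.
  have zi : (index z l < n.+2)%N by rewrite -sl index_mem.
  by exists (Ordinal zi); rewrite /x /= nth_index.
have eE := @Eerr_ub _ n a.
have regx i : regular_point a p (x i) by exact: reg.
have [d1 d10 h1] := perturbed_domination a1 E0 sp eE pk x1 regx sg1 value complete
  (fun=> erefl) (fun=> erefl) (fun=> erefl) r0 B0 closeQ closeY closeF value_t crit_t fixed_t.
have [d2 d20 h2] := perturbed_values a1 x1 (fun=> erefl) (fun=> erefl) (fun=> erefl)
  r0 B0 closeY value_t fixed_t.
have [d3 d30 h3] : exists2 d : R, 0 < d & forall t, `|t| < d ->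
    forall ij : 'I_n.+2 * 'I_n.+2, (ij.1 < ij.2)%N -> y t ij.1 < y t ij.2.
  apply: (common_radius (P := fun (ij : 'I_n.+2 * 'I_n.+2) t =>
    (ij.1 < ij.2)%N -> y t ij.1 < y t ij.2)) => -[i j] /=.
  case: (ltnP i j) => ij; last by exists 1.
  by have [d d0 hd] := perturbed_order r0 B0 closeY (xinc i j ij); exists d => // t /hd.
have [d4 d40 h4] := perturbed_level_gt0 E0 r0 B0 closeF.
exists (Num.min (Num.min d1 d2) (Num.min r (Num.min d3 d4))), x, c, W.
split; first by rewrite !lt_min d10 d20 r0 d30.
move=> t; rewrite !lt_min => /andP [/andP [t1 t2] /and3P [tr t3 t4]].
pose lt := [seq y t i | i <- enum 'I_n.+2].
have slt : size lt = n.+2 by rewrite size_map size_enum_ord.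
have nlt i (iN : (i < n.+2)%N) : nth 0 lt i = y t (Ordinal iN).
  rewrite (nth_map ord0) ?size_enum_ord //; congr (y t _).
  by apply: val_inj; rewrite /= nth_enum_ord.
have altt : alternates (approx_err (a + t) (Q t)) (F t) t0 lt.
  apply: nth_alternates => i; rewrite slt => iN.
    by rewrite (nlt _ iN) (nlt _ (ltnW iN)); apply: (h3 t t3 (Ordinal _, Ordinal _)) => /=.
  by rewrite (nlt _ iN); have [_ -> _ _] := h2 t t2 (Ordinal iN).
have bound z : -1 <= z <= 1 -> `|approx_err (a + t) (Q t) z| <= F t.
  move=> z1; have [/ltW //|[i ->]] := h1 t z t1 z1.
  by have [_ -> _ _] := h2 t t2 i; rewrite normrM sg1 mul1r gtr0_norm // h4.
have sQ : (size (Q t) <= n.+1)%N by exact: size_poly.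
have ylt i : y t i \in lt by apply: map_f; rewrite mem_enum.
have [mt Et] : minimax n (a + t) = Q t /\ Eerr n (a + t) = F t.
  apply: (alternates_minimax t01 sQ altt) => //; first by rewrite slt.
  by move=> _ /mapP [i _ ->]; have [] := h2 t t2 i.
have ltA z : alternation n (a + t) z <-> z \in lt.
  rewrite alternationP mt Et; split.
    move=> [z1 ez]; have [|[i ->] //] := h1 t z t1 z1.
    by rewrite /= -/(approx_err (a + t) (Q t) z) ez ltxx.
  move=> /mapP [i _ ->]; have [y1 -> _ _] := h2 t t2 i.
  by split => //; rewrite normrM sg1 mul1r gtr0_norm // h4.
have srt := alternates_sorted altt.
split.
- by have [] := h t tr.
- exact: Et.
- by move=> m mn; rewrite mt coef_poly ltnS mn.
- rewrite (left_altE srt ltA) filter_map map_rev; congr (rev (map _ _)).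
  by apply: eq_filter => i /=; have [] := h2 t t2 i.
- rewrite (right_altE srt ltA) filter_map; congr (map _ _).
  by apply: eq_filter => i /=; have [] := h2 t t2 i.
Qed.

Theorem theorem1 (R : realType) (n : nat) (alpha0 : R)
  (halpha0 : -1 < alpha0 < 1)
  (hexc : ~ Vshape_exceptional (@Eerr R n) alpha0) :
  [/\ analytic_at (@Eerr R n) alpha0,
      (forall i : nat, (i < size (left_alt n alpha0))%N ->
         (\forall alpha \near alpha0, (i < size (left_alt n alpha))%N) /\
         analytic_at (@u_pt R n i) alpha0),
      (forall j : nat, (j < size (right_alt n alpha0))%N ->
         (\forall alpha \near alpha0, (j < size (right_alt n alpha))%N) /\
         analytic_at (@v_pt R n j) alpha0) &
      (forall m : nat, (m <= n)%N ->
         analytic_at (fun alpha : R => (minimax n alpha)`_m) alpha0)].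
Proof.
have [d [x [c [W [d0 h]]]]] := regular_parameter_series halpha0 hexc.
have cW j t : `|t| < d -> pseries (c j) t @ \oo --> W t j by move=> /h [].
have at0 : `|0 : R| < d by rewrite normr0.
have near_shift (P : R -> Prop) : (forall t, `|t| < d -> P (alpha0 + t)) ->
    \forall alpha \near alpha0, P alpha.
  move=> hP; apply/nbhs_ballP; exists d => //= z zd.
  have -> : z = alpha0 + (z - alpha0) by ring.
  by apply: hP; rewrite distrC.
split.
- by apply: (analytic_at_of_series d0 (cW (iV ord_max))) => t /h [_ -> _ _ _]; exact: erefl.
- have [_ _ _ l0 _] := h 0 at0; rewrite addr0 in l0.
  move=> i; rewrite l0 size_map => iN; split.
    by apply: near_shift => t /h [_ _ _ -> _]; rewrite size_map.
  (* The point that is i-th to the left of the kink has the same index k for all small t. *)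
  pose k := nth ord0 (rev [seq i <- enum 'I_n.+2 | x i < alpha0]) i.
  apply: (analytic_at_of_series d0 (cW (iX k))) => t /h [_ _ _ e _].
  by rewrite /u_pt e (nth_map ord0) //; exact: erefl.
- have [_ _ _ _ r0] := h 0 at0; rewrite addr0 in r0.
  move=> i; rewrite r0 size_map => iN; split.
    by apply: near_shift => t /h [_ _ _ _ ->]; rewrite size_map.
  pose k := nth ord0 [seq i <- enum 'I_n.+2 | alpha0 < x i] i.
  apply: (analytic_at_of_series d0 (cW (iX k))) => t /h [_ _ _ _ e].
  by rewrite /v_pt e (nth_map ord0) //; exact: erefl.
- move=> m mn.
  by apply: (analytic_at_of_series d0 (cW (iV (inord m)))) => t /h [_ _ -> // _ _]; exact: erefl.
Qed.
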